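(* Let $(\mathcal A,E,B)$ be an operator-valued probability space, with operator-valued free cumulants $\kappa_n$ and boolean cumulants $\beta_n$. Let $k,b:\mathcal W\to T(\mathrm{Hom}(B))$ be the infinitesimal morphisms on $\mathcal W$ such that, for $n\ge1$, $a_1,\dots,a_n\in\mathcal A$, $b_0,\dots,b_n\in B$, $$k(a_1\cdots a_n)(b_0,\dots,b_n)=\kappa_n(b_0a_1b_1,a_2b_2,\dots,a_nb_n),\qquad b(a_1\cdots a_n)(b_0,\dots,b_n)=\beta_n(b_0a_1b_1,a_2b_2,\dots,a_nb_n).$$ Denote also by $E$ the horizontal algebra morphism $\mathcal W\to T(\mathrm{Hom}(B))$ such that $$E(a_1\cdots a_n)(b_0,\dots,b_n)=E(b_0a_1b_1a_2b_2\cdots a_nb_n)$$ (the product on the right being taken in $\mathcal A$), with $E(\emptyset)=\mathrm{id}_B$ on the empty word. Then $$E=\eta_{\mathrm{Hom}(B)}\circ\varepsilon^{\mathcal W}+k\prec E=\eta_{\mathrm{Hom}(B)}\circ\varepsilon^{\mathcal W}+E\succ b.$$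
   Context: Operator-valued probability space: $B$ is a unital involutive complex algebra, $\mathcal A$ is a unital involutive complex algebra with a compatible $B$-$B$-bimodule algebra structure (left and right actions commute and are compatible with product and involution), and $E:\mathcal A\to B$ is a linear positive unital $B$-bimodule map: $E(b_1ab_2)=b_1E(a)b_2$, $E(aa^* )\in BB^*$, $E(1_{\mathcal A})=1_B$. Cumulants: $\mathrm{NC}(n)$ and $\mathrm{Int}(n)$ denote the non-crossing partitions, resp. interval partitions (all blocks are intervals of consecutive integers), of $\{1,\dots,n\}$; $\mathbf 1_n$ is the one-block partition. Given multilinear maps $\kappa_n:\mathcal A^n\to B$, one sets $\kappa_{\mathbf 1_n}=\kappa_n$ and, for $\pi\in\mathrm{NC}(n)$, $\pi\ne\mathbf 1_n$, choosing a block of $\pi$ that is an interval $\{r,\dots,l\}$ and letting $\pi_1$ be the restriction of $\pi$ to the complement, $\kappa_\pi(a_1,\dots,a_n)=\kappa_{\pi_1}(a_1,\dots,a_{r-1},\kappa_{l-r+1}(a_r,\dots,a_l)a_{l+1},\dots,a_n)$ if $l<n$, and $\kappa_\pi(a_1,\dots,a_n)=\kappa_{\pi_1}(a_1,\dots,a_{r-1}\kappa_{l-r+1}(a_r,\dots,a_n))$ if $l=n$ (the result does not depend on the choice for the cumulants below). The same definition gives $\beta_I$ from maps $\beta_n$. The free cumulants $\kappa_n$ and boolean cumulants $\beta_n$ are defined inductively by $E(a_1\cdots a_n)=\sum_{\pi\in\mathrm{NC}(n)}\kappa_\pi(a_1,\dots,a_n)=\sum_{I\in\mathrm{Int}(n)}\beta_I(a_1,\dots,a_n)$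 for all $n\ge1$, $a_i\in\mathcal A$. Bicollections: all vector spaces are over $\mathbb C$. A bicollection is a family $P=(P(n,m))_{n,m\ge 0}$ of vector spaces ($n$ outputs, $m$ inputs); morphisms are families of linear maps. Vertical tensor product: $(P\boxtimes Q)(n,m)=\bigoplus_{k\ge 0}P(n,k)\otimes Q(k,m)$, with unit $\mathbf 1_v$ ($\mathbf 1_v(n,n)=\mathbb C1_n$, zero for $n\neq m$). For a family $(P(n))_{n\ge1}$ of vector spaces, $T(P)$ is the bicollection of words: $T(P)(0,0)=\mathbb C1$ and $T(P)(n,m)=\bigoplus_{k_1+\cdots+k_n=m}P(k_1)\otimes\cdots\otimes P(k_n)$ otherwise. Its horizontal product is concatenation; on $T(P)\boxtimes T(P)$ set $(a\boxtimes b)(a'\boxtimes b')=aa'\boxtimes bb'$. A morphism of bicollections compatible with horizontal products and units is a horizontal algebra morphism. $\mathrm{Hom}(B)$ is the operad $\mathrm{Hom}(B)(n)=\mathrm{Hom}(B^{\otimes n},B)$, $n\ge1$, with composition of multilinear maps. $\nabla_{\mathrm{Hom}(B)}:T(\mathrm{Hom}(B))\boxtimes T(\mathrm{Hom}(B))\to T(\mathrm{Hom}(B))$ sends $(p^1\cdots p^n)\boxtimes(q_1\cdots q_N)$, with $N=\sum_i|p^i|$ the total number of inputs, to the word whose $i$-th letter is $p^i$ composed with its consecutive group of $|p^i|$ letters $q_j$. $\eta_{\mathrm{Hom}(B)}:\mathbf 1_v\to T(\mathrm{Hom}(B))$, $1_n\mapsto\mathrm{id}_B^{\,n}$. Words: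 $\bar T(\mathcal A)(n)=\mathcal A^{\otimes(n-1)}$, $n\ge1$, with $\bar T(\mathcal A)(1)=\mathbb C\emptyset$ spanned by the empty word; $\mathcal W=T(\bar T(\mathcal A))$, with concatenation written $|$; a word $a_1\cdots a_p$ stands for $a_1\otimes\cdots\otimes a_p$ and has $p+1$ inputs. $\Delta^{\mathcal W}:\mathcal W\to\mathcal W\boxtimes\mathcal W$ is the horizontal algebra morphism with $\Delta^{\mathcal W}(x)=\sum_S x_S\boxtimes(U_0|\cdots|U_{|S|})$ for $x=a_1\cdots a_p$, over all subsets $S\subset\{1,\dots,p\}$ of letter positions, where $x_S$ is the subword with positions in $S$ and $U_0,\dots,U_{|S|}$ are the (possibly empty) words of consecutive letters before, between and after the positions of $S$. $\varepsilon^{\mathcal W}:\mathcal W\to\mathbf 1_v$ is $\varepsilon^{\mathcal W}(\emptyset^n)=1_n$, zero on words with a non-empty letter. For a word $w\in\mathcal W$ with a non-empty letter, $\Delta^{\mathcal W}_\prec(w)$ is the sum of the terms $\alpha\boxtimes\beta$ of $\Delta^{\mathcal W}(w)$ in which the first letter of the first non-empty word of $w$ belongs to $\alpha$ and $\alpha\neq w$; $\Delta^{\mathcal W}_\succ(w)$ is the sum of those in which it belongs to $\beta$ and $\beta\ne w$. For bicollection morphisms $f,g:\mathcal W\to T(\mathrm{Hom}(B))$ vanishing on all $\emptyset^n$: $f\prec g=\nabla_{\mathrm{Hom}(B)}\circ(f\boxtimes g)\circ\Delta^{\mathcal W}_\prec$ and $f\succ g=\nabla_{\mathrm{Hom}(B)}\circ(f\boxtimes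 g)\circ\Delta^{\mathcal W}_\succ$ on words with a non-empty letter (zero on $\emptyset^n$); with $e=\eta_{\mathrm{Hom}(B)}\circ\varepsilon^{\mathcal W}$, $f\prec e=e\succ f=f$ and $e\prec f=f\succ e=0$, and the products are extended bilinearly (so $k\prec E=k+k\prec(E-e)$ and $E\succ b=b+(E-e)\succ b$). An infinitesimal morphism $k:\mathcal W\to T(\mathrm{Hom}(B))$ is a bicollection morphism with $k(\emptyset^p|w|\emptyset^q)=\mathrm{id}_B^{\,p}\,k(w)\,\mathrm{id}_B^{\,q}$ for every non-empty word $w$ on $\mathcal A$, $p,q\ge0$, and zero on all words of $\mathcal W$ not of this form. *)

(* Defs.v *)
From HB Require Import structures.
From mathcomp Require Import all_boot all_order all_algebra ring_quotient.
From mathcomp Require Import boolp functions reals.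
From mathcomp Require Import complex.
From mathcomp.multinomials Require Import freeg.

Set Implicit Arguments.
Unset Strict Implicit.
Unset Printing Implicit Defensive.

Import Order.TTheory GRing.Theory Num.Theory.
Local Open Scope ring_scope.
Local Open Scope quotient_scope.

(* Every tensor construction below is a vector space presented by a set [X]   *)
(* of generators and the relations [z = c *: x + y] for [rel c x y z]: the    *)
(* free vector space on [X] modulo the span of these relations.               *)
Section Presented.
Variables (K : fieldType) (X : Type) (rel : K -> X -> X -> X -> Prop).
Local Notation free := {freeg {classic X} / K}.

Definition relator (c : K) (x y z : {classic X}) : free :=
  << z >> - (c *: << x >> + << y >>).

Definition relators_span : {pred free} := fun v =>
  `[< forall U : {pred free}, submod_closed U ->
      (forall c x y z, rel c x y z -> relator c x y z \in U) -> v \in U >].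

Lemma relators_span_submod : submod_closed relators_span.
Proof.
split=> [|c u v]; first by apply/asboolP => U [].
move=> /asboolP hu /asboolP hv; apply/asboolP => U cU rU.
by have [_ +] := cU; apply; [apply: hu | apply: hv].
Qed.

Lemma relators_span_zmod : zmod_closed relators_span.
Proof.
have [h0 h] := relators_span_submod; split=> // u v hu hv.
by have := h (-1) v u hv hu; rewrite scaleN1r addrC.
Qed.

HB.instance Definition _ :=
  GRing.isZmodClosed.Build free relators_span relators_span_zmod.

Definition presented : Type := Quotient.quot relators_span.
HB.instance Definition _ := GRing.Zmodule.on presented.

Definition pclass (u : free) : presented := \pi_(Quotient.quot relators_span) u.
Definition prepr (u : presented) : free := repr (u : Quotient.quot relators_span).

Lemma preprK u : pclass (prepr u) = u. Proof. exact: reprK. Qed.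

Lemma pclassB u v : pclass (u - v) = pclass u - pclass v.
Proof. exact: (raddfB \pi_(Quotient.quot relators_span)). Qed.

Lemma pclassD u v : pclass (u + v) = pclass u + pclass v.
Proof. exact: (raddfD \pi_(Quotient.quot relators_span)). Qed.

Lemma pclass_eq u v : pclass u = pclass v <-> u - v \in relators_span.
Proof. by rewrite Quotient.idealrBE; split=> [/eqP|/eqP]. Qed.

Definition pscale (c : K) (u : presented) : presented := pclass (c *: prepr u).

Lemma pclassZ c u : pclass (c *: u) = pscale c (pclass u).
Proof.
apply/pclass_eq; rewrite -scalerBr.
have [h0 h] := relators_span_submod.
rewrite -[_ *: _]addr0; apply: h => //; apply/pclass_eq; by rewrite preprK.
Qed.

Fact pscaleA a b u : pscale a (pscale b u) = pscale (a * b) u.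
Proof. by rewrite -[u]preprK -!pclassZ scalerA. Qed.
Fact pscale1 : left_id 1 pscale.
Proof. by move=> u; rewrite -[u]preprK -!pclassZ scale1r. Qed.
Fact pscaleDr : right_distributive pscale +%R.
Proof.
move=> c u v; rewrite -[u]preprK -[v]preprK -pclassD -!pclassZ.
by rewrite scalerDr pclassD.
Qed.
Fact pscaleDl u : {morph pscale^~ u : a b / a + b}.
Proof. by move=> a b; rewrite -[u]preprK -!pclassZ scalerDl pclassD. Qed.

HB.instance Definition _ := GRing.Zmodule_isLmodule.Build K presented
  pscaleA pscale1 pscaleDr pscaleDl.

Lemma pclass_linear : linear pclass.
Proof. by move=> c u v; rewrite pclassD pclassZ. Qed.

Definition gen (x : X) : presented := pclass << (x : {classic X}) >>.

Section Lift.
Variable V : lmodType K.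

Definition respects (f : X -> V) :=
  forall c x y z, rel c x y z -> f z = c *: f x + f y.

(* The linear extension of [f] to the presented space.  It is independent of  *)
(* the representative, and linear, when [f] respects the relations (see       *)
(* [plift_gen] and [plift_is_linear]).                                        *)
Definition plift (f : X -> V) (u : presented) : V :=
  fglift (f : {classic X} -> V) (prepr u).

End Lift.

Section LiftTheory.
Variable V : lmodType K.
Implicit Types f g : X -> V.

Lemma fglift_linear (f : {classic X} -> V) : linear (fglift f).
Proof.
have fD (D1 D2 : free) : fglift f (D1 + D2) = fglift f D1 + fglift f D2.
  have N (D : free) : fglift f (- D) = - fglift f D.
    by have := lift_is_additive f 0 D; rewrite sub0r => ->;
       have := lift_is_additive f 0 0; rewrite !subrr => ->; rewrite sub0r.
  by rewrite -[D2]opprK lift_is_additive [fglift f (- - D2)]N N opprK.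
have f0 : fglift f (0 : free) = 0.
  by have := lift_is_additive (f : {classic X} -> V) 0 0; rewrite !subrr.
have fS I (r : seq I) (F : I -> free) :
    fglift f (\sum_(i <- r) F i) = \sum_(i <- r) fglift f (F i).
  by elim: r => [|i r IH]; rewrite ?big_nil // !big_cons fD IH.
move=> c u v; rewrite fD; congr (_ + _).
rewrite -{2}[u]freeg_sumE fS scaler_sumr.
have -> : c *: u = \sum_(x <- dom u) << c * coeff x u *g x >> by [].
by rewrite fS; apply: eq_bigr => x _; rewrite !liftU scalerA.
Qed.

Lemma fglift_comb c f g (u : free) :
  fglift (fun x : {classic X} => c *: f x + g x) u
  = c *: fglift (f : {classic X} -> V) u + fglift (g : {classic X} -> V) u.
Proof.
have lin h := fglift_linear h.
pose M h : {linear free -> V} := HB.pack (fglift h)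
  (GRing.isLinear.Build _ _ _ _ (fglift h) (lin h)).
have E h : fglift h =1 M h by [].
rewrite !E -[u]freeg_sumE !raddf_sum -big_split.
apply: eq_bigr => x _.
by rewrite /= !liftU scalerDr !scalerA mulrC.
Qed.

Lemma plift_comb c f g u :
  plift (fun x => c *: f x + g x) u = c *: plift f u + plift g u.
Proof. exact: fglift_comb. Qed.

Lemma eq_plift f g : f =1 g -> plift f =1 plift g.
Proof. by move=> /funext ->. Qed.

Variable (f : X -> V) (hf : respects f).

Lemma plift_pclass u : plift f (pclass u) = fglift (f : {classic X} -> V) u.
Proof.
pose F := fglift (f : {classic X} -> V).
have lin : linear F by exact: fglift_linear.
have F0 : F 0 = 0 by have := lift_is_additive (f : {classic X} -> V) 0 0; rewrite !subrr.
have FB v w : F (v - w) = F v - F w by exact: lift_is_additive.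
apply/eqP; rewrite -subr_eq0 -[_ - _]FB.
have /pclass_eq/asboolP h := preprK (pclass u).
have/h : submod_closed (fun v => F v == 0).
  split=> [|c x y]; rewrite !unfold_in ?F0 // => /eqP hx /eqP hy.
  by rewrite lin hx hy scaler0 addr0.
apply=> c x y z /hf fz.
by rewrite unfold_in /relator FB lin /F !liftU !scale1r fz subrr.
Qed.

Lemma plift_gen x : plift f (gen x) = f x.
Proof. by rewrite plift_pclass liftU scale1r. Qed.

Lemma plift_is_linear : linear (plift f).
Proof.
move=> c u v; rewrite -[u]preprK -[v]preprK.
have -> : c *: pclass (prepr u) = pclass (c *: prepr u) by rewrite pclassZ.
by rewrite -pclassD !plift_pclass fglift_linear.
Qed.

Definition plift_map of respects f := plift f.
HB.instance Definition _ := GRing.isLinear.Build K presented V *:%R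
  (plift_map hf) plift_is_linear.

End LiftTheory.

Lemma gen_respects : respects gen.
Proof.
move=> c x y z r; rewrite /gen.
have -> : c *: pclass << (x : {classic X}) >> = pclass (c *: << (x : {classic X}) >>).
  by rewrite pclassZ.
rewrite -pclassD; apply/pclass_eq; apply/asboolP => U _; exact.
Qed.

Lemma presented_ext (V : lmodType K) (f g : presented -> V) :
  linear f -> linear g -> (forall x, f (gen x) = g (gen x)) -> f =1 g.
Proof.
move=> lf lg fg u; rewrite -[u]preprK.
have lc (h : presented -> V) : linear h -> linear (fun v : free => h (pclass v)).
  by move=> lh c v w; rewrite pclass_linear lh.
pose F : {linear free -> V} := HB.pack (fun v : free => f (pclass v))
  (GRing.isLinear.Build _ _ _ _ _ (lc f lf)).
pose G : {linear free -> V} := HB.pack (fun v : free => g (pclass v))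
  (GRing.isLinear.Build _ _ _ _ _ (lc g lg)).
rewrite -[LHS]/(F _) -[RHS]/(G _) -[prepr u]freeg_sumE !raddf_sum /=.
apply: eq_bigr => x _.
have -> : << coeff x (prepr u) *g x >> = coeff x (prepr u) *: (<< x >> : free).
  by apply/eqP/freeg_eqP => y; rewrite coeffZ !coeffU mul1r.
have -> : pclass (coeff x (prepr u) *: (<< x >> : free))
          = coeff x (prepr u) *: gen x by exact: pclassZ.
have Z (h : presented -> V) c v : linear h -> h (c *: v) = c *: h v.
  move=> lh; have h0 : h 0 = 0.
    by apply: (addIr (h 0)); rewrite add0r -{1}[h 0]scale1r -lh scaler0 addr0.
  by rewrite -[c *: v]addr0 lh h0 addr0.
by rewrite !Z // fg.
Qed.

End Presented.

(* [entry_lin c x y z]: the lists [x], [y], [z] agree except in one entry,    *)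
(* where the entry of [z] is [c *: x_i + y_i].  A map on lists (or tuples) is *)
(* multilinear iff it respects this relation.                                 *)
Definition entry_lin (K : fieldType) (V : lmodType K) (c : K) (x y z : seq V) :=
  exists u v a b,
    [/\ x = u ++ a :: v, y = u ++ b :: v & z = u ++ (c *: a + b) :: v].

Definition multilinear (K : fieldType) (U V : lmodType K) (n : nat)
    (f : n.-tuple U -> V) :=
  respects (fun c (x y z : n.-tuple U) => entry_lin c x y z) f.

Definition tensor_power (K : fieldType) (V : lmodType K) (n : nat) : lmodType K :=
  presented (fun c (x y z : n.-tuple V) => entry_lin c x y z).

Section Bicollections.
Variable K : fieldType.

(* [P n m]: [n] outputs, [m] inputs.                                          *)
Definition bicollection := nat -> nat -> lmodType K.

Definition bimorphism (P Q : bicollection) :=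
  forall n m, {linear P n m -> Q n m}.

Definition bicomp (P Q S : bicollection)
    (g : bimorphism Q S) (f : bimorphism P Q) : bimorphism P S :=
  fun n m => g n m \o f n m.

Definition bisub (P Q : bicollection) (f g : bimorphism P Q) : bimorphism P Q :=
  fun n m => f n m \- g n m.

Section Vertical.
Variables P Q : bicollection.

Definition vpair n m := {k : nat & (P n k * Q k m)%type}.
Definition mkvpair n m k (p : P n k) (q : Q k m) : vpair n m :=
  Tagged (fun k => (P n k * Q k m)%type) (p, q).

Definition bilinear_rel n m (c : K) (x y z : vpair n m) : Prop :=
  (exists k (p p' : P n k) (q : Q k m),
    [/\ x = mkvpair p q, y = mkvpair p' q & z = mkvpair (c *: p + p') q]) \/
  (exists k (p : P n k) (q q' : Q k m),
    [/\ x = mkvpair p q, y = mkvpair p q' & z = mkvpair p (c *: q + q')]).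

Definition vtensor : bicollection := fun n m => presented (@bilinear_rel n m).

Definition vten n m k (p : P n k) (q : Q k m) : vtensor n m :=
  gen _ (mkvpair p q).

Lemma vtenPl n m k c (p p' : P n k) (q : Q k m) :
  vten (c *: p + p') q = c *: vten p q + vten p' q.
Proof. by apply: gen_respects; left; exists k, p, p', q. Qed.

Lemma vtenPr n m k c (p : P n k) (q q' : Q k m) :
  vten p (c *: q + q') = c *: vten p q + vten p q'.
Proof. by apply: gen_respects; right; exists k, p, q, q'. Qed.

Lemma respects_bilinear n m (V : lmodType K) (h : forall k, P n k -> Q k m -> V) :
  (forall k c p p' q, h k (c *: p + p') q = c *: h k p q + h k p' q) ->
  (forall k c p q q', h k p (c *: q + q') = c *: h k p q + h k p q') ->
  respects (@bilinear_rel n m) (fun x => h (tag x) (tagged x).1 (tagged x).2).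
Proof.
move=> hl hr c x y z [] [k [p [p' [q [-> -> ->]]]]]; first exact: hl.
exact: hr.
Qed.

End Vertical.

Section VerticalMap.
Variables (P P' Q Q' : bicollection).
Variables (f : bimorphism P P') (g : bimorphism Q Q').

Fact vmap_respects n m : respects (@bilinear_rel P Q n m)
  (fun x => vten (f n (tag x) (tagged x).1) (g (tag x) m (tagged x).2)).
Proof.
apply: (@respects_bilinear P Q n m _ (fun k p q => vten (f n k p) (g k m q))).
  by move=> k c p p' q; rewrite linearP vtenPl.
by move=> k c p q q'; rewrite linearP vtenPr.
Qed.

Definition vmap : bimorphism (vtensor P Q) (vtensor P' Q') :=
  fun n m => plift_map (@vmap_respects n m).

Lemma vmapE n m k (p : P n k) (q : Q k m) :
  vmap n m (vten p q) = vten (f n k p) (g k m q).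
Proof. by rewrite /vmap /= /plift_map (plift_gen (@vmap_respects n m)). Qed.

End VerticalMap.

(* A row vector of dimension 1 if [n = m], and 0 otherwise; [1_n] is the      *)
(* vector with entries 1.                                                     *)
Definition vunit : bicollection := fun n m => 'rV[K]_(n == m).

End Bicollections.

Section Words.
Variable K : fieldType.
(* A family [(P(n))_{n >= 1}] of vector spaces is encoded as                  *)
(* [P : nat -> lmodType K] with [P k] standing for the space [P(k+1)], so     *)
(* that an element of [P k] has [k.+1] inputs.                                *)
Variable P : nat -> lmodType K.

Definition letter := {k : nat & P k}.

Definition mkletter k (x : P k) : letter := Tagged P x.

Definition arity (l : letter) : nat := (tag l).+1.

Definition inputs (w : seq letter) : nat := sumn (map arity w).

Definition word n m := {w : seq letter | (size w == n) && (inputs w == m)}.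

Definition letter_lin (c : K) (x y z : seq letter) : Prop :=
  exists u v k (a b : P k), [/\ x = u ++ mkletter a :: v,
    y = u ++ mkletter b :: v & z = u ++ mkletter (c *: a + b) :: v].

Definition word_lin n m (c : K) (x y z : word n m) : Prop :=
  letter_lin c (val x) (val y) (val z).

(* The bicollection [T(P)].                                                   *)
Definition words : bicollection K := fun n m => presented (@word_lin n m).

(* The class in [T(P)(n,m)] of a list of [n] letters with [m] inputs in total *)
(* (0 for any other list).                                                    *)
Definition wclass n m (w : seq letter) : words n m :=
  if insub w is Some x then gen _ (x : word n m) else 0.

Lemma letter_lin_dims c x y z : letter_lin c x y z ->
  [/\ size x = size z, size y = size z, inputs x = inputs z & inputs y = inputs z].
Proof.
case=> u [v [k [a [b [-> -> ->]]]]].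
by rewrite /inputs !size_cat !map_cat !sumn_cat.
Qed.

Lemma wclass_respects n m : respects letter_lin (wclass n m).
Proof.
move=> c x y z r; rewrite /wclass.
have [sx sy ix iy] := letter_lin_dims r.
case: (boolP ((size z == n) && (inputs z == m))) => hz; last first.
  by rewrite !insubN ?sx ?ix ?sy ?iy // scaler0 addr0.
have hx : (size x == n) && (inputs x == m) by rewrite sx ix.
have hy : (size y == n) && (inputs y == m) by rewrite sy iy.
rewrite (insubT (fun w => (size w == n) && (inputs w == m)) hx).
rewrite (insubT (fun w => (size w == n) && (inputs w == m)) hy).
rewrite (insubT (fun w => (size w == n) && (inputs w == m)) hz).
exact: gen_respects.
Qed.

Lemma wclass_gen n m (w : word n m) : wclass n m (val w) = gen _ w.
Proof. by rewrite /wclass valK. Qed.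

End Words.

(* Bilinear extension of an operation [h] on words.                           *)
Section WordOperation.
Variables (K : fieldType) (P Q : nat -> lmodType K) (n m n' m' : nat).
Variables (V : lmodType K) (h : seq (letter P) -> seq (letter Q) -> V).

Definition wlift2 (x : words P n m) (y : words Q n' m') : V :=
  plift (fun u : word P n m => plift (fun v : word Q n' m' => h (val u) (val v)) y) x.

Hypothesis hl : forall v : word Q n' m',
  respects (@word_lin _ P n m) (fun u => h (val u) (val v)).
Hypothesis hr : forall u : word P n m,
  respects (@word_lin _ Q n' m') (fun v => h (val u) (val v)).

Let hl' (y : words Q n' m') : respects (@word_lin _ P n m) (fun u => plift (fun v : word Q n' m' => h (val u) (val v)) y).
Proof.
move=> c u1 u2 u3 r; rewrite -plift_comb; apply: eq_plift => v.
exact: (hl v r).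
Qed.

Lemma wlift2Pl y : linear (wlift2^~ y).
Proof. exact: plift_is_linear. Qed.

Lemma wlift2Pr x : linear (wlift2 x).
Proof.
move=> c y1 y2; rewrite /wlift2 -plift_comb; apply: eq_plift => u.
exact: plift_is_linear.
Qed.

Lemma wlift2_gen (u : word P n m) (v : word Q n' m') :
  wlift2 (wclass n m (val u)) (wclass n' m' (val v)) = h (val u) (val v).
Proof. by rewrite !wclass_gen /wlift2 plift_gen // plift_gen. Qed.

End WordOperation.

(* The horizontal product of [T(P)]: concatenation of words.                  *)
Definition hprod (K : fieldType) (P : nat -> lmodType K) n m n' m'
    (x : words P n m) (y : words P n' m') : words P (n + n')%N (m + m')%N :=
  wlift2 (fun u v => wclass (n + n')%N (m + m')%N (u ++ v)) x y.

Lemma hprodE (K : fieldType) (P : nat -> lmodType K) n m n' m'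
    (u : word P n m) (v : word P n' m') :
  hprod (wclass n m (val u)) (wclass n' m' (val v))
  = wclass (n + n')%N (m + m')%N (val u ++ val v).
Proof.
apply: (wlift2_gen (h := fun u v => wclass (n + n')%N (m + m')%N (u ++ v))) => w.
  move=> c x y z [s [t [k [a [b [-> -> ->]]]]]]; apply: wclass_respects.
  by exists s, (t ++ val w), k, a, b; rewrite -!catA.
move=> c x y z [s [t [k [a [b [-> -> ->]]]]]]; apply: wclass_respects.
by exists (val w ++ s), t, k, a, b; rewrite -!catA.
Qed.

Definition hmorphism (K : fieldType) (P Q : nat -> lmodType K)
    (f : bimorphism (words P) (words Q)) : Prop :=
  f 0 0 (wclass 0 0 [::]) = wclass 0 0 [::] /\
  forall n m n' m' (x : words P n m) (y : words P n' m'),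
    f (n + n')%N (m + m')%N (hprod x y) = hprod (f n m x) (f n' m' y).

Section EndomorphismOperad.
Variables (K : fieldType) (B : lmodType K).

Definition multilinear_maps n : {pred n.-tuple B -> B} :=
  fun f => `[< multilinear f >].

Fact multilinear_maps_submod n : submod_closed (@multilinear_maps n).
Proof.
split=> [|a f g /asboolP hf /asboolP hg]; apply/asboolP => c x y z r /=.
  by rewrite /= scaler0 addr0.
rewrite -[LHS]/(a *: f z + g z) (hf _ _ _ _ r) (hg _ _ _ _ r).
rewrite -[(a *: f + g) x]/(a *: f x + g x) -[(a *: f + g) y]/(a *: f y + g y).
by rewrite !scalerDr !scalerA [a * c]mulrC addrACA.
Qed.

HB.instance Definition _ n := GRing.isSubmodClosed.Build K (n.-tuple B -> B)
  (@multilinear_maps n) (@multilinear_maps_submod n).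

(* The multilinear maps with [k.+1] arguments, in accordance with [letter].   *)
Record hom k := Hom {
  hom_fun :> k.+1.-tuple B -> B;
  _ : hom_fun \in @multilinear_maps k.+1 }.

HB.instance Definition _ k := [isSub for @hom_fun k].
HB.instance Definition _ k := [Choice of hom k by <:].
HB.instance Definition _ k := [SubChoice_isSubLmodule of hom k by <:].

Definition HomB : nat -> lmodType K := fun k => hom k.

Lemma homP k (f : hom k) : multilinear f.
Proof. by case: f => f /= /asboolP. Qed.

Definition mkhom k (f : k.+1.-tuple B -> B) (hf : multilinear f) : hom k :=
  Hom (introT (asboolP _) hf).

(* [l(s)] for a letter [l] and a list [s] of [arity l] elements of [B]        *)
(* (0 for a list of another length).                                          *)
Definition app (l : letter HomB) (s : seq B) : B :=
  if insub s is Some t then (tagged l : hom (tag l)) t else 0.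

Lemma app_multilinear l : respects (@entry_lin K B) (app l).
Proof.
case: l => k f c x y z r; rewrite /app /=.
have [sx sy] : size x = size z /\ size y = size z.
  by case: r => u [v [a [b [-> -> ->]]]]; rewrite !size_cat.
case: (boolP (size z == k.+1)) => hz; last first.
  by rewrite !insubN ?sx ?sy // scaler0 addr0.
have hx : size x == k.+1 by rewrite sx.
have hy : size y == k.+1 by rewrite sy.
rewrite (insubT (fun s : seq B => size s == k.+1) hx).
rewrite (insubT (fun s : seq B => size s == k.+1) hy).
rewrite (insubT (fun s : seq B => size s == k.+1) hz).
exact: homP.
Qed.

(* [s] is cut in consecutive groups, fed to the successive letters of [q].    *)
Fixpoint apps (q : seq (letter HomB)) (s : seq B) : seq B :=
  if q is l :: q' then
    app l (take (arity l) s) :: apps q' (drop (arity l) s)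
  else [::].

Lemma apps_entry q c x y z : size z = inputs q ->
  entry_lin c x y z -> entry_lin c (apps q x) (apps q y) (apps q z).
Proof.
elim: q x y z => [|l q IH] x y z sz [u [v [a [b [ex ey ez]]]]] /=.
  by move: sz; rewrite ez size_cat addnS.
have [hu|hu] := ltnP (size u) (arity l).
  have tk w d : take (arity l) (u ++ d :: w) = u ++ d :: take (arity l - (size u).+1)%N w.
    rewrite take_cat ltnNge (ltnW hu) /= -[(arity l - _)%N]prednK ?subn_gt0 //=.
    by rewrite subnS.
  have dr w d : drop (arity l) (u ++ d :: w) = drop (arity l - (size u).+1)%N w.
    rewrite drop_cat ltnNge (ltnW hu) /= -[(arity l - _)%N]prednK ?subn_gt0 //=.
    by rewrite subnS.
  rewrite ex ey ez !tk !dr.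
  exists [::], (apps q (drop (arity l - (size u).+1)%N v)),
    (app l (u ++ a :: take (arity l - (size u).+1)%N v)),
    (app l (u ++ b :: take (arity l - (size u).+1)%N v)).
  split=> //=; congr (_ :: _); apply: app_multilinear.
  by exists u, (take (arity l - (size u).+1)%N v), a, b.
have tk d : take (arity l) (u ++ d) = take (arity l) u by rewrite takel_cat.
have dr d : drop (arity l) (u ++ d) = drop (arity l) u ++ d.
  rewrite drop_cat; case: ltnP => // h.
  have -> : arity l = size u by apply/eqP; rewrite eqn_leq hu h.
  by rewrite drop_size subnn drop0.
rewrite ex ey ez !tk !dr.
have [] := IH (drop (arity l) u ++ a :: v) (drop (arity l) u ++ b :: v)
  (drop (arity l) u ++ (c *: a + b) :: v).
- by rewrite -dr -ez size_drop sz /inputs /= addKn.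
- by exists (drop (arity l) u), v, a, b.
move=> u' [v' [a' [b' [-> -> ->]]]].
by exists (app l (take (arity l) u) :: u'), v', a', b'.
Qed.

Fact compose_multilinear (p : letter HomB) (q : seq (letter HomB)) :
  multilinear (fun s : (inputs q).-1.+1.-tuple B => app p (apps q s)).
Proof.
case: q => [|l q] c x y z r.
  by rewrite /= /app !insubN ?scaler0 ?addr0.
by apply: app_multilinear; apply: apps_entry; [rewrite size_tuple | exact: r].
Qed.

(* The operadic composition of [p] with the list [q] of [arity p] letters.    *)
Definition compose (p : letter HomB) (q : seq (letter HomB)) : letter HomB :=
  mkletter (mkhom (@compose_multilinear p q) : HomB (inputs q).-1).

Fixpoint compose_word (p q : seq (letter HomB)) : seq (letter HomB) :=
  if p is l :: p' then
    compose l (take (arity l) q) :: compose_word p' (drop (arity l) q)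
  else [::].

Definition nabla_op n m k (p : words HomB n k) (q : words HomB k m) :
    words HomB n m :=
  wlift2 (fun u v => wclass n m (compose_word u v)) p q.

Lemma app_mkhom k (f : k.+1.-tuple B -> B) (hf : multilinear f) (t : k.+1.-tuple B) :
  app (mkletter (mkhom hf : HomB k)) t = f t.
Proof. by rewrite /app /= valK. Qed.

Lemma letter_linP c (l1 l2 l3 : letter HomB) :
  tag l1 = tag l3 -> tag l2 = tag l3 ->
  (forall t : (arity l3).-tuple B, app l3 t = c *: app l1 t + app l2 t) ->
  exists k (a b : HomB k),
    [/\ l1 = mkletter a, l2 = mkletter b & l3 = mkletter (c *: a + b)].
Proof.
case: l1 l2 l3 => [k a] [k2 b] [k3 d] /= e1 e2; subst k3; subst k2 => h.
exists k, a, b; split=> //; congr (Tagged _ _); apply: val_inj; apply/funext => t.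
by have := h t; rewrite /app /= valK.
Qed.

Lemma compose_word_l q c x y z :
  letter_lin c x y z ->
  letter_lin c (compose_word x q) (compose_word y q) (compose_word z q).
Proof.
case=> u [v [k [a [b [-> -> ->]]]]].
elim: u q => [|l u IH] q /=; last first.
  have [u' [v' [k' [a' [b' [-> -> ->]]]]]] := IH (drop (arity l) q).
  by exists (compose l (take (arity l) q) :: u'), v', k', a', b'.
set q1 := take _ q; set q2 := drop _ q.
have [|||k' [a' [b' [-> -> ->]]]] := @letter_linP c
  (compose (mkletter a) q1) (compose (mkletter b) q1)
  (compose (mkletter (c *: a + b)) q1) => //.
  move=> t; rewrite !app_mkhom /app /=.
  by case: insubP => [s _ _|_] //; rewrite scaler0 addr0.
by exists [::], (compose_word v q2), k', a', b'.
Qed.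

Lemma app_comb k c (a b : HomB k) s :
  app (mkletter (c *: a + b)) s = c *: app (mkletter a) s + app (mkletter b) s.
Proof. by rewrite /app /=; case: insubP => [t _ _|_] //; rewrite scaler0 addr0. Qed.

Lemma apps_letter c x y z s :
  letter_lin c x y z -> entry_lin c (apps x s) (apps y s) (apps z s).
Proof.
case=> u [v [k [a [b [-> -> ->]]]]].
elim: u s => [|l u IH] s /=; last first.
  have [u' [v' [a' [b' [-> -> ->]]]]] := IH (drop (arity l) s).
  by exists (app l (take (arity l) s) :: u'), v', a', b'.
rewrite app_comb.
by exists [::], (apps v (drop k.+1 s)), (app (mkletter a) (take k.+1 s)),
  (app (mkletter b) (take k.+1 s)).
Qed.

Lemma compose_word_r p c x y z : inputs p = size z ->
  letter_lin c x y z ->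
  letter_lin c (compose_word p x) (compose_word p y) (compose_word p z).
Proof.
elim: p x y z => [|l p IH] x y z sz [u [v [k [a [b [ex ey ez]]]]]] /=.
  by move: sz; rewrite ez size_cat addnS.
have [hu|hu] := ltnP (size u) (arity l).
  have tk w d : take (arity l) (u ++ d :: w) = u ++ d :: take (arity l - (size u).+1)%N w.
    rewrite take_cat ltnNge (ltnW hu) /= -[(arity l - _)%N]prednK ?subn_gt0 //=.
    by rewrite subnS.
  have dr w d : drop (arity l) (u ++ d :: w) = drop (arity l - (size u).+1)%N w.
    rewrite drop_cat ltnNge (ltnW hu) /= -[(arity l - _)%N]prednK ?subn_gt0 //=.
    by rewrite subnS.
  rewrite ex ey ez !tk !dr; set v1 := take _ v; set v2 := drop _ v.
  have r : letter_lin c (u ++ mkletter a :: v1) (u ++ mkletter b :: v1)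
     (u ++ mkletter (c *: a + b) :: v1) by exists u, v1, k, a, b.
  have [_ _ i1 i2] := letter_lin_dims r.
  have [|||k' [a' [b' [-> -> ->]]]] := @letter_linP c
    (compose l (u ++ mkletter a :: v1)) (compose l (u ++ mkletter b :: v1))
    (compose l (u ++ mkletter (c *: a + b) :: v1)).
  - by rewrite /= i1.
  - by rewrite /= i2.
  - move=> t; rewrite {1}/compose app_mkhom.
    have E q : inputs q = inputs (u ++ mkletter (c *: a + b) :: v1) ->
        app (compose l q) t = app l (apps q t).
      move=> e; have st : size t == (inputs q).-1.+1 by rewrite size_tuple /= e.
      by rewrite -[tval t]/(tval (Tuple st)) app_mkhom.
    by rewrite !E //; apply: app_multilinear; apply: apps_letter.
  by exists [::], (compose_word p v2), k', a', b'.
have tk d : take (arity l) (u ++ d) = take (arity l) u by rewrite takel_cat.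
have dr d : drop (arity l) (u ++ d) = drop (arity l) u ++ d.
  rewrite drop_cat; case: ltnP => // h.
  have -> : arity l = size u by apply/eqP; rewrite eqn_leq hu h.
  by rewrite drop_size subnn drop0.
rewrite ex ey ez !tk !dr.
have [] := IH (drop (arity l) u ++ mkletter a :: v)
  (drop (arity l) u ++ mkletter b :: v)
  (drop (arity l) u ++ mkletter (c *: a + b) :: v).
- by rewrite -dr -ez size_drop -sz /inputs /= addKn.
- by exists (drop (arity l) u), v, k, a, b.
move=> u' [v' [k' [a' [b' [-> -> ->]]]]].
by exists (compose l (take (arity l) u) :: u'), v', k', a', b'.
Qed.

Section NablaOp.
Variables n m k : nat.

Let hl (v : word HomB k m) : respects (@word_lin _ HomB n k)
  (fun u => wclass n m (compose_word (val u) (val v))).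
Proof.
by move=> c x y z r; apply: wclass_respects; apply: compose_word_l.
Qed.

Let hr (u : word HomB n k) : respects (@word_lin _ HomB k m)
  (fun v => wclass n m (compose_word (val u) (val v))).
Proof.
move=> c x y z r; apply: wclass_respects; apply: compose_word_r r.
by case/andP: (valP u) => _ /eqP ->; case/andP: (valP z) => /eqP ->.
Qed.

Lemma nabla_opPl (q : words HomB k m) : linear (fun p : words HomB n k => nabla_op p q).
Proof. exact: (wlift2Pl (h := fun u v => wclass n m (compose_word u v))). Qed.

Lemma nabla_opPr (p : words HomB n k) : linear (@nabla_op n m k p).
Proof. exact: (wlift2Pr (h := fun u v => wclass n m (compose_word u v))). Qed.

Lemma nabla_op_gen (u : word HomB n k) (v : word HomB k m) :
  nabla_op (wclass n k (val u)) (wclass k m (val v))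
  = wclass n m (compose_word (val u) (val v)).
Proof. exact: (wlift2_gen (h := fun u v => wclass n m (compose_word u v))). Qed.

End NablaOp.

Fact nabla_respects n m : respects (@bilinear_rel K (words HomB) (words HomB) n m)
  (fun x => nabla_op (tagged x).1 (tagged x).2).
Proof.
apply: (@respects_bilinear K (words HomB) (words HomB) n m _
  (fun k p q => nabla_op p q)).
  by move=> k c p p' q; apply: nabla_opPl.
by move=> k c p q q'; apply: nabla_opPr.
Qed.

Definition nabla : bimorphism (vtensor (words HomB) (words HomB)) (words HomB) :=
  fun n m => plift_map (@nabla_respects n m).

Lemma nablaE n m k (u : word HomB n k) (v : word HomB k m) :
  nabla n m (vten (wclass n k (val u)) (wclass k m (val v)))
  = wclass n m (compose_word (val u) (val v)).
Proof.
by rewrite /nabla /= /plift_map (plift_gen (@nabla_respects n m)) nabla_op_gen.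
Qed.

Fact hom_id_multilinear : multilinear (fun t : 1.-tuple B => thead t).
Proof.
move=> c x y z [u [v [a [b []]]]].
case: x y z => [[|x []] //= ?] [[|y []] //= ?] [[|z []] //= ?].
by case: u => [|? [|? ?]] //= [-> _] [-> _] [-> _].
Qed.

Definition idB : letter HomB := mkletter (mkhom hom_id_multilinear : HomB 0).

Definition eta_fun n m (v : vunit K n m) : words HomB n m :=
  (\sum_i v 0 i) *: wclass n m (nseq n idB).

Fact eta_is_linear n m : linear (@eta_fun n m).
Proof.
move=> c u v; rewrite /eta_fun scalerA -scalerDl mulr_sumr -big_split /=.
by congr (_ *: _); apply: eq_bigr => i _; rewrite !mxE.
Qed.
HB.instance Definition _ n m := GRing.isLinear.Build K (vunit K n m)
  (words HomB n m) *:%R (@eta_fun n m) (@eta_is_linear n m).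

Definition eta : bimorphism (vunit K) (words HomB) := fun n m => @eta_fun n m.

End EndomorphismOperad.

Section WordsOnAlgebra.
Variables (K : fieldType) (A : lmodType K).

(* The words [a_1 ... a_k] have [k.+1] inputs, in accordance with [letter].   *)
Definition Tbar : nat -> lmodType K := fun k => tensor_power A k.

Definition W : bicollection K := words Tbar.

(* A list [a : seq A] stands for the word [a_1 ... a_p], and a list of lists  *)
(* [w : seq (seq A)] for the word [w_1 | ... | w_n] of [W].                   *)
Definition pure (a : seq A) : letter Tbar :=
  mkletter (gen _ (in_tuple a) : Tbar (size a)).

Definition Wclass n m (w : seq (seq A)) : W n m := wclass n m (map pure w).

Section WLift.
Variable V : lmodType K.

Fixpoint wlift_rec (w : seq (letter Tbar)) (f : seq (seq A) -> V) : V :=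
  if w is l :: w' then
    plift (fun t : (tag l).-tuple A => wlift_rec w' (fun w => f (tval t :: w)))
      (tagged l : tensor_power A (tag l))
  else f [::].

Definition words_entry_lin (c : K) (x y z : seq (seq A)) : Prop :=
  exists u v a b d, entry_lin c a b d /\
    [/\ x = u ++ a :: v, y = u ++ b :: v & z = u ++ d :: v].

Lemma wlift_rec_comb w c (f g : seq (seq A) -> V) :
  wlift_rec w (fun x => c *: f x + g x) = c *: wlift_rec w f + wlift_rec w g.
Proof.
elim: w f g => [|l w IH] f g //=; rewrite -plift_comb; apply: eq_plift => t.
exact: IH.
Qed.

Lemma respects_cons (f : seq (seq A) -> V) (a : seq A) : respects words_entry_lin f ->
  respects words_entry_lin (fun w => f (a :: w)).
Proof.
move=> hf c x y z [u [v [a1 [b [d [r [-> -> ->]]]]]]]; apply: hf.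
by exists (a :: u), v, a1, b, d.
Qed.

Lemma wlift_head (f : seq (seq A) -> V) w k : respects words_entry_lin f ->
  respects (fun c (x y z : k.-tuple A) => entry_lin c x y z)
    (fun t => wlift_rec w (fun w => f (tval t :: w))).
Proof.
move=> hf c x y z r; rewrite -wlift_rec_comb; congr wlift_rec; apply/funext => w'.
by apply: hf; exists [::], w', (tval x), (tval y), (tval z).
Qed.

Lemma wlift_rec_respects (f : seq (seq A) -> V) : respects words_entry_lin f ->
  respects (@letter_lin K Tbar) (wlift_rec^~ f).
Proof.
move=> hf c x y z [u [v [k [a [b [-> -> ->]]]]]].
elim: u f hf => [|l u IH] f hf /=.
  exact: (plift_is_linear (wlift_head v hf)).
rewrite -plift_comb; apply: eq_plift => t; apply: IH.
exact: respects_cons.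
Qed.

Lemma wlift_rec_pure (f : seq (seq A) -> V) w : respects words_entry_lin f ->
  wlift_rec (map pure w) f = f w.
Proof.
elim: w f => [|a w IH] f hf //=.
rewrite (plift_gen (wlift_head (map pure w) hf)) /=.
by rewrite IH //; apply: respects_cons.
Qed.

Variables (n m : nat) (f : seq (seq A) -> V) (hf : respects words_entry_lin f).

Fact wlift_respects : respects (@word_lin K Tbar n m) (fun w => wlift_rec (val w) f).
Proof. by move=> c x y z; apply: wlift_rec_respects. Qed.

(* The linear map on [W(n,m)] given on words by [f].                          *)
Definition wlift : {linear W n m -> V} := plift_map wlift_respects.

Lemma size_pure w : size (map pure w) = size w. Proof. exact: size_map. Qed.
Lemma inputs_pure w : inputs (map pure w) = (size w + size (flatten w))%N.
Proof.
elim: w => //= a w IH; rewrite /inputs /= -/(inputs _) IH /arity /= size_cat.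
by rewrite !addSn addnCA.
Qed.

Lemma wliftE w : size w = n -> (size w + size (flatten w))%N = m ->
  wlift (Wclass n m w) = f w.
Proof.
move=> hn hm.
have hw : (size (map pure w) == n) && (inputs (map pure w) == m).
  by rewrite size_pure inputs_pure hn -hm hn !eqxx.
rewrite /wlift /= /plift_map /Wclass.
pose x : word Tbar n m := exist _ (map pure w) hw.
rewrite [wclass _ _ _](wclass_gen x).
by rewrite (plift_gen wlift_respects) /= wlift_rec_pure.
Qed.

End WLift.

Lemma Wclass_respects n m : respects words_entry_lin (Wclass n m).
Proof.
move=> c x y z [u [v [a [b [d [r [-> -> ->]]]]]]]; apply: wclass_respects.
have [sa sb] : size a = size d /\ size b = size d.
  by case: r => s [t [e [e' [-> -> ->]]]]; rewrite !size_cat.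
rewrite !map_cat /=.
pose ta : (size d).-tuple A := Tuple (introT eqP sa).
pose tb : (size d).-tuple A := Tuple (introT eqP sb).
have E e (se : size e = size d) :
    pure e = mkletter (gen _ (Tuple (introT eqP se)) : Tbar (size d)).
  move: (introT eqP se) => h; case: _ / se h => h.
  by rewrite /pure (_ : in_tuple e = Tuple h) //; apply: val_inj.
exists (map pure u), (map pure v), (size d),
  (gen _ ta : Tbar (size d)), (gen _ tb : Tbar (size d)).
split; rewrite ?(E a sa) ?(E b sb) //.
congr (_ ++ _ :: _); rewrite (E d erefl); congr mkletter.
by apply: gen_respects.
Qed.

Fact counit_respects n m : respects words_entry_lin
  (fun w => if all (@nilp A) w then const_mx 1 : vunit K n m else 0).
Proof.
move=> c x y z [u [v [a [b [d [[s [t [e [e' [-> -> ->]]]]] [-> -> ->]]]]]]].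
by rewrite !all_cat /= /nilp !size_cat /= !addnS /= !andbF scaler0 addr0.
Qed.

Definition counit : bimorphism W (vunit K) :=
  fun n m => wlift n m (@counit_respects n m).

(* A subset of the letters of [x] is given by a sequence [s] of booleans; the *)
(* subword on this subset is [mask s x], and [gaps s x] lists the words       *)
(* before, between and after its letters.                                     *)
Fixpoint gaps (s : bitseq) (x : seq A) : seq (seq A) :=
  if x is a :: x' then
    let g := gaps (behead s) x' in
    if head false s then [::] :: g else (a :: head [::] g) :: behead g
  else [:: [::]].

(* [cut_left s w] and [cut_right s w] are the factors [alpha] and [beta] of   *)
(* the term of the coproduct of the word [w] in which the letters of [w] that *)
(* go to [alpha] are those selected by [s], [s] running over all the letters  *)
(* of [w] from left to right.                                                 *)
Fixpoint cut_left (s : bitseq) (w : seq (seq A)) : seq (seq A) :=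
  if w is x :: w' then
    mask (take (size x) s) x :: cut_left (drop (size x) s) w'
  else [::].

Fixpoint cut_right (s : bitseq) (w : seq (seq A)) : seq (seq A) :=
  if w is x :: w' then
    gaps (take (size x) s) x ++ cut_right (drop (size x) s) w'
  else [::].

Definition cut n m (s : bitseq) (w : seq (seq A)) : vtensor W W n m :=
  let k := size (cut_right s w) in
  vten (Wclass n k (cut_left s w)) (Wclass k m (cut_right s w)).

Definition cuts (sel : pred bitseq) n m (w : seq (seq A)) : vtensor W W n m :=
  \sum_(s : (size (flatten w)).-tuple bool | sel s) cut n m s w.

Lemma mask_gaps_lin c a b d s : entry_lin c a b d ->
  [/\ mask s a = mask s d, mask s b = mask s d &
      words_entry_lin c (gaps s a) (gaps s b) (gaps s d)] \/
  [/\ gaps s a = gaps s d, gaps s b = gaps s d &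
      entry_lin c (mask s a) (mask s b) (mask s d)].
Proof.
case=> u [v [e [e' [-> -> ->]]]]; elim: u s => [|x u IH] s /=.
  case: s => [|[] s] /=.
  - left; split; rewrite ?mask0 //.
    exists [::], (behead (gaps [::] v)), (e :: head [::] (gaps [::] v)),
      (e' :: head [::] (gaps [::] v)), (c *: e + e' :: head [::] (gaps [::] v)).
    by split=> //; exists [::], (head [::] (gaps [::] v)), e, e'.
  - by right; split=> //; exists [::], (mask s v), e, e'.
  left; split=> //.
  exists [::], (behead (gaps s v)), (e :: head [::] (gaps s v)),
      (e' :: head [::] (gaps s v)), (c *: e + e' :: head [::] (gaps s v)).
  by split=> //; exists [::], (head [::] (gaps s v)), e, e'.
have E y : mask s (x :: y) = (if head false s then [:: x] else [::]) ++ mask (behead s) y.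
  by case: s => [|[] s]; rewrite /= ?mask0.
rewrite !E {E}.
have [[-> -> [u' [v' [a' [b' [d' [r [-> -> ->]]]]]]]]|] := IH (behead s).
  left; split=> //; case: (head false s).
    by exists ([::] :: u'), v', a', b', d'.
  case: u' => [|y u'] /=; last by exists ((x :: y) :: u'), v', a', b', d'.
  exists [::], v', (x :: a'), (x :: b'), (x :: d'); split=> //.
  by case: r => s1 [s2 [s3 [s4 [-> -> ->]]]]; exists (x :: s1), s2, s3, s4.
case=> -> -> [u' [v' [a' [b' [-> -> ->]]]]]; right; split=> //.
by exists ((if head false s then [:: x] else [::]) ++ u'), v', a', b'; rewrite -!catA.
Qed.

Lemma cut_lin c x y z s : words_entry_lin c x y z ->
  [/\ cut_left s x = cut_left s z, cut_left s y = cut_left s z &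
      words_entry_lin c (cut_right s x) (cut_right s y) (cut_right s z)] \/
  [/\ cut_right s x = cut_right s z, cut_right s y = cut_right s z &
      words_entry_lin c (cut_left s x) (cut_left s y) (cut_left s z)].
Proof.
case=> u [v [a [b [d [r [-> -> ->]]]]]]; elim: u s => [|w u IH] s /=.
  have [-> ->] : size a = size d /\ size b = size d.
    by case: r => s1 [t [e [e' [-> -> ->]]]]; rewrite !size_cat.
  have [[-> -> [u' [v' [a' [b' [d' [r' [-> -> ->]]]]]]]]|[-> -> r']] :=
    mask_gaps_lin (take (size d) s) r.
    left; split=> //; exists u', (v' ++ cut_right (drop (size d) s) v), a', b', d'.
    by split=> //; rewrite -!catA.
  right; split=> //.
  by exists [::], (cut_left (drop (size d) s) v), (mask (take (size d) s) a),
    (mask (take (size d) s) b), (mask (take (size d) s) d).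
have [[-> -> [u' [v' [a' [b' [d' [r' [-> -> ->]]]]]]]]|
      [-> -> [u' [v' [a' [b' [d' [r' [-> -> ->]]]]]]]]] := IH (drop (size w) s).
  left; split=> //; exists (gaps (take (size w) s) w ++ u'), v', a', b', d'.
  by split=> //; rewrite -!catA.
by right; split=> //; exists (mask (take (size w) s) w :: u'), v', a', b', d'.
Qed.

Lemma words_entry_size c x y z : words_entry_lin c x y z ->
  [/\ size x = size z, size y = size z, size (flatten x) = size (flatten z)
    & size (flatten y) = size (flatten z)].
Proof.
case=> u [v [a [b [d [[s [t [e [e' [-> -> ->]]]]] [-> -> ->]]]]]].
by split; rewrite ?flatten_cat ?size_cat //= ?size_cat.
Qed.

Fact cuts_respects sel n m : respects words_entry_lin (cuts sel n m).
Proof.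
move=> c x y z r; rewrite /cuts.
have [_ _ -> ->] := words_entry_size r.
rewrite scaler_sumr -big_split /=; apply: eq_bigr => s _; rewrite /cut.
have [[-> -> r']|[-> -> r']] := cut_lin s r.
  have [-> -> _ _] := words_entry_size r'.
  by rewrite (Wclass_respects _ _ r') vtenPr.
by rewrite (Wclass_respects _ _ r') vtenPl.
Qed.

Definition coproduct_on (sel : pred bitseq) : bimorphism W (vtensor W W) :=
  fun n m => wlift n m (@cuts_respects sel n m).

(* See [coproduct_letter] for its value on one-letter words and               *)
(* [coproduct_hprod] for its compatibility with horizontal products.          *)
Definition coproduct := coproduct_on predT.

(* The first letter of the first non-empty word of [w] is the first letter of *)
(* [flatten w]; here it goes to [alpha], and [alpha <> w].                    *)
Definition coproduct_prec :=
  coproduct_on (fun s => head false s && has negb s).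

(* This letter goes to [beta], and [beta <> w].                               *)
Definition coproduct_succ :=
  coproduct_on (fun s => ~~ head true s && has id s).

End WordsOnAlgebra.

Section HalfShuffles.
Variables (K : fieldType) (A B : lmodType K).
Local Notation mor := (bimorphism (W A) (words (HomB B))).

Definition mor_prec (f g : mor) : mor :=
  bicomp (nabla B) (bicomp (vmap f g) (coproduct_prec A)).

Definition mor_succ (f g : mor) : mor :=
  bicomp (nabla B) (bicomp (vmap f g) (coproduct_succ A)).

Definition mor_unit : mor := bicomp (eta B) (counit A).

(* [mor_prec f g] and [mor_succ f g] are meant for [f], [g] vanishing on all  *)
(* words made of empty words.  For such an [f], and for [F] equal to          *)
(* [mor_unit] on these words, the two maps below are the values on [(f, F)]   *)
(* and [(F, f)] of the bilinear extensions of [mor_prec] and [mor_succ] for   *)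
(* which [f] composed with [mor_unit], on the right for [mor_prec] and on the *)
(* left for [mor_succ], is [f]: [F] is split as [mor_unit + (F - mor_unit)].  *)
Definition mor_prec_ext (f F : mor) : mor :=
  fun n m => f n m \+ mor_prec f (bisub F mor_unit) n m.

Definition mor_succ_ext (F f : mor) : mor :=
  fun n m => f n m \+ mor_succ (bisub F mor_unit) f n m.

Definition idB_word p : words (HomB B) p p := wclass p p (nseq p (idB B)).

Definition infinitesimal (k : mor) : Prop :=
  (forall p q (a : seq A), a != [::] ->
     k (p + 1 + q)%N (p + (size a).+1 + q)%N
       (Wclass _ _ (nseq p [::] ++ a :: nseq q [::]))
     = hprod (hprod (idB_word p) (k 1%N (size a).+1 (Wclass _ _ [:: a])))
         (idB_word q)) /\
  (forall n m (w : seq (seq A)),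
     (forall p q (a : seq A), a != [::] -> w <> nseq p [::] ++ a :: nseq q [::]) ->
     k n m (Wclass n m w) = 0).

(* [f(a_1 ... a_n)(b_0, ..., b_n) = phi a b] for [n >= 1], where [Hom(B)(n+1)] *)
(* is identified with the space [T(Hom(B))(1,n+1)] of one-letter words.       *)
Definition has_values (f : mor) (phi : seq A -> seq B -> B) : Prop :=
  forall a : seq A, a != [::] ->
  exists2 h : HomB B (size a),
    f 1%N (size a).+1 (Wclass _ _ [:: a]) = wclass _ _ [:: mkletter h] &
    forall b : (size a).+1.-tuple B, hom_fun h b = phi a b.

End HalfShuffles.

Section CoproductIsHorizontal.
Variables (K : fieldType) (A : lmodType K).

Lemma mkletter_gen k (t : k.-tuple A) :
  mkletter (gen _ t : Tbar A k) = pure (tval t).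
Proof.
case: t => s h; have e : size s = k by apply/eqP.
subst k; rewrite /pure /=.
by rewrite (_ : in_tuple s = Tuple h) //; apply: val_inj.
Qed.

Lemma W_ext n m (V : lmodType K) (f g : W A n m -> V) :
  linear f -> linear g ->
  (forall w, size w = n -> (size w + size (flatten w))%N = m ->
     f (Wclass n m w) = g (Wclass n m w)) ->
  f =1 g.
Proof.
move=> lf lg fg; apply: presented_ext => // x; rewrite -wclass_gen.
have H (u : seq (letter (Tbar A))) pre :
    (size (map (@pure _ A) pre ++ u) == n) && (inputs (map (@pure _ A) pre ++ u) == m) ->
    f (wclass n m (map (@pure _ A) pre ++ u)) = g (wclass n m (map (@pure _ A) pre ++ u)).
  elim: u pre => [|[k t] u IH] pre.
    rewrite cats0 size_pure inputs_pure => /andP[/eqP h1 /eqP h2].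
    exact: fg.
  move=> hd.
  pose F (t' : tensor_power A k) :=
    f (wclass n m (map (@pure _ A) pre ++ (mkletter (t' : Tbar A k)) :: u)).
  pose G (t' : tensor_power A k) :=
    g (wclass n m (map (@pure _ A) pre ++ (mkletter (t' : Tbar A k)) :: u)).
  have lin (h : W A n m -> V) : linear h -> linear (fun t' : tensor_power A k =>
      h (wclass n m (map (@pure _ A) pre ++ (mkletter (t' : Tbar A k)) :: u))).
    move=> lh c a b; rewrite -lh; congr h; apply: wclass_respects.
    by exists (map (@pure _ A) pre), u, k, a, b.
  rewrite -[LHS]/(F t) -[RHS]/(G t).
  apply: presented_ext => [||{t hd} t']; [exact: lin| exact: lin| ].
  have E : mkletter (gen _ t' : Tbar A k) = pure (tval t') := mkletter_gen t'.
  rewrite /F /G E -cat_rcons -map_rcons.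
  have [hd|hd] := boolP ((size (map (@pure _ A) (rcons pre t') ++ u) == n)
    && (inputs (map (@pure _ A) (rcons pre t') ++ u) == m)).
    exact: IH.
  have h0 (h : W A n m -> V) : linear h -> h 0 = 0.
    by move=> lh; apply: (addIr (h 0)); rewrite add0r -{1}[h 0]scale1r -lh scaler0 addr0.
  by rewrite /wclass insubN // !h0.
exact: (H (val x) [::] (valP x)).
Qed.

Lemma hprod_linearl (P : nat -> lmodType K) n m n' m' (y : words P n' m') :
  linear (fun x : words P n m => hprod x y).
Proof.
apply: (wlift2Pl (h := fun u v => wclass (n + n')%N (m + m')%N (u ++ v))) => w.
move=> c x1 x2 x3 [s [t [k [a [b [-> -> ->]]]]]]; apply: wclass_respects.
by exists s, (t ++ val w), k, a, b; rewrite -!catA.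
Qed.

Lemma hprod_linearr (P : nat -> lmodType K) n m n' m' (x : words P n m) :
  linear (@hprod K P n m n' m' x).
Proof.
apply: (wlift2Pr (h := fun u v => wclass (n + n')%N (m + m')%N (u ++ v))) => w.
move=> c x1 x2 x3 [s [t [k [a [b [-> -> ->]]]]]]; apply: wclass_respects.
by exists (val w ++ s), t, k, a, b; rewrite -!catA.
Qed.

Lemma hprod_wclass (P : nat -> lmodType K) n m n' m' (u v : seq (letter P)) :
  size u = n -> inputs u = m -> size v = n' -> inputs v = m' ->
  hprod (wclass n m u) (wclass n' m' v) = wclass (n + n')%N (m + m')%N (u ++ v).
Proof.
move=> un um vn vm.
have hu : (size u == n) && (inputs u == m) by rewrite un um !eqxx.
have hv : (size v == n') && (inputs v == m') by rewrite vn vm !eqxx.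
exact: (hprodE (exist _ u hu : word P n m) (exist _ v hv : word P n' m')).
Qed.

(* The horizontal product (a (x) b)(a' (x) b') = aa' (x) bb'.                 *)
Section VerticalHprod.
Variables (P Q : nat -> lmodType K) (n m n' m' : nat).
Local Notation PQ := (vtensor (words P) (words Q)).

Definition vhprod (x : PQ n m) (y : PQ n' m') : PQ (n + n')%N (m + m')%N :=
  plift (fun p : vpair (words P) (words Q) n m =>
    plift (fun q : vpair (words P) (words Q) n' m' =>
      vten (hprod (tagged p).1 (tagged q).1) (hprod (tagged p).2 (tagged q).2)) y) x.

Let hr (p : vpair (words P) (words Q) n m) : respects (@bilinear_rel K (words P) (words Q) n' m')
  (fun q => vten (hprod (tagged p).1 (tagged q).1) (hprod (tagged p).2 (tagged q).2)
     : PQ (n + n')%N (m + m')%N).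
Proof.
case: p => k [a b] /=.
apply: (@respects_bilinear K (words P) (words Q) n' m' _
  (fun k' a' b' => vten (hprod a a') (hprod b b'))) => k' c.
  by move=> a1 a2 b1; rewrite (hprod_linearr a c a1 a2) vtenPl.
by move=> a1 b1 b2; rewrite (hprod_linearr b c b1 b2) vtenPr.
Qed.

Let hl (y : PQ n' m') : respects (@bilinear_rel K (words P) (words Q) n m)
  (fun p => plift (fun q : vpair (words P) (words Q) n' m' =>
    vten (hprod (tagged p).1 (tagged q).1) (hprod (tagged p).2 (tagged q).2)
     : PQ (n + n')%N (m + m')%N) y).
Proof.
move=> c x1 x2 x3 r; rewrite -plift_comb; apply: eq_plift => -[k' [a' b']] /=.
move: c x1 x2 x3 r; apply: (@respects_bilinear K (words P) (words Q) n m _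
  (fun k a b => vten (hprod a a') (hprod b b'))) => k c.
  by move=> a1 a2 b1; rewrite (hprod_linearl a' c a1 a2) vtenPl.
by move=> a1 b1 b2; rewrite (hprod_linearl b' c b1 b2) vtenPr.
Qed.

Lemma vhprod_linearl y : linear (vhprod^~ y).
Proof. exact: (plift_is_linear (hl y)). Qed.

Lemma vhprod_linearr x : linear (vhprod x).
Proof.
move=> c y1 y2; rewrite /vhprod -plift_comb; apply: eq_plift => p.
exact: (plift_is_linear (hr p)).
Qed.

Lemma vhprodE k k' (a : words P n k) (b : words Q k m)
    (a' : words P n' k') (b' : words Q k' m') :
  vhprod (vten a b) (vten a' b') = vten (hprod a a') (hprod b b').
Proof. by rewrite /vhprod (plift_gen (hl _)) (plift_gen (hr _)). Qed.

End VerticalHprod.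

Lemma size_cut_left s (w : seq (seq A)) : size (cut_left s w) = size w.
Proof. by elim: w s => //= x w IH s; rewrite IH. Qed.

Lemma size_cut_right s (w : seq (seq A)) : size s = size (flatten w) ->
  size (cut_right s w) = (size w + size (flatten (cut_left s w)))%N.
Proof.
elim: w s => //= x w IH s; rewrite size_cat => hs.
rewrite !size_cat IH ?size_drop ?hs ?addKn //.
have -> : size (gaps (take (size x) s) x) = (size (mask (take (size x) s) x)).+1.
  have : (size x <= size s)%N by rewrite hs leq_addr.
  elim: x s {hs} => [|a x IHx] [|[] s] //= hs; first by rewrite IHx.
  by case: (gaps _ _) (IHx s hs) => //= ? ? [->].
by rewrite !addSn addnCA.
Qed.

Lemma size_flatten_cut s (w : seq (seq A)) : size s = size (flatten w) ->
  (size (flatten (cut_left s w)) + size (flatten (cut_right s w)))%N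
  = size (flatten w).
Proof.
elim: w s => //= x w IH s; rewrite size_cat => hs.
have hx : (size (mask (take (size x) s) x)
           + size (flatten (gaps (take (size x) s) x)))%N = size x.
  have : (size x <= size s)%N by rewrite hs leq_addr.
  elim: x s {hs} => [|a x IHx] [|[] s] //= hs; first by rewrite addSn IHx.
  have := IHx s hs; case: (gaps _ _) => [|g gs] /=; last first.
    by rewrite !size_cat addnS => ->.
  by rewrite addnS => ->.
have := IH (drop (size x) s); rewrite size_drop hs addKn => /(_ erefl).
rewrite flatten_cat !size_cat; move: hx.
by set p := size _; set q := size _; set r := size _; set t := size _ => <- <-;
  rewrite addnACA.
Qed.

Lemma cut_left_cat s s' (w w' : seq (seq A)) : size s = size (flatten w) ->
  cut_left (s ++ s') (w ++ w') = cut_left s w ++ cut_left s' w'.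
Proof.
elim: w s => [|x w IH] s /=; first by case: s.
rewrite size_cat => hs; have hx : (size x <= size s)%N by rewrite hs leq_addr.
rewrite takel_cat // drop_cat; case: ltnP => h.
  by rewrite IH // size_drop hs addKn.
have e : size x = size s by apply/eqP; rewrite eqn_leq hx h.
rewrite e subnn drop0 drop_size -[s' in LHS]cat0s IH //=.
by apply/eqP; rewrite eq_sym -(eqn_add2l (size x)) -hs e addn0.
Qed.

Lemma cut_right_cat s s' (w w' : seq (seq A)) : size s = size (flatten w) ->
  cut_right (s ++ s') (w ++ w') = cut_right s w ++ cut_right s' w'.
Proof.
elim: w s => [|x w IH] s /=; first by case: s.
rewrite size_cat => hs; have hx : (size x <= size s)%N by rewrite hs leq_addr.
rewrite takel_cat // drop_cat; case: ltnP => h.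
  by rewrite IH ?catA // size_drop hs addKn.
have e : size x = size s by apply/eqP; rewrite eqn_leq hx h.
rewrite e subnn drop0 drop_size -[s' in LHS]cat0s IH ?catA //=.
by apply/eqP; rewrite eq_sym -(eqn_add2l (size x)) -hs e addn0.
Qed.

Lemma big_tuple_cat (V : lmodType K) N N' (F : seq bool -> V) :
  \sum_(s : (N + N').-tuple bool) F s
  = \sum_(s : N.-tuple bool) \sum_(s' : N'.-tuple bool) F (s ++ s').
Proof.
rewrite pair_big /=.
rewrite (reindex (fun p : N.-tuple bool * N'.-tuple bool => cat_tuple p.1 p.2)) //=.
have T1 (s : (N + N').-tuple bool) : size (take N s) == N.
  by rewrite size_takel // size_tuple leq_addr.
have T2 (s : (N + N').-tuple bool) : size (drop N s) == N'.
  by rewrite size_drop size_tuple addKn.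
exists (fun s => (Tuple (T1 s), Tuple (T2 s))) => [[s s'] _|s _].
  congr (_, _); apply: val_inj => /=.
    by rewrite take_cat size_tuple ltnn subnn take0 cats0.
  by rewrite drop_cat size_tuple ltnn subnn drop0.
by apply: val_inj; rewrite /= cat_take_drop.
Qed.

Lemma coproductE sel n m w : size w = n ->
  (size w + size (flatten w))%N = m ->
  coproduct_on A sel n m (Wclass n m w) = cuts sel n m w.
Proof. exact: wliftE. Qed.

Lemma coproduct_letter (x : seq A) :
  coproduct A 1 (size x).+1 (Wclass _ _ [:: x]) =
  \sum_(s : (size x).-tuple bool)
    vten (Wclass 1 (size (gaps s x)) [:: mask s x]) (Wclass _ _ (gaps s x)).
Proof.
rewrite coproductE //= ?cats0 // /cuts /= cats0; apply: eq_bigr => s _.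
by rewrite /cut /= take_oversize ?size_tuple // cats0.
Qed.

Lemma hprod_Wclass n m n' m' (w w' : seq (seq A)) :
  size w = n -> (size w + size (flatten w))%N = m ->
  size w' = n' -> (size w' + size (flatten w'))%N = m' ->
  hprod (Wclass n m w) (Wclass n' m' w') = Wclass (n + n')%N (m + m')%N (w ++ w').
Proof.
by move=> *; rewrite /Wclass map_cat hprod_wclass ?size_pure ?inputs_pure.
Qed.

Lemma bilinear_sum (U V X : lmodType K) (h : U -> V -> X)
    (hl : forall y, linear (h^~ y)) (hr : forall x, linear (h x))
    I J (F : seq I) (G : seq J) f g :
  h (\sum_(i <- F) f i) (\sum_(j <- G) g j)
  = \sum_(i <- F) \sum_(j <- G) h (f i) (g j).
Proof.
have lin0 (U1 V1 : lmodType K) (t : U1 -> V1) : linear t -> t 0 = 0.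
  by move=> lt; apply: (addIr (t 0)); rewrite add0r -{1}[t 0]scale1r -lt scaler0 addr0.
elim: F => [|i F IH]; first by rewrite !big_nil (lin0 _ _ _ (hl _)).
rewrite !big_cons -[f i in LHS]scale1r hl scale1r IH; congr (_ + _).
elim: G {IH} => [|j G IH]; first by rewrite !big_nil (lin0 _ _ _ (hr _)).
by rewrite !big_cons -[g j in LHS]scale1r hr scale1r IH.
Qed.

Theorem coproduct_hprod n m n' m' (x : W A n m) (y : W A n' m') :
  coproduct A (n + n')%N (m + m')%N (hprod x y)
  = vhprod (coproduct A n m x) (coproduct A n' m' y).
Proof.
move: x; apply: W_ext => [c u v|c u v|w hn hm].
- by rewrite (hprod_linearl y c u v) linearP.
- by rewrite linearP; apply: vhprod_linearl.
move: y; apply: W_ext => [c u v|c u v|w' hn' hm'].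
- by rewrite (hprod_linearr _ c u v) linearP.
- by rewrite linearP; apply: vhprod_linearr.
rewrite hprod_Wclass // /coproduct !coproductE //; last 2 first.
- by rewrite size_cat hn hn'.
- by rewrite flatten_cat !size_cat addnACA hm hm'.
rewrite /cuts /= (bilinear_sum (@vhprod_linearl (Tbar A) (Tbar A) n m n' m')
  (@vhprod_linearr (Tbar A) (Tbar A) n m n' m')) flatten_cat size_cat.
rewrite (big_tuple_cat _ _ (fun s => cut (n + n')%N (m + m')%N s (w ++ w'))).
apply: eq_bigr => s _; apply: eq_bigr => s' _.
have zs : size s = size (flatten w) by rewrite size_tuple.
have zs' : size s' = size (flatten w') by rewrite size_tuple.
rewrite /cut vhprodE cut_left_cat // cut_right_cat // size_cat.
rewrite !hprod_Wclass ?size_cut_left ?size_cut_right //.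
- by rewrite -addnA size_flatten_cut.
by rewrite -addnA size_flatten_cut.
Qed.

End CoproductIsHorizontal.

Section OperatorValuedProbability.
Variable C : numClosedFieldType.

Definition involution (A : algType C) (star : A -> A) : Prop :=
  [/\ forall c x y, star (c *: x + y) = c^* *: star x + star y,
      forall x y, star (x * y) = star y * star x
    & forall x, star (star x) = x].

Variables (B A : algType C) (starB : B -> B) (starA : A -> A).
Variables (la : B -> A -> A) (ra : A -> B -> A).

Record bimodule_algebra : Prop := BimoduleAlgebra {
  la_linearl : forall a, linear (la^~ a);
  la_linearr : forall b, linear (la b);
  ra_linearl : forall b, linear (ra^~ b);
  ra_linearr : forall a, linear (ra a);
  la1 : forall a, la 1 a = a;
  ra1 : forall a, ra a 1 = a;
  laM : forall b b' a, la (b * b') a = la b (la b' a);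
  raM : forall a b b', ra a (b * b') = ra (ra a b) b';
  la_ra : forall b a b', ra (la b a) b' = la b (ra a b');
  mul_la : forall b a a', la b (a * a') = la b a * a';
  mul_ra : forall a a' b, ra (a * a') b = a * ra a' b;
  mul_ra_la : forall a b a', ra a b * a' = a * la b a';
  star_la : forall b a, starA (la b a) = ra (starA a) (starB b);
  star_ra : forall a b, starA (ra a b) = la (starB b) (starA a) }.

Record opv_probability_space (E : {linear A -> B}) : Prop := OpvProbabilitySpace {
  opv_starB : involution starB;
  opv_starA : involution starA;
  opv_bimodule : bimodule_algebra;
  opv_E_bimodule : forall b1 a b2, E (ra (la b1 a) b2) = b1 * E a * b2;
  opv_E_positive : forall a, exists b, E (a * starA a) = b * starB b;
  opv_E_unital : E 1 = 1 }.

Section Cumulants.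

Definition noncrossing n (pi : {set {set 'I_n}}) : bool :=
  partition pi [set: 'I_n] &&
  [forall V in pi, forall V' in pi, forall i in V, forall j in V',
   forall k in V, forall l in V', (i < j < k)%N && (k < l)%N ==> (V == V')].

Definition interval_partition n (pi : {set {set 'I_n}}) : bool :=
  partition pi [set: 'I_n] &&
  [forall V in pi, forall i in V, forall k in V, forall j : 'I_n,
   (i < j < k)%N ==> (j \in V)].

(* A family [(kappa_n)_{n >= 1}] of maps [A^n -> B] is encoded as a function  *)
(* on lists, [kappa [:: a_1; ...; a_n]] being [kappa_n(a_1, ..., a_n)]; its   *)
(* value at [[::]] is irrelevant.                                             *)
Variable kappa : seq A -> B.

(* Below, a partition of the positions of a list [a] is given by the list     *)
(* [s] of the blocks (or any labels thereof) of these positions.              *)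
Definition starts_interval_block (T : eqType) (s : seq T) (i : nat) : bool :=
  if drop i s is t :: _ then
    take (count_mem t s) (drop i s) == nseq (count_mem t s) t
  else false.

(* [kappa_pi(a)], in which the leftmost block that is an interval, of         *)
(* positions [i, ..., i + c - 1] counted from 0, is evaluated and removed     *)
(* first.  [fuel] bounds the number of blocks.                                *)
Fixpoint kappa_rec (T : eqType) (fuel : nat) (s : seq T) (a : seq A) : B :=
  if fuel is fuel'.+1 then
    let i := find (starts_interval_block s) (iota 0 (size s)) in
    if drop i s is t :: _ then
      let c := count_mem t s in
      let b := kappa (take c (drop i a)) in
      if c == size s then b else
      if drop (i + c)%N a is x :: a' then
        kappa_rec fuel' (take i s ++ drop (i + c)%N s) (take i a ++ la b x :: a')
      else
        kappa_rec fuel' (take i s) (rcons (take i.-1 a) (ra (nth 0 a i.-1) b))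
    else 0
  else 0.

Definition kappa_partition n (pi : {set {set 'I_n}}) (a : n.-tuple A) : B :=
  kappa_rec n [seq pblock pi i | i <- enum 'I_n] a.

End Cumulants.

Definition free_cumulants (E : A -> B) (kappa : seq A -> B) : Prop :=
  respects (@entry_lin C A) kappa /\
  forall n (a : n.-tuple A), (0 < n)%N ->
    E (\prod_(x <- a) x) = \sum_(pi | noncrossing pi) kappa_partition kappa pi a.

Definition boolean_cumulants (E : A -> B) (beta : seq A -> B) : Prop :=
  respects (@entry_lin C A) beta /\
  forall n (a : n.-tuple A), (0 < n)%N ->
    E (\prod_(x <- a) x) =
    \sum_(pi | interval_partition pi) kappa_partition beta pi a.

(* The list [b_0 a_1 b_1, a_2 b_2, ..., a_n b_n].                             *)
Definition sandwich (a : seq A) (b : seq B) : seq A :=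
  if [seq ra p.1 p.2 | p <- zip a (behead b)] is x :: s
  then la (head 0 b) x :: s else [::].

End OperatorValuedProbability.

(* Main.v *)
From HB Require Import structures.
Require Import Defs.
From mathcomp Require Import all_boot all_algebra zify.
From mathcomp Require Import boolp reals complex.
Set Implicit Arguments.
Unset Strict Implicit.
Unset Printing Implicit Defensive.
Import GRing.Theory.

(** Both identities are linear, so they are checked on a word [w] of words on
[A].  If all the letters of [w] are empty, both sides are the unit.  Otherwise
[w] is a number of empty words, followed by a non-empty word [a] and by some
[w'].  The summand [k w] of the extended product is the one missing from the
half coproduct, where all the letters of [w] go to the left; likewise [b w] is
the one where they all go to the right ([prec_cuts], [succ_cuts]).  An
infinitesimal morphism vanishes unless exactly one of the words is non-empty.
For the first identity this leaves the sets of letters that lie in [a] and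
contain its first letter; for the second one, the initial segments of [a] as
the set of letters that go to the right ([prec_first_word],
[succ_first_word]).  In both cases the words around [a] are only carried along,
and the identity for [a] alone remains ([free_letter], [boolean_letter]).

With c_1 = b_0 a_1 b_1 and c_i = a_i b_i for i > 1, the identity for [a] is, in
the free case ([free_moment_masks]),

  E(c_1 ... c_n) = sum over S containing 1 of
                     kappa_|S|(c_1 E(U_1), c_{i_2} E(U_2), ...),

where S = {1 < i_2 < ...} and U_j is the product of the c's between the j-th
element of S and the next one; in the boolean case it is
([boolean_moment_prefixes])

  E(c_1 ... c_n) = sum over 1 <= j <= n of
                     beta_j(c_1, ..., c_j) E(c_{j+1} ... c_n).

To derive these from the sums over partitions, a partition is coded by the word
that labels each position by the first position of its block.  It is
non-crossing iff this word has no subword xyxy, and an interval partition iff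
it has no subword xyx.  Read from left to right, such a word drives a stack of
open blocks, of which only the topmost can be continued ([codesP]).  The
leftmost block that is an interval is the first block to close, so evaluating
kappa_pi amounts to applying kappa to each block when it closes and multiplying
the next argument by the value, on the left.  The sum over all partitions is
therefore computed by a recursion on the arguments ([cumulant_sum],
[sum_kappa_partition]).

In the boolean case this recursion is the formula above.  In the free case,
splitting at the next element of the top block ([cumulant_sum_split]) gives the
formula with the values E(U_j) multiplied on the left of the next argument of
kappa rather than on the right of the previous one ([moment_first_block]).  The
two agree because the cumulants are balanced over [B], i.e.
kappa(..., a b, a', ...) = kappa(..., a, b a', ...): as kappa_n is the term
S = {1, ..., n} of the sum and E is a bimodule map, this follows by induction
on n ([free_cumulants_balanced]). *)

(** * Non-crossing and interval partitions as words of labels *)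

(** The subword whose absence characterizes non-crossing partitions ([nest] true)
or interval partitions ([nest] false) among words of block labels. *)
Definition pattern (T : Type) (nest : bool) (x y : T) : seq T :=
  if nest then [:: x; y; x; y] else [:: x; y; x].

(** No two distinct labels form the forbidden pattern. *)
Definition avoids (T : eqType) (nest : bool) (s : seq T) : Prop :=
  forall x y, x != y -> ~~ subseq (pattern nest x y) s.

(** Doubling an entry creates no new subword without equal neighbours; in
particular, it creates no forbidden pattern. *)
Lemma subseq_dup (T : eqType) (w u v : seq T) t :
  sorted (fun x y => x != y) w ->
  subseq w (u ++ t :: t :: v) = subseq w (u ++ t :: v).
Proof.
move=> sw; apply/idP/idP; last first.
  move=> h; apply: subseq_trans h _; apply: cat_subseq => //.
  by rewrite /= eqxx; apply: subseq_cons.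
elim: u w sw => [|a u IH] [|x w] sw; rewrite ?sub0seq //.
- have [ex|nx] := eqVneq x t; last by rewrite /= (negPf nx) /= (negPf nx).
  rewrite /= ex eqxx; case: w sw => [_|y w]; first by rewrite sub0seq.
  by move=> /= /andP[ne _]; rewrite eq_sym -ex (negPf ne).
- have [ex|nx] := eqVneq x a; rewrite /= ?ex ?eqxx ?(negPf nx); apply: IH => //.
  exact: path_sorted sw.
Qed.

Lemma sorted_pattern (T : eqType) nest (x y : T) :
  x != y -> sorted (fun x y => x != y) (pattern nest x y).
Proof. by case: nest => /= h; rewrite h eq_sym h. Qed.

Lemma avoids_dup (T : eqType) nest (u v : seq T) t :
  avoids nest (u ++ t :: t :: v) <-> avoids nest (u ++ t :: v).
Proof.
split=> h x y xy; have := h x y xy; by rewrite subseq_dup ?sorted_pattern.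
Qed.

(** An entry that occurs nowhere else plays no role in [x; y; x; y].  In
[x; y; x] it could be the [y], unless nothing precedes it. *)
Lemma avoids_single (T : eqType) nest (u v : seq T) t :
  t \notin u ++ v -> nest || nilp u ->
  avoids nest (u ++ t :: v) <-> avoids nest (u ++ v).
Proof.
move=> tn nu; split=> h x y xy; have := h x y xy; apply: contra => hs.
  apply: subseq_trans hs _; apply: cat_subseq => //; exact: subseq_cons.
have [ex|nx] := eqVneq x t.
  have := leq_count_subseq (pred1 t) hs.
  have /count_memPn := tn; rewrite !count_cat /= eqxx.
  by case: nest {nu h hs} => /=; rewrite ex eqxx; lia.
have [ey|ny] := eqVneq y t; last first.
  have := subseq_filter (pattern nest x y) (u ++ t :: v) (predC1 t).
  rewrite hs filter_cat /= eqxx /= -filter_cat => h1.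
  have /all_filterP e : all (predC1 t) (u ++ v).
    by apply/allP => z zi /=; apply: contraNneq tn => <-.
  by rewrite -e h1; case: (nest); rewrite /= nx ny.
subst y; case: nest nu h hs => /= [_|/nilP ->] h hs.
  have := leq_count_subseq (pred1 t) hs.
  have /count_memPn := tn; rewrite !count_cat /= eqxx.
  by lia.
by move: hs; rewrite /= (negPf nx).
Qed.

(** The label words of length [n] of the positions [p], [p + 1], ..., when [st] is
the stack of the labels of the open blocks, topmost first.  Each position either
opens a block, labelled by the position itself, or continues the topmost block;
the block is then left open or closed.  If [nest] is false, no block is opened
inside another one.  All blocks must be closed at the end. *)
Fixpoint codes (nest : bool) (st : seq nat) (p n : nat) : seq (seq nat) :=
  if n is n'.+1 then
    (if nest || nilp st then
       [seq p :: s | s <- codes nest (p :: st) p.+1 n'] ++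
       [seq p :: s | s <- codes nest st p.+1 n']
     else [::]) ++
    (if st is t :: st' then
       [seq t :: s | s <- codes nest st p.+1 n'] ++
       [seq t :: s | s <- codes nest st' p.+1 n']
     else [::])
  else if st is [::] then [:: [::]] else [::].

(** The invariant of the stack at position [p]: its labels are distinct earlier
positions and, if blocks may not be nested, at most one block is open. *)
Definition stack_wf nest (st : seq nat) p :=
  [/\ uniq st, all (fun t => t < p) st & nest || (size st <= 1)].

(** [s] continues a word whose open blocks have the labels [st]: these labels all
occur again in [s], the other labels are the positions of their first
occurrences, and no forbidden pattern appears.  As regards patterns, the part
already read is represented by one occurrence of each open label. *)
Definition code_spec nest (st : seq nat) p (s : seq nat) : Prop :=
  [/\ {subset st <= s},
      {in s, forall y, (y \in st) || (y == p + index y s)} &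
      avoids nest (rev st ++ s)].

Lemma mem_map_cons (x y : nat) s (r : seq (seq nat)) :
  (y :: s \in [seq x :: u | u <- r]) = (y == x) && (s \in r).
Proof.
apply/mapP/andP => [[u ur [-> ->]]|[/eqP -> sr]]; last by exists s.
by rewrite eqxx.
Qed.

Lemma mem_codesS nest st p n y s :
  (y :: s \in codes nest st p n.+1) =
  [&& nest || nilp st, y == p &
     (s \in codes nest (p :: st) p.+1 n) || (s \in codes nest st p.+1 n)] ||
  (if st is t :: st' then
     (y == t) && ((s \in codes nest st p.+1 n) || (s \in codes nest st' p.+1 n))
   else false).
Proof.
rewrite [codes _ _ _ _]/= mem_cat; congr (_ || _).
  by case: ifP => // _; rewrite mem_cat !mem_map_cons -andb_orr.
by case: st => // t st'; rewrite mem_cat !mem_map_cons -andb_orr.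
Qed.

Lemma stack_wf_open nest st p : nest || nilp st -> stack_wf nest st p ->
  stack_wf nest (p :: st) p.+1.
Proof.
move=> hn [us hs _]; split=> /=.
- by rewrite us andbT; apply/negP => /(allP hs); rewrite ltnn.
- by rewrite ltnSn; apply: sub_all hs => x /leqW.
- by case: nest hn => //= /nilP ->.
Qed.

Lemma stack_wf_skip nest st p : stack_wf nest st p -> stack_wf nest st p.+1.
Proof. by move=> [us hs h]; split=> //; apply: sub_all hs => x /leqW. Qed.

Lemma stack_wf_pop nest t st p : stack_wf nest (t :: st) p -> stack_wf nest st p.+1.
Proof.
move=> [/andP[_ us] /andP[_ hs] h]; split=> //.
  by apply: sub_all hs => x /leqW.
by case: nest h => //=; case: (size st).
Qed.

Lemma codes_size nest st p n s : s \in codes nest st p n -> size s = n.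
Proof.
have nilN x (r : seq (seq nat)) : ([::] \in [seq x :: u | u <- r]) = false.
  by apply/mapP; case.
elim: n st p s => [|n IH] st p [|y s] //.
- by case: st.
- by rewrite /=; case: ifP => _; case: st => [|t st]; rewrite ?mem_cat ?nilN.
rewrite mem_codesS => /orP[/and3P[_ _ /orP[] /IH <-] //|].
by case: st => // t st /andP[_ /orP[] /IH <-].
Qed.

Lemma index_consE (T : eqType) (x y : T) s :
  index x (y :: s) = if x == y then 0 else (index x s).+1.
Proof. by rewrite /= eq_sym. Qed.

(** The step is the same in both directions: opening or continuing a block moves
one label across the boundary between the two parts, and forgetting a closed
block, or a repeated label, does not affect the forbidden patterns. *)
Lemma codesP nest st p n s : stack_wf nest st p ->
  reflect (size s = n /\ code_spec nest st p s) (s \in codes nest st p n).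
Proof.
move=> wf; apply: (iffP idP).
  move=> hs; split; first exact: codes_size hs.
  elim: n st p s wf hs => [|n IH] st p s wf.
    case: st wf => // _; rewrite inE => /eqP ->; split=> //.
    by case: nest.
  case: s => [|y s]; first by move/codes_size.
  rewrite mem_codesS => /orP[/and3P[hn /eqP -> /orP[]]|].
  - move/IH => /(_ (stack_wf_open hn wf)) [h1 h2 h3]; split.
    + by move=> x xs; rewrite inE h1 ?orbT // inE xs orbT.
    + move=> x; rewrite inE => /orP[/eqP ->|xs]; 
        first by rewrite index_consE eqxx addn0 eqxx orbT.
      have := h2 x xs; rewrite inE index_consE.
      by have [->|_] := eqVneq x p; rewrite ?addn0 ?eqxx ?orbT //= addnS addSn.
    + by move: h3; rewrite rev_cons cat_rcons.
  - move/IH => /(_ (stack_wf_skip wf)) [h1 h2 h3]; split.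
    + by move=> x xs; rewrite inE h1 ?orbT.
    + move=> x; rewrite inE => /orP[/eqP ->|xs]; 
        first by rewrite index_consE eqxx addn0 eqxx orbT.
      have := h2 x xs; rewrite  index_consE.
      by have [->|_] := eqVneq x p; rewrite ?addn0 ?eqxx ?orbT //= addnS addSn.
    + have [us hs _] := wf.
      have pst : p \notin st by apply/negP => /(allP hs); rewrite ltnn.
      apply/avoids_single => //; last by move: hn; rewrite /nilp size_rev.
      rewrite mem_cat mem_rev negb_or pst /=; apply/negP => ps.
      by have := h2 p ps; rewrite (negPf pst) addSn => /eqP; lia.
  - case: st wf => // t st wf /andP[/eqP -> /orP[]].
      move/IH => /(_ (stack_wf_skip wf)) [h1 h2 h3]; split.
      + by move=> x xs; rewrite inE h1 ?orbT.
      + move=> x; rewrite inE => /orP[/eqP ->|xs]; first by rewrite mem_head.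
        have := h2 x xs; rewrite inE index_consE.
        by have [->|_] := eqVneq x t; rewrite ?eqxx //= addnS addSn.
      + by move: h3; rewrite rev_cons !cat_rcons => /avoids_dup.
    move/IH => /(_ (stack_wf_pop wf)) [h1 h2 h3]; split.
    + by move=> x; rewrite !inE => /orP[->//|xs]; rewrite h1 ?orbT.
    + move=> x; rewrite inE => /orP[/eqP ->|xs]; first by rewrite mem_head.
      have := h2 x xs; rewrite inE index_consE.
      by have [->|_] := eqVneq x t; rewrite ?eqxx //= addnS addSn.
    + have [/andP[tst us] /andP[ltp hs] hsz] := wf.
      rewrite rev_cons cat_rcons; apply/avoids_dup.
      apply/avoids_single => //.
        rewrite mem_cat mem_rev negb_or tst /=; apply/negP => ps.
        by have := h2 t ps; rewrite (negPf tst) addSn => /eqP; lia.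
      by move: hsz; rewrite /nilp size_rev; case: (nest) => //=; case: (size st).
case=> hsz; elim: n st p s wf hsz => [|n IH] st p s wf.
  by move/size0nil => -> [h1 _ _]; case: st wf h1 => // t st _ /(_ t (mem_head _ _)).
case: s => [|y s] //= [hsz] [h1 h2 h3]; rewrite mem_codesS.
have [us hs hsz1] := wf.
have pst : p \notin st by apply/negP => /(allP hs); rewrite ltnn.
have idx z : z \in s -> z != y -> (z \in st) || (z == p.+1 + index z s).
  move=> zs zy; have := h2 z; rewrite inE zs orbT index_consE (negPf zy).
  by rewrite addnS -addSn; apply.
have [yst|yst] := boolP (y \in st); last first.
  have /eqP yp : y == p.
    by have := h2 y (mem_head _ _); rewrite (negPf yst) index_consE eqxx addn0.
  subst y; apply/orP; left; rewrite eqxx andTb.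
  have st_s : {subset st <= s}.
    move=> x xs; have := h1 x xs; rewrite inE => /orP[/eqP ex|//].
    by rewrite ex (negPf yst) in xs.
  have hn : nest || nilp st.
    (* A block opened above a label t would give the subword t, p, t. *)
    case: (boolP nest) => //= nn; case: st {wf us hs hsz1 pst idx h1 h2} h3 yst st_s => // t st.
    rewrite rev_cons cat_rcons inE negb_or => h3 /andP[pt _] /(_ t (mem_head _ _)) ts.
    have := h3 t p; rewrite eq_sym (negPf nn) => /(_ pt).
    case/negP; rewrite /pattern -[X in subseq X]cat0s.
    by apply: cat_subseq; rewrite ?sub0seq //= !eqxx sub1seq.
  rewrite hn /=.
  have [ps|ps] := boolP (p \in s); apply/orP; [left|right]; apply: IH => //.
  - exact: stack_wf_open.
  - split=> [x|x xs|]; first by rewrite inE => /orP[/eqP ->|/st_s].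
      by rewrite inE; have [//|nx] := eqVneq x p; rewrite /= idx.
    by rewrite rev_cons cat_rcons.
  - exact: stack_wf_skip.
  - split=> // [x xs|]; first by apply: idx => //; apply: contraNneq ps => <-.
    apply: (iffLR (avoids_single _ _)) h3; last by rewrite /nilp size_rev.
    by rewrite mem_cat mem_rev negb_or pst.
apply/orP; right.
case: st wf us hs hsz1 pst h1 h2 h3 idx yst => // t st wf us hs hsz1 pst h1 h2 h3 idx yst.
have yt : y = t.
  apply/eqP; apply/negP => /negP yt.
  move: yst; rewrite inE (negPf yt) /= => yst.
  have ts : t \in s.
    by have := h1 t (mem_head _ _); rewrite inE eq_sym (negPf yt).
  (* Continuing a lower block y while t is open gives y, t, y, t. *)
  case: (nest) hsz1 h3 => /= hsz1; last by case: st hsz1 yst {wf us hs pst h1 h2 idx}.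
  move/(_ y t yt); case/negP; rewrite rev_cons cat_rcons.
  case/splitPr: yst => s1 s2.
  rewrite rev_cat rev_cons cat_rcons -catA -[pattern _ _ _]cat0s.
  apply: cat_subseq; first exact: sub0seq.
  rewrite cat_cons /= eqxx -[[:: t; y; t]]cat0s.
  apply: cat_subseq; first exact: sub0seq.
  by rewrite /= !eqxx sub1seq.
subst y; rewrite eqxx /=.
have [ps|ps] := boolP (t \in s); apply/orP; [left|right]; apply: IH => //.
- exact: stack_wf_skip.
- split=> [x|x xs|].
  + by move/h1; rewrite inE => /orP[/eqP ->|].
  + by have [->|nx] := eqVneq x t; rewrite ?mem_head // idx.
  + by move: h3; rewrite rev_cons !cat_rcons => /avoids_dup.
- exact: stack_wf_pop wf.
- case/andP: us => tst us; split=> [x xs|x xs|].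
  + have := h1 x; rewrite !inE xs orbT => /(_ isT) /orP[/eqP ex|//].
    by rewrite ex (negPf tst) in xs.
  + have nx : x != t by apply: contraNneq ps => <-.
    by have := idx x xs nx; rewrite inE (negPf nx).
  + move: h3; rewrite rev_cons cat_rcons => /avoids_dup h3.
    apply: (iffLR (avoids_single _ _)) h3.
      by rewrite mem_cat mem_rev negb_or tst.
    by move: hsz1; rewrite /nilp size_rev; case: (nest) => //=; case: (size st).
Qed.

Lemma map_cons_inj (x : nat) : injective (cons x).
Proof. by move=> a b []. Qed.

Lemma uniq_codes nest st p n : stack_wf nest st p -> uniq (codes nest st p n).
Proof.
elim: n st p => [|n IH] st p wf; first by case: st wf.
have [us hs hsz] := wf.
have pst : p \notin st by apply/negP => /(allP hs); rewrite ltnn.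
rewrite [codes _ _ _ _]/= cat_uniq; apply/and3P; split.
- case: ifP => // hn; rewrite cat_uniq !(map_inj_uniq (@map_cons_inj _)).
  rewrite (IH _ _ (stack_wf_open hn wf)) (IH _ _ (stack_wf_skip wf)) andbT /=.
  apply/hasPn => [_ /mapP[s hs1 ->]]; rewrite mem_map_cons eqxx /=.
  apply/negP => /codesP [|_ [+ _ _]]; first exact: stack_wf_open.
  move=> /(_ p (mem_head _ _)) ps.
  move/codesP: hs1 => [|_ [_ + _]]; first exact: stack_wf_skip.
  by move=> /(_ p ps); rewrite (negPf pst) addSn => /eqP; lia.
- apply/hasPn => s; case: st wf us hs hsz pst => // t st wf us hs hsz pst.
  rewrite mem_cat => hs1; have {hs1} [s' ->] : exists s', s = t :: s'.
    by case/orP: hs1 => /mapP[s' _ ->]; exists s'.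
  case: ifP => // _; rewrite mem_cat !mem_map_cons.
  by move: pst; rewrite inE negb_or eq_sym => /andP[/negPf -> _].
- case: st wf us hs hsz pst => // t st wf us hs hsz pst.
  rewrite cat_uniq !(map_inj_uniq (@map_cons_inj _)).
  rewrite (IH _ _ (stack_wf_skip wf)) (IH _ _ (stack_wf_pop wf)) andbT /=.
  apply/hasPn => [_ /mapP[s hs1 ->]]; rewrite mem_map_cons eqxx /=.
  apply/negP => /codesP [|_ [+ _ _]]; first exact: stack_wf_skip wf.
  move=> /(_ t (mem_head _ _)) ps.
  move/codesP: hs1 => [|_ [_ + _]]; first exact: stack_wf_pop wf.
  case/andP: us => tst _; case/andP: hs => tp _.
  by move=> /(_ t ps); rewrite (negPf tst) addSn => /eqP; lia.
Qed.

(** * Sums over partitions as sums over codes *)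

Lemma avoids_map (T T' : eqType) nest (f : T -> T') (s : seq T) :
  {in s &, injective f} -> avoids nest (map f s) <-> avoids nest s.
Proof.
move=> fi.
have pmap U U' (g : U -> U') x y : pattern nest (g x) (g y) = map g (pattern nest x y).
  by case: (nest).
have pmem (U : eqType) (x y : U) r : subseq (pattern nest x y) r -> (x \in r) /\ (y \in r).
  by move=> /mem_subseq h; split; apply: h; case: (nest); rewrite /= !inE eqxx ?orbT.
split=> h x y xy.
  apply/negP => hs; have [xs ys] := pmem _ _ _ _ hs.
  have fxy : f x != f y by apply: contraNneq xy => /(fi x y xs ys) ->.
  have /negP := h (f x) (f y) fxy; apply.
  by rewrite pmap; apply: map_subseq.
apply/negP => hs; have [xs ys] := pmem _ _ _ _ hs.
have [x0 x0s ex] := mapP xs; have [y0 y0s ey] := mapP ys.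
have xy0 : x0 != y0 by apply: contraNneq xy => e; rewrite ex ey e.
have /negP := h x0 y0 xy0; apply.
have := map_subseq (fun u => nth x0 s (index u (map f s))) hs.
rewrite -pmap ex ey !nth_index_map // -map_comp.
have /eq_in_map -> : {in s, (fun u => nth x0 s (index u (map f s))) \o f =1 id}.
  by move=> z zs /=; rewrite nth_index_map.
by rewrite map_id.
Qed.

Lemma subseq_enum_ord (T : eqType) n (f : 'I_n -> T) (w : seq T) :
  subseq w (map f (enum 'I_n)) <->
  exists2 v : seq 'I_n, sorted (fun i j : 'I_n => i < j) v & w = map f v.
Proof.
have tr : transitive (fun i j : 'I_n => i < j) by move=> ? ? ?; apply: ltn_trans.
have se : sorted (fun i j : 'I_n => i < j) (enum 'I_n).
  by have := iota_ltn_sorted 0 n; rewrite -val_enum_ord sorted_map.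
split=> [/subseqP[m _ ->]|[v sv ->]].
  exists (mask m (enum 'I_n)); last by rewrite map_mask.
  exact: (subseq_sorted tr (mask_subseq _ _)).
apply: map_subseq.
have -> : v = [seq i <- enum 'I_n | i \in v].
  apply: (irr_sorted_eq tr) => //; first by move=> i; apply: ltnn.
    exact: sorted_filter.
  by move=> i; rewrite mem_filter mem_enum andbT.
exact: filter_subseq.
Qed.

(** The word in which each position is labelled by its own block. *)
Definition block_labels n (pi : {set {set 'I_n}}) : seq {set 'I_n} :=
  [seq pblock pi i | i <- enum 'I_n].

(** Uniform treatment of the free and of the boolean case. *)
Definition admissible nest n (pi : {set {set 'I_n}}) : bool :=
  if nest then noncrossing pi else interval_partition pi.

Lemma admissibleP nest n (pi : {set {set 'I_n}}) :
  admissible nest pi <-> partition pi [set: 'I_n] /\ avoids nest (block_labels pi).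
Proof.
have inc i : partition pi [set: 'I_n] -> i \in cover pi.
  by move=> /and3P[/eqP -> _ _]; rewrite inE.
have pb V i : partition pi [set: 'I_n] -> V \in pi -> i \in V -> pblock pi i = V.
  by move=> /and3P[_ ti _]; apply: def_pblock.
have pp i : partition pi [set: 'I_n] -> pblock pi i \in pi.
  by move=> h; apply: pblock_mem; apply: inc.
have pi_i i : partition pi [set: 'I_n] -> i \in pblock pi i.
  by move=> h; rewrite mem_pblock; apply: inc.
case: nest; rewrite /admissible; split.
- case/andP=> hp /forall_inP h; split=> // X Y XY; apply/negP => /subseq_enum_ord [v sv ev].
  case: v sv ev => [|i [|j [|k [|l [|? ?]]]]] //= /and4P[ij jk kl _] [eX eY eX' eY'].
  have := h _ (pp i hp) => /forall_inP /(_ _ (pp j hp)) /forall_inP /(_ _ (pi_i i hp)).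
  move=> /forall_inP /(_ _ (pi_i j hp)) /forall_inP /(_ k).
  rewrite -eX eX' => /(_ (pi_i k hp)) /forall_inP /(_ l).
  rewrite -eY eY' => /(_ (pi_i l hp)).
  by rewrite ij jk kl /= -eX' -eY' (negPf XY).
- case=> hp h; rewrite /noncrossing hp /=.
  apply/forall_inP => V Vp; apply/forall_inP => V' Vp'; apply/forall_inP => i iV.
  apply/forall_inP => j jV; apply/forall_inP => k kV; apply/forall_inP => l lV.
  apply/implyP => /andP[/andP[ij jk] kl]; apply/negPn/negP => VV.
  have /negP := h V V' VV; apply; apply/subseq_enum_ord; exists [:: i; j; k; l].
    by rewrite /= ij jk kl.
  by rewrite /= (pb V i) // (pb V' j) // (pb V k) // (pb V' l).
- case/andP=> hp /forall_inP h; split=> // X Y XY; apply/negP => /subseq_enum_ord [v sv ev].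
  case: v sv ev => [|i [|j [|k [|? ?]]]] //= /and3P[ij jk _] [eX eY eX'].
  have := h _ (pp i hp) => /forall_inP /(_ _ (pi_i i hp)) /forall_inP /(_ k).
  rewrite -eX eX' => /(_ (pi_i k hp)) /forallP /(_ j); rewrite ij jk /=.
  by rewrite -eX' => jX; case/negP: XY; rewrite eY (pb X j) // eX pp.
case=> hp h; rewrite /interval_partition hp /=.
apply/forall_inP => V Vp; apply/forall_inP => i iV; apply/forall_inP => k kV.
apply/forallP => j; apply/implyP => /andP[ij jk]; apply/negPn/negP => jV.
have VV : V != pblock pi j by apply: contraNneq jV => ->; apply: pi_i.
have /negP := h V (pblock pi j) VV; apply; apply/subseq_enum_ord; exists [:: i; j; k].
  by rewrite /= ij jk.
by rewrite /= (pb V i) // (pb V k).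
Qed.

(** The canonical relabelling: each entry becomes the position of its first
occurrence. *)
Definition first_labels (T : eqType) (l : seq T) : seq nat :=
  [seq index x l | x <- l].

(** The canonical labels depend only on which entries are equal. *)
Lemma eq_first_labels (I : Type) (T T' : eqType) (e : seq I) (f : I -> T) (g : I -> T') :
  (forall i j, (f i == f j) = (g i == g j)) ->
  first_labels (map f e) = first_labels (map g e).
Proof.
move=> fg; rewrite /first_labels -!map_comp; apply: eq_map => i /=.
by rewrite /index !find_map; apply: eq_find => j /=.
Qed.

Lemma index_inj_in (T : eqType) (l : seq T) : {in l &, injective (index^~ l)}.
Proof.
by move=> x y xl yl e; rewrite -(nth_index x xl) e nth_index.
Qed.

Lemma first_labels_canonical (T : eqType) (l : seq T) :
  {in first_labels l, forall y, y = index y (first_labels l)}.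
Proof.
move=> _ /mapP[x xl ->]; rewrite {2}/index find_map.
by apply: eq_in_find => y yl /=; apply/eqP/eqP => [->//|]; apply: index_inj_in.
Qed.

(** The partition of the positions of [s] according to their labels. *)
Definition code_partition n (s : seq nat) : {set {set 'I_n}} :=
  preim_partition (fun i : 'I_n => nth 0 s i) [set: 'I_n].

Lemma block_labels_code n (s : seq nat) : size s = n ->
  {in s, forall y, y = index y s} ->
  first_labels (block_labels (code_partition n s)) = s.
Proof.
move=> sz can; rewrite (@eq_first_labels _ _ _ _ _ (fun i : 'I_n => nth 0 s i)); last first.
  move=> i j; rewrite eq_pblock.
  - by rewrite pblock_equivalence_partition ?inE // => x y z _ _ _; split=> // /eqP ->.
  - by have /and3P[_ ] := preim_partitionP (fun i : 'I_n => nth 0 s i) setT.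
  - have /and3P[/eqP -> _ _] := preim_partitionP (fun i : 'I_n => nth 0 s i) setT.
    by rewrite inE.
have -> : [seq nth 0 s i | i : 'I_n <- enum 'I_n] = s.
  rewrite (map_comp (nth 0 s) val) val_enum_ord -sz.
  exact: mkseq_nth.
by rewrite -[RHS]map_id; apply/eq_in_map => y ys; rewrite /= -can.
Qed.

Lemma code_partition_first_labels n (pi : {set {set 'I_n}}) :
  partition pi [set: 'I_n] -> code_partition n (first_labels (block_labels pi)) = pi.
Proof.
move=> hp; rewrite -[RHS](equivalence_partition_pblock hp).
apply: eq_imset => i; apply/setP => j; rewrite !inE /=.
have lab (k : 'I_n) : nth 0 (first_labels (block_labels pi)) k
    = index (pblock pi k) (block_labels pi).
  rewrite /first_labels /block_labels -map_comp (nth_map k) ?size_enum_ord //=.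
  by rewrite nth_ord_enum.
have bl k : pblock pi k \in block_labels pi by apply: map_f; rewrite mem_enum.
rewrite !lab -eq_pblock; first by apply/eqP/eqP => [|->//]; apply: index_inj_in.
  by have /and3P[_ ] := hp.
by have /and3P[/eqP -> _ _] := hp; rewrite inE.
Qed.

(** The codes are exactly the canonical labels of the admissible partitions. *)
Lemma admissible_codes nest n (s : seq nat) :
  (s \in codes nest [::] 0 n) =
  (s \in [seq first_labels (block_labels pi) | pi <- enum (@admissible nest n)]).
Proof.
have wf : stack_wf nest [::] 0 by split=> //; rewrite orbT.
apply/codesP/mapP => // [[sz [_ can av]]|[pi]].
  have {}can : {in s, forall y, y = index y s} by move=> y /can /= /eqP.
  exists (code_partition n s); last by rewrite block_labels_code.
  rewrite mem_enum; apply/admissibleP; split; first exact: preim_partitionP.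
  apply/(avoids_map nest (@index_inj_in _ _)).
  by rewrite -[map _ _]/(first_labels _) block_labels_code.
rewrite mem_enum => /admissibleP [hp av] ->; split.
  by rewrite 2!size_map size_enum_ord.
split=> //; last by apply/avoids_map => //; apply: index_inj_in.
by move=> y /first_labels_canonical e; rewrite add0n -e eqxx orbT.
Qed.

Lemma sum_admissible (V : nmodType) nest n (F : seq nat -> V) :
  (\sum_(pi : {set {set 'I_n}} | admissible nest pi)
     F (first_labels (block_labels pi)) =
   \sum_(s <- codes nest [::] 0 n) F s)%R.
Proof.
have wf : stack_wf nest [::] 0 by split=> //; rewrite orbT.
rewrite -big_enum -(big_map (fun pi => first_labels (block_labels pi)) predT F).
apply: perm_big; apply: uniq_perm; last by move=> s; rewrite admissible_codes.
  rewrite map_inj_in_uniq ?enum_uniq // => x y.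
  rewrite !mem_enum => /admissibleP[hx _] /admissibleP[hy _] e.
  by rewrite -(code_partition_first_labels hx) e code_partition_first_labels.
exact: uniq_codes.
Qed.

(** * Cumulants along a partition, with a stack of open blocks *)

Local Open Scope ring_scope.

Lemma eq_map_in (T T' : eqType) (f : T -> T') (s u v : seq T) :
  {in s &, injective f} -> {subset u <= s} -> {subset v <= s} ->
  (map f u == map f v) = (u == v).
Proof.
move=> fi; elim: u v => [|x u IH] [|y v] //= us vs.
rewrite !eqseq_cons IH; last 2 first.
- by move=> z zu; apply: us; rewrite inE zu orbT.
- by move=> z zu; apply: vs; rewrite inE zu orbT.
congr andb; apply/eqP/eqP => [|->//]; apply: fi; [apply: us|apply: vs]; exact: mem_head.
Qed.

Lemma count_mem_map_in (T T' : eqType) (f : T -> T') (s : seq T) t :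
  {in s &, injective f} -> t \in s -> count_mem (f t) (map f s) = count_mem t s.
Proof.
move=> fi ts; rewrite count_map; apply: eq_in_count => x xs /=.
by apply/eqP/eqP => [|->//]; apply: fi.
Qed.

Lemma starts_interval_block_map (T T' : eqType) (f : T -> T') (s : seq T) i :
  {in s &, injective f} ->
  starts_interval_block (map f s) i = starts_interval_block s i.
Proof.
move=> fi; rewrite /starts_interval_block -map_drop.
case E: (drop i s) => [|t r] //=.
have sub : {subset t :: r <= s} by move=> x; rewrite -E; apply: mem_drop.
rewrite count_mem_map_in //; last by apply: sub; apply: mem_head.
rewrite -[f t :: _]/(map f (t :: r)) -map_take -map_nseq (eq_map_in fi) //.
- by move=> x /mem_take /sub.
- by move=> x /nseqP[-> _]; apply: sub; apply: mem_head.
Qed.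

Section Machine.
Variables (C : numClosedFieldType) (B A : algType C).
Variables (la : B -> A -> A) (ra : A -> B -> A) (kappa : seq A -> B).
Hypothesis la1 : forall a, la 1 a = a.

(** The evaluation depends on the labels only up to renaming. *)
Lemma kappa_rec_map (T T' : eqType) (f : T -> T') fuel (s : seq T) a :
  {in s &, injective f} ->
  kappa_rec la ra kappa fuel (map f s) a = kappa_rec la ra kappa fuel s a.
Proof.
elim: fuel s a => [|fuel IH] s a fi //=.
rewrite size_map (@eq_find _ _ (starts_interval_block s)); last first.
  by move=> i; apply: starts_interval_block_map.
set i := find _ _; rewrite -map_drop.
case E: (drop i s) => [|t r] //=.
have ts : t \in s by apply: (@mem_drop i); rewrite E mem_head.
rewrite count_mem_map_in //; case: ifP => // _.
case: (drop _ a) => [|x a'].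
  by rewrite -map_take IH // => x y /mem_take xs /mem_take ys; apply: fi.
rewrite -map_take -map_drop -map_cat IH // => u v.
by rewrite !mem_cat => /orP[/mem_take|/mem_drop] us /orP[/mem_take|/mem_drop] vs; apply: fi.
Qed.

(** The labels still to be evaluated among those already read, for a stack of open
blocks, topmost first, each given by its label and its arguments.  The elements
of an open block precede those of the blocks above it. *)
Fixpoint stack_labels (st : seq (nat * seq A)) : seq nat :=
  if st is (t, blk) :: st' then stack_labels st' ++ nseq (size blk) t else [::].

(** The arguments at these positions. *)
Fixpoint stack_elements (st : seq (nat * seq A)) : seq A :=
  if st is (t, blk) :: st' then stack_elements st' ++ blk else [::].

Lemma size_stack st : size (stack_elements st) = size (stack_labels st).
Proof. by elim: st => [|[t blk] st IH] //=; rewrite !size_cat size_nseq IH. Qed.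

Lemma mem_stack_labels st x : x \in stack_labels st -> x \in unzip1 st.
Proof.
elim: st => [|[t blk] st IH] //=; rewrite mem_cat inE => /orP[/IH ->|].
  by rewrite orbT.
by case/nseqP => -> _; rewrite eqxx.
Qed.

(** The evaluation of the remaining labels [s] and arguments [x] after the part
[s1], [a1] held by the stack, when the value [b] of the last closed block is
pending: [b] multiplies the next argument, and it is the final result if there
is none. *)
Definition kappa_rec_pending fuel (s1 : seq nat) (a1 : seq A) b s x : B :=
  if x is z :: x' then kappa_rec la ra kappa fuel (s1 ++ s) (a1 ++ la b z :: x')
  else b.

(** A block that closes while all the open ones are still to be continued is the
leftmost block that is an interval: it is evaluated first. *)
Lemma kappa_rec_first_closed fuel st (t : nat) (blk x : seq A) s :
  blk != [::] -> size s = size x -> all (fun p => p.2 != [::]) st ->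
  t \notin unzip1 st -> t \notin s -> {subset unzip1 st <= s} ->
  kappa_rec la ra kappa fuel.+1 (stack_labels st ++ nseq (size blk) t ++ s)
    (stack_elements st ++ blk ++ x) =
  kappa_rec_pending fuel (stack_labels st) (stack_elements st) (kappa blk) s x.
Proof.
move=> bn sx ne tst ts sub; set s1 := stack_labels st; set a1 := stack_elements st.
have sz : size a1 = size s1 by apply: size_stack.
have b0 : (0 < size blk)%N by case: blk bn.
have ts1 : t \notin s1 by apply: contra tst; apply: mem_stack_labels.
set l := s1 ++ nseq (size blk) t ++ s.
have ct : count_mem t l = size blk.
  rewrite !count_cat (count_memPn ts1) (count_memPn ts) count_nseq /= eqxx.
  by rewrite addn0 mul1n.
have dl : drop (size s1) l = t :: nseq (size blk).-1 t ++ s.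
  by rewrite drop_size_cat //; case: (size blk) b0.
have fi : find (starts_interval_block l) (iota 0 (size l)) = size s1.
  have szl : (size s1 < size l)%N by rewrite !size_cat size_nseq; lia.
  have -> : iota 0 (size l) = iota 0 (size s1) ++ iota (size s1) (size l - size s1).
    by rewrite -{2}[size s1]add0n -iotaD subnKC // ltnW.
  rewrite find_cat; case: ifP => [/hasP [i iN]|_].
    (* The label at i is that of an open block: it occurs again in s, after an
       occurrence of t, so its block is not an interval. *)
    have ilt : (i < size s1)%N by move: iN; rewrite mem_iota.
    rewrite /starts_interval_block drop_cat ilt.
    case E: (drop i s1) => [|u r] /=.
      by have := size_drop i s1; rewrite E /=; lia.
    have us1 : u \in s1 by apply: (@mem_drop i); rewrite E mem_head.
    have us : u \in s by apply: sub; apply: mem_stack_labels.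
    have ut : u != t by apply: contraNneq ts1 => <-.
    set c := count_mem u l; set d := u :: _ => /eqP e.
    have td : nth u d (size r).+1 = t.
      by rewrite /d /= nth_cat ltnn subnn; case: (size blk) b0.
    have cr : (c <= (size r).+1)%N.
      rewrite leqNgt; apply/negP => cl.
      by have := nth_take u cl d; rewrite e nth_nseq cl td => /eqP; rewrite (negPf ut).
    have cd : (count_mem u d <= c)%N.
      rewrite /d -cat_cons -E /c /l -{2}(cat_take_drop i s1) -catA [leqRHS]count_cat.
      exact: leq_addl.
    exfalso; have := cd; rewrite -(cat_take_drop c d) count_cat e count_nseq /= eqxx mul1n.
    have : (0 < count_mem u (drop c d))%N.
      rewrite -has_count; apply/hasP; exists u => //=.
      have -> : d = (u :: r) ++ nseq (size blk) t ++ s by [].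
      rewrite drop_cat; case: ltnP => _; rewrite ?mem_cat ?us ?orbT //.
      rewrite (_ : c - _ = 0)%N ?drop0 ?mem_cat ?us ?orbT //=.
      by apply/eqP; rewrite subn_eq0.
    by rewrite lt0n -[X in (_ <= X)%N]addn0 leq_add2l leqn0 => /negPf ->.
  rewrite size_iota (_ : (size l - size s1)%N = (size l - size s1).-1.+1); last by lia.
  rewrite /= /starts_interval_block dl ct -dl drop_size_cat //.
  by rewrite take_size_cat ?size_nseq // eqxx addn0.
rewrite [LHS]/= fi dl ct -[in LHS]sz drop_size_cat // take_size_cat //.
have -> : (size blk == size l) = (x == [::]).
  rewrite !size_cat size_nseq sx; case: x sx => [|z x] sx; last first.
    by rewrite [RHS](_ : _ = false) //; apply/eqP => /=; lia.
  have st0 : st = [::].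
    move: sub; rewrite (size0nil sx); case: (st) => // p st' /(_ p.1).
    by rewrite inE eqxx => /(_ isT).
  by rewrite /s1 st0 /= addn0 add0n eqxx.
case: x sx => [|z x] sx //=.
rewrite sz addnC -drop_drop -{2}sz drop_size_cat // drop_size_cat //.
rewrite /l take_size_cat // -drop_drop drop_size_cat // drop_size_cat ?size_nseq //.
by rewrite -sz take_size_cat.
Qed.

(** The sum over all ways of completing the stack [st] of open blocks by the
arguments [x], with pending value [b]; the labels are no longer needed.  The two
outer summands correspond to opening a block and to continuing the topmost one,
the two inner ones to leaving this block open and to closing it. *)
Fixpoint cumulant_sum nest (st : seq (seq A)) (b : B) (x : seq A) : B :=
  if x is y :: x' then
    (if nest || nilp st then
       cumulant_sum nest ([:: la b y] :: st) 1 x' +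
       cumulant_sum nest st (kappa [:: la b y]) x'
     else 0) +
    (if st is t :: st' then
       cumulant_sum nest (rcons t (la b y) :: st') 1 x' +
       cumulant_sum nest st' (kappa (rcons t (la b y))) x'
     else 0)
  else if nilp st then b else 0.

Lemma sum_codes nest fuel st b x p :
  stack_wf nest (unzip1 st) p -> all (fun q => q.2 != [::]) st ->
  (size x <= fuel)%N ->
  \sum_(s <- codes nest (unzip1 st) p (size x))
    kappa_rec_pending fuel (stack_labels st) (stack_elements st) b s x =
  cumulant_sum nest (unzip2 st) b x.
Proof.
elim: x fuel st b p => [|y x IH] fuel st b p wf ne hf.
  by case: st {wf ne} => [|q st] /=; rewrite ?big_nil // big_seq1.
have nopen t blk st' s q : s \in codes nest (t :: unzip1 st') q (size x) ->
    kappa_rec la ra kappa fuel (stack_labels ((t, blk) :: st') ++ s)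
      (stack_elements ((t, blk) :: st') ++ x) =
    kappa_rec_pending fuel (stack_labels ((t, blk) :: st'))
      (stack_elements ((t, blk) :: st')) 1 s x.
  by case: (x) => [|z x'] //=; rewrite ?la1 ?in_nil.
have nclosed t blk st' s : all (fun q => q.2 != [::]) st' -> blk != [::] ->
    (t < p.+1)%N -> uniq (t :: unzip1 st') -> stack_wf nest (unzip1 st') p.+1 ->
    s \in codes nest (unzip1 st') p.+1 (size x) ->
    kappa_rec la ra kappa fuel (stack_labels ((t, blk) :: st') ++ s)
      (stack_elements ((t, blk) :: st') ++ x) =
    kappa_rec_pending fuel.-1 (stack_labels st') (stack_elements st') (kappa blk) s x.
  move=> ne' bn tp /andP[tst' _] wf' /codesP [] // sz [h1 h2 _].
  have ef : fuel = fuel.-1.+1 by case: (fuel) hf.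
  rewrite [stack_labels (_ :: _)]/= [stack_elements (_ :: _)]/= -!catA [in LHS]ef.
  rewrite kappa_rec_first_closed //.
  by apply/negP => ts; have := h2 t ts; rewrite (negPf tst') => /eqP; lia.
have [us hs hsz] := wf.
have pst : p \notin unzip1 st by apply/negP => /(allP hs); rewrite ltnn.
rewrite [codes _ _ _ _]/= [cumulant_sum _ _ _ _]/= big_cat /=; congr (_ + _).
  have -> : nilp (unzip2 st) = nilp (unzip1 st) by case: (st).
  case: ifP => hn; last by rewrite big_nil.
  rewrite big_cat !big_map; congr (_ + _).
    rewrite -(IH fuel ((p, [:: la b y]) :: st) 1 p.+1) //=; last 2 first.
    - exact: stack_wf_open.
    - exact: ltnW.
    rewrite !big_seq; apply: eq_bigr => s hs1.
    by move: (nopen p [:: la b y] st s _ hs1) => /= <-; rewrite -!catA.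
  rewrite -(IH fuel.-1 st _ p.+1) //=; last 2 first.
  - exact: stack_wf_skip.
  - by case: (fuel) hf.
  rewrite !big_seq; apply: eq_bigr => s hs1.
  move: (nclosed p [:: la b y] st s ne isT (ltnSn p)) => /= <- //; first by rewrite -!catA.
    by rewrite pst us.
  exact: stack_wf_skip.
case: st wf ne us hs hsz pst => [|[t blk] st] wf ne us hs hsz pst /=.
  by rewrite big_nil.
have /andP[bn ne'] := ne; have /andP[tp _] := hs.
rewrite big_cat !big_map; congr (_ + _).
  rewrite -(IH fuel ((t, rcons blk (la b y)) :: st) 1 p.+1) //=; last 3 first.
  - exact: stack_wf_skip wf.
  - by apply/andP; split; [case: (blk) | exact: ne'].
  - exact: ltnW.
  rewrite !big_seq; apply: eq_bigr => s hs1.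
  move: (nopen t (rcons blk (la b y)) st s _ hs1) => /= <-.
  by rewrite size_rcons -[(size blk).+1]addn1 nseqD -!cats1 -!catA.
rewrite -(IH fuel.-1 st _ p.+1) //=; last 2 first.
- exact: stack_wf_pop wf.
- by case: (fuel) hf.
rewrite !big_seq; apply: eq_bigr => s hs1.
have bn' : rcons blk (la b y) != [::] by case: (blk).
move: (nclosed t _ st s ne' bn' (ltnW tp) us (stack_wf_pop wf) hs1) => /= <-.
rewrite size_rcons -[(size blk).+1]addn1 nseqD.
by rewrite -!cats1 -!catA.
Qed.

Lemma sum_kappa_partition nest n (a : n.-tuple A) : (0 < n)%N ->
  \sum_(pi : {set {set 'I_n}} | admissible nest pi) kappa_partition la ra kappa pi a =
  cumulant_sum nest [::] 1 a.
Proof.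
move=> n0; have sz := size_tuple a.
rewrite -(@sum_codes nest n [::] 1 a 0) ?sz //; last by split=> //; rewrite orbT.
rewrite -(sum_admissible nest n); apply: eq_bigr => pi _.
rewrite /kappa_partition -/(block_labels pi) /first_labels /=.
rewrite -(@kappa_rec_map _ _ (index^~ (block_labels pi))); last exact: index_inj_in.
rewrite /kappa_rec_pending /=; case: a sz => -[|z x] /= _ sz; last by rewrite la1.
by rewrite -sz in n0.
Qed.

End Machine.

(** * Moments in terms of cumulants *)

Lemma sum_tuple_cons (V : nmodType) n (F : seq bool -> V) :
  \sum_(s : n.+1.-tuple bool) F s =
  \sum_(s : n.-tuple bool) F (true :: s) + \sum_(s : n.-tuple bool) F (false :: s).
Proof.
rewrite (reindex (fun p : bool * n.-tuple bool => cons_tuple p.1 p.2)) /=; last first.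
  exists (fun s => (thead s, behead_tuple s)) => [[b s] _|s _] /=.
    by rewrite theadE; congr (_, _); apply: val_inj.
  by case/tupleP: s => b s; apply: val_inj; rewrite /= theadE.
rewrite -(pair_bigA _ (fun b (s : n.-tuple bool) => F (b :: s))) /=.
by rewrite big_bool.
Qed.

Lemma sum_tuple0 (V : nmodType) (F : seq bool -> V) :
  \sum_(s : 0.-tuple bool) F s = F [::].
Proof.
rewrite (big_pred1 [tuple]) //= => s.
by rewrite [s]tuple0; apply/esym/eqP.
Qed.

Lemma gaps_head (K : fieldType) (A : lmodType K) s (x : seq A) :
  gaps s x = head [::] (gaps s x) :: behead (gaps s x).
Proof. by case: x => //= a x; case: (head false s). Qed.

(** The sum of [f u y v] over all the factorizations of [x] as [u ++ y :: v]. *)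
Fixpoint splits (V : nmodType) (T : Type) (f : seq T -> T -> seq T -> V) (x : seq T) : V :=
  if x is y :: v then f [::] y v + splits (fun u => f (y :: u)) v else 0.

Lemma eq_splits (V : nmodType) (T : Type) (f g : seq T -> T -> seq T -> V) x :
  (forall u y v, (size v < size x)%N -> f u y v = g u y v) -> splits f x = splits g x.
Proof.
elim: x f g => [|y x IH] f g fg //=; rewrite fg //; congr (_ + _).
by apply: IH => u z v h; apply: fg; apply: leqW.
Qed.

Lemma splitsD (V : nmodType) (T : Type) (f g : seq T -> T -> seq T -> V) x :
  splits (fun u y v => f u y v + g u y v) x = splits f x + splits g x.
Proof.
elim: x f g => [|y x IH] f g /=; first by rewrite addr0.
by rewrite IH addrACA.
Qed.

Lemma splits0 (V : nmodType) (T : Type) x :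
  splits (fun (u : seq T) (y : T) (v : seq T) => 0 : V) x = 0.
Proof. by elim: x => //= y x ->; rewrite addr0. Qed.

Section OperatorValued.
Variables (C : numClosedFieldType) (B A : algType C) (starB : B -> B) (starA : A -> A).
Variables (la : B -> A -> A) (ra : A -> B -> A) (E : {linear A -> B}).
Hypothesis space : opv_probability_space starB starA la ra E.

Let bim := opv_bimodule space.

Lemma E_la b a : E (la b a) = b * E a.
Proof. by rewrite -[la b a](ra1 bim) (opv_E_bimodule space) mulr1. Qed.

Lemma E_ra a b : E (ra a b) = E a * b.
Proof. by rewrite -[a in LHS](la1 bim) (opv_E_bimodule space) mul1r. Qed.

Lemma la_prod b y (x : seq A) :
  la b (\prod_(z <- y :: x) z) = \prod_(z <- la b y :: x) z.
Proof. by rewrite !big_cons (mul_la bim). Qed.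

Section Cumulants.
Variables (nest : bool) (kappa : seq A -> B).
Hypothesis kappa_lin : respects (@entry_lin C A) kappa.
Local Notation cumsum := (cumulant_sum la kappa nest).

Lemma entry_lin_rcons (V : lmodType C) c (x y z : seq V) v :
  entry_lin c x y z -> entry_lin c (rcons x v) (rcons y v) (rcons z v).
Proof.
move=> [s [t [a [b [-> -> ->]]]]]; exists s, (rcons t v), a, b.
by rewrite -!cats1 -!catA.
Qed.

Lemma entry_lin_last (V : lmodType C) c (s : seq V) a b :
  entry_lin c (rcons s a) (rcons s b) (rcons s (c *: a + b)).
Proof. by exists s, [::], a, b; rewrite !cats1. Qed.

(** Multilinearity in the arguments held by the stack, and linearity in the pending
value.  The two are proved together since closing a block turns an argument
into a pending value. *)
Lemma cumulant_sum_linear x :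
  (forall b, respects (@words_entry_lin C A) (fun st => cumsum st b x)) /\
  (forall st, linear (fun b => cumsum st b x)).
Proof.
have addZ (c : C) (p q r s : B) : c *: (p + q) + (r + s) = (c *: p + r) + (c *: q + s).
  by rewrite scalerDr addrACA.
elim: x => [|y x [IHs IHb]]; split.
- move=> b c s1 s2 s3 [u [v [a1 [a2 [a3 [_ [-> -> ->]]]]]]] /=.
  by rewrite /nilp !size_cat !addnS /= scaler0 addr0.
- by move=> st c b1 b2 /=; case: ifP => // _; rewrite scaler0 addr0.
- move=> b c s1 s2 s3 r /=.
  have [n1 n2 n3] : [/\ nilp s1 = false, nilp s2 = false & nilp s3 = false].
    by case: r => [u [v [a1 [a2 [a3 [_ [-> -> ->]]]]]]]; rewrite /nilp !size_cat !addnS.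
  rewrite n1 n2 n3 addZ; congr (_ + _).
    case: ifP => _; last by rewrite scaler0 addr0.
    rewrite addZ -(IHs (kappa _) _ _ _ _ r); congr (_ + _).
    apply: IHs; case: r => [u [v [a1 [a2 [a3 [h [-> -> ->]]]]]]].
    by exists ([:: la b y] :: u), v, a1, a2, a3.
  case: r {n1 n2 n3} => [[|t u] [v [a1 [a2 [a3 [h [-> -> ->]]]]]]] /=; rewrite addZ.
    have h' := entry_lin_rcons (la b y) h.
    rewrite (kappa_lin h') IHb; congr (_ + _); apply: IHs.
    by exists [::], v, (rcons a1 (la b y)), (rcons a2 (la b y)), (rcons a3 (la b y)).
  congr (_ + _); apply: IHs; last by exists u, v, a1, a2, a3.
  by exists (rcons t (la b y) :: u), v, a1, a2, a3.
move=> st c b1 b2 /=; rewrite (la_linearl bim) addZ.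
set y1 := la b1 y; set y2 := la b2 y; congr (_ + _).
  case: ifP => _; last by rewrite scaler0 addr0.
  have h := entry_lin_last c [::] y1 y2; rewrite /= in h.
  rewrite (kappa_lin h) IHb addZ; congr (_ + _); apply: IHs.
  by exists [::], st, [:: y1], [:: y2], [:: c *: y1 + y2].
case: st => [|t st]; first by rewrite scaler0 addr0.
have h := entry_lin_last c t y1 y2.
rewrite (kappa_lin h) IHb addZ; congr (_ + _); apply: IHs.
by exists [::], st, (rcons t y1), (rcons t y2), (rcons t (c *: y1 + y2)).
Qed.

Hypothesis moments : forall x, x != [::] -> E (\prod_(z <- x) z) = cumsum [::] 1 x.

Lemma cumulant_sum_nil b x : cumsum [::] b x = b * E (\prod_(z <- x) z).
Proof.
case: x => [|y x]; first by rewrite /= big_nil (opv_E_unital space) mulr1.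
by rewrite -E_la la_prod moments //= (la1 bim).
Qed.

(** The part of [cumulant_sum] in which [y], with the pending value [b], is the
element that continues the top block [t]. *)
Definition joined t st b y v :=
  cumsum (rcons t (la b y) :: st) 1 v + cumsum st (kappa (rcons t (la b y))) v.

Lemma joined_linear t st y v : linear (fun b => joined t st b y v).
Proof.
move=> c b1 b2; rewrite /joined (la_linearl bim).
have h := entry_lin_last c t (la b1 y) (la b2 y).
have [IHs IHb] := cumulant_sum_linear v.
rewrite (kappa_lin h) IHb scalerDr addrACA; congr (_ + _); apply: IHs.
exists [::], st, (rcons t (la b1 y)), (rcons t (la b2 y)).
by exists (rcons t (c *: la b1 y + la b2 y)).
Qed.

Lemma joinedD t st y v b1 b2 :
  joined t st (b1 + b2) y v = joined t st b1 y v + joined t st b2 y v.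
Proof. by have := joined_linear t st y v 1 b1 b2; rewrite !scale1r. Qed.

Lemma joined0 t st y v : joined t st 0 y v = 0.
Proof.
have := joinedD t st y v 0 0; rewrite addr0 => h.
by apply: (addIr (joined t st 0 y v)); rewrite add0r -h.
Qed.

(** If [y] is the next element of the block [t], what precedes [y] completes the
blocks above [t], and contributes its value as a pending value. *)
Lemma cumulant_sum_split t st' st b x : nest ->
  cumsum (st' ++ t :: st) b x =
  splits (fun u y v => joined t st (cumsum st' b u) y v) x.
Proof.
move=> hn; have hn' b' : nest || b' = true by rewrite hn.
elim: x st' b => [|y x IH] st' b /=; first by case: st'.
rewrite !hn' /=.
rewrite (eq_splits (g := fun u z v =>
   (joined t st (cumsum ([:: la b y] :: st') 1 u) z v +
    joined t st (cumsum st' (kappa [:: la b y]) u) z v) +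
   joined t st (if st' is t' :: st'' then
      cumsum (rcons t' (la b y) :: st'') 1 u + cumsum st'' (kappa (rcons t' (la b y))) u
      else 0) z v)); last by move=> u z v _; rewrite -!joinedD.
rewrite 2!splitsD -(IH ([:: la b y] :: st') 1) -(IH st' (kappa [:: la b y])).
rewrite /= addrCA; congr (_ + _).
case: st' => [|t' st'] /=.
  rewrite (eq_splits (g := fun u z v => 0)); last by move=> *; rewrite joined0.
  by rewrite splits0 addr0.
rewrite joined0 add0r [RHS](eq_splits (g := fun u z v =>
   joined t st (cumsum (rcons t' (la b y) :: st') 1 u) z v +
   joined t st (cumsum st' (kappa (rcons t' (la b y))) u) z v)); last first.
  by move=> *; rewrite joinedD.
by rewrite splitsD -!IH.
Qed.

End Cumulants.

(** The sum over the sets of elements of [x] that continue the block [t], where [p]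
is the product of the arguments met since the last element of that block.  The
moment of each gap multiplies the next element of the block on the left; that
of the last gap multiplies the value of the block. *)
Fixpoint first_block_sum (K : seq A -> B) (t : seq A) (p : A) (x : seq A) : B :=
  if x is y :: x' then
    first_block_sum K (rcons t (la (E p) y)) 1 x' + first_block_sum K t (p * y) x'
  else K t * E p.

Lemma first_block_sum_split K t p x :
  first_block_sum K t p x = K t * E (p * \prod_(z <- x) z) +
    splits (fun u y v => first_block_sum K
      (rcons t (la (E (p * \prod_(z <- u) z)) y)) 1 v) x.
Proof.
elim: x p => [|y x IH] p /=; first by rewrite big_nil mulr1 addr0.
rewrite IH big_nil mulr1 big_cons mulrA addrCA; congr (_ + (_ + _)).
by apply: eq_splits => u z v _; rewrite big_cons mulrA.
Qed.

Section Balanced.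
Variable K : seq A -> B.

(** Balancedness over [B]: a factor [b] can be moved from the right of an argument
to the left of the next one, and out of the last argument. *)
Definition balanced : Prop :=
  (forall u y b z v, K (u ++ ra y b :: z :: v) = K (u ++ y :: la b z :: v)) /\
  (forall u y b, K (rcons u (ra y b)) = K (rcons u y) * b).

Hypothesis Kbal : balanced.
Local Notation Psi := (first_block_sum K).

Lemma first_block_sum_bal_block u y b z t p x :
  Psi (u ++ ra y b :: z :: t) p x = Psi (u ++ y :: la b z :: t) p x.
Proof.
elim: x t p => [|w x IH] t p /=; first by rewrite Kbal.1.
by rewrite !rcons_cat /= !IH.
Qed.

Lemma first_block_sum_bal_gap t y b p x :
  Psi (rcons t (ra y b)) p x = Psi (rcons t y) (la b p) x.
Proof.
elim: x p => [|w x IH] p /=; first by rewrite Kbal.2 E_la mulrA.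
rewrite IH -(mul_la bim); congr (_ + _).
rewrite E_la (laM bim) -!cats1 -!catA.
exact: first_block_sum_bal_block.
Qed.

Lemma first_block_sum_bal_next t y b z x :
  Psi (rcons t (ra y b)) 1 (z :: x) = Psi (rcons t y) 1 (la b z :: x).
Proof.
rewrite first_block_sum_bal_gap /= E_la (opv_E_unital space) mulr1 (la1 bim).
by rewrite -(mul_la bim) !mul1r.
Qed.

Lemma first_block_sum_bal t p u y b z v :
  Psi t p (u ++ ra y b :: z :: v) = Psi t p (u ++ y :: la b z :: v).
Proof.
elim: u t p => [|w u IH] t p /=; last by rewrite !IH.
rewrite -(la_ra bim) -(mul_ra bim) E_ra (opv_E_unital space) !(la1 bim) (laM bim).
rewrite (mul_ra_la bim) !mul1r first_block_sum_bal_gap; congr (_ + _ + _).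
by rewrite -!cats1 -!catA first_block_sum_bal_block.
Qed.

Lemma first_block_sum_bal_last t p x y b :
  Psi t p (rcons x (ra y b)) = Psi t p (rcons x y) * b.
Proof.
elim: x t p => [|w x IH] t p /=; last by rewrite !IH mulrDl.
rewrite -(la_ra bim) Kbal.2 (opv_E_unital space) !mulr1 -(mul_ra bim) E_ra.
by rewrite mulrDl mulrA.
Qed.

End Balanced.

Section Free.
Variable kappa : seq A -> B.
Hypothesis kappa_free : free_cumulants la ra E kappa.

Let kappa_lin : respects (@entry_lin C A) kappa. Proof. exact: kappa_free.1. Qed.

Lemma free_moments x : x != [::] ->
  E (\prod_(z <- x) z) = cumulant_sum la kappa true [::] 1 x.
Proof.
move=> x0; have n0 : (0 < size x)%N by case: x x0.
rewrite -(sum_kappa_partition ra kappa (la1 bim) true (in_tuple x) n0).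
exact: (kappa_free.2 _ (in_tuple x) n0).
Qed.

(** By induction on [x], the block [t] is completed first: what lies between two of
its elements, and after the last one, contributes a moment. *)
Lemma cumulant_sum_first_block t x :
  cumulant_sum la kappa true [:: t] 1 x + cumulant_sum la kappa true [::] (kappa t) x =
  first_block_sum kappa t 1 x.
Proof.
have [n] := ubnP (size x); elim: n t x => // n IH t x xn.
rewrite (@cumulant_sum_split true kappa kappa_lin t [::] [::]) //.
rewrite (cumulant_sum_nil free_moments) first_block_sum_split mul1r addrC.
congr (_ + _); apply: eq_splits => u y v vx.
rewrite /joined (cumulant_sum_nil free_moments) mul1r IH ?mul1r //.
exact: leq_trans vx _.
Qed.

Lemma moment_first_block c x :
  E (\prod_(z <- c :: x) z) = first_block_sum kappa [:: c] 1 x.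
Proof.
by rewrite -cumulant_sum_first_block free_moments //= (la1 bim) addr0.
Qed.

(** [K] on the lists of fewer than [n] arguments, and 0 on the others. *)
Definition truncate n (K : seq A -> B) (l : seq A) : B :=
  if (size l < n)%N then K l else 0.

Lemma first_block_sum_truncate_lt K n t p x : (size t + size x < n)%N ->
  first_block_sum (truncate n K) t p x = first_block_sum K t p x.
Proof.
elim: x t p => [|y x IH] t p /=; first by rewrite addn0 /truncate => ->.
by rewrite addnS => h; rewrite !IH // ?size_rcons ?addSn //; apply: ltnW.
Qed.

(** The term with the most arguments is the one where the block takes all of them. *)
Lemma first_block_sum_truncate K t x :
  first_block_sum K t 1 x = K (t ++ x) + first_block_sum (truncate (size t + size x) K) t 1 x.
Proof.
elim: x t => [|y x IH] t /=.
  rewrite addn0 cats0 /truncate ltnn mul0r addr0.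
  by rewrite (opv_E_unital space) mulr1.
rewrite (opv_E_unital space) (la1 bim) IH size_rcons addSnnS cat_rcons -addrA.
by rewrite (@first_block_sum_truncate_lt K _ t) // addnS.
Qed.

(** The recursion that determines the cumulants: the sum on the right only involves
cumulants with fewer arguments. *)
Lemma free_cumulant_rec c x :
  kappa (c :: x) = E (\prod_(z <- c :: x) z) -
    first_block_sum (truncate (size x).+1 kappa) [:: c] 1 x.
Proof. by rewrite moment_first_block first_block_sum_truncate /= add1n addrK. Qed.

Lemma balanced_truncate n : balanced (truncate n kappa).
Proof.
elim: n => [|n IH]; first by split=> *; rewrite /truncate !ltn0 ?mul0r.
(* Only the lists of n arguments are new; there, the recursion expresses kappa
   by moments and by shorter cumulants. *)
have trS l : (size l != n) -> truncate n.+1 kappa l = truncate n kappa l.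
  by move=> h; rewrite /truncate ltnS leq_eqVlt (negPf h).
have trn l : (size l == n) -> truncate n.+1 kappa l = kappa l.
  by move=> /eqP <-; rewrite /truncate ltnSn.
split=> [u y b z v|u y b].
  set l1 := (X in _ X = _); set l2 := (X in _ = _ X).
  have sz : size l1 = size l2 by rewrite !size_cat.
  have [e|ne] := boolP (size l1 == n); last first.
    by rewrite !trS -?sz // IH.1.
  rewrite !trn -?sz //; move: e; rewrite /l1 /l2 size_cat => /eqP e {l1 l2 sz}.
  have el : E (\prod_(z <- u ++ ra y b :: z :: v) z) =
            E (\prod_(z <- u ++ y :: la b z :: v) z).
    by rewrite !big_cat !big_cons /= !mulrA -(mulrA _ (ra y b)) (mul_ra_la bim) !mulrA.
  subst n; case: u el IH {trS trn} => [|c u] /= el IH; rewrite !free_cumulant_rec el.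
    by congr (_ - _); exact: (first_block_sum_bal_next IH [::]).
  by congr (_ - _); rewrite !size_cat; exact: (first_block_sum_bal IH).
have [e|ne] := boolP (size (rcons u y) == n); last first.
  by rewrite !trS ?IH.2 // size_rcons; rewrite size_rcons in ne.
rewrite !trn //; last by rewrite size_rcons; rewrite size_rcons in e.
move: e; rewrite size_rcons => /eqP e.
subst n.
have el : E (\prod_(z <- rcons u (ra y b)) z) = E (\prod_(z <- rcons u y) z) * b.
  by rewrite -!cats1 !big_cat !big_seq1 /= -(mul_ra bim) E_ra.
case: u el IH {trS trn} => [|c u] /= el IH; rewrite !free_cumulant_rec el mulrBl.
  by congr (_ - _); rewrite /truncate /= !mul0r.
by congr (_ - _); rewrite !size_rcons; exact: (first_block_sum_bal_last IH).
Qed.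

Lemma free_cumulants_balanced : balanced kappa.
Proof.
have tr n l : (size l < n)%N -> kappa l = truncate n kappa l by rewrite /truncate => ->.
split=> [u y b z v|u y b].
  set n := (size (u ++ y :: la b z :: v)).+1.
  by rewrite !(tr n) ?(balanced_truncate n).1 // /n !size_cat.
by rewrite !(tr (size u).+2) ?(balanced_truncate _).2 // size_rcons.
Qed.

(** Balancedness moves the moments of the gaps to the right of the preceding
elements of the block. *)
Lemma first_block_sum_masks acc y p x :
  first_block_sum kappa (rcons acc y) p x =
  \sum_(s : (size x).-tuple bool)
    kappa (acc ++ ra y (E (p * \prod_(z <- head [::] (gaps s x)) z)) ::
      [seq ra q.1 (E (\prod_(z <- q.2) z))
         | q <- zip (mask s x) (behead (gaps s x))]).
Proof.
have bal := free_cumulants_balanced.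
elim: x acc y p => [|z x IH] acc y p /=.
  rewrite (sum_tuple0 (fun s => kappa (acc ++ ra y (E (p * \prod_(z <- [::]) z)) ::
    [seq ra q.1 (E (\prod_(z <- q.2) z)) | q <- zip (mask s [::]) [::]]))).
  by rewrite big_nil mulr1 mask0 /= cats1 bal.2.
rewrite (sum_tuple_cons _ (fun s => kappa (acc ++ ra y (E (p * \prod_(z <-
   head [::] (gaps s (z :: x))) z)) :: [seq ra q.1 (E (\prod_(z <- q.2) z))
         | q <- zip (mask s (z :: x)) (behead (gaps s (z :: x)))]))).
congr (_ + _).
  have -> : first_block_sum kappa (rcons (rcons acc y) (la (E p) z)) 1 x =
            first_block_sum kappa (rcons (rcons acc (ra y (E p))) z) 1 x.
    by rewrite -!cats1 -!catA /= first_block_sum_bal_block.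
  rewrite IH.
  apply: eq_bigr => s _; rewrite /= big_nil mulr1 cat_rcons.
  by rewrite [gaps s x]gaps_head /= mul1r.
rewrite IH; apply: eq_bigr => s _ /=.
by rewrite big_cons mulrA.
Qed.

(** Here [s] selects the elements other than [c] of the block of [c]. *)
Theorem free_moment_masks c x :
  E (\prod_(z <- c :: x) z) =
  \sum_(s : (size x).-tuple bool)
    kappa (ra c (E (\prod_(z <- head [::] (gaps s x)) z)) ::
      [seq ra q.1 (E (\prod_(z <- q.2) z))
         | q <- zip (mask s x) (behead (gaps s x))]).
Proof.
rewrite moment_first_block (first_block_sum_masks [::]).
by apply: eq_bigr => s _; rewrite mul1r.
Qed.

End Free.

Section Boolean.
Variable beta : seq A -> B.
Hypothesis beta_boolean : boolean_cumulants la ra E beta.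

Lemma boolean_moments x : x != [::] ->
  E (\prod_(z <- x) z) = cumulant_sum la beta false [::] 1 x.
Proof.
move=> x0; have n0 : (0 < size x)%N by case: x x0.
rewrite -(sum_kappa_partition ra beta (la1 bim) false (in_tuple x) n0).
exact: (beta_boolean.2 _ (in_tuple x) n0).
Qed.

Lemma cumulant_sum_prefixes t x :
  cumulant_sum la beta false [:: t] 1 x + cumulant_sum la beta false [::] (beta t) x =
  \sum_(j < (size x).+1) beta (t ++ take j x) * E (\prod_(z <- drop j x) z).
Proof.
elim: x t => [|y x IH] t.
  by rewrite big_ord1 /= add0r cats0 big_nil (opv_E_unital space) mulr1.
rewrite big_ord_recl take0 drop0 cats0 (cumulant_sum_nil boolean_moments) addrC.
congr (_ + _); rewrite /= add0r (la1 bim) IH; apply: eq_bigr => j _.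
by rewrite cat_rcons.
Qed.

(** The block of [c] is [c :: take j x]. *)
Theorem boolean_moment_prefixes c x :
  E (\prod_(z <- c :: x) z) =
  \sum_(j < (size x).+1) beta (c :: take j x) * E (\prod_(z <- drop j x) z).
Proof.
by rewrite -(cumulant_sum_prefixes [:: c]) boolean_moments //= (la1 bim) addr0.
Qed.

End Boolean.

End OperatorValued.

(** * Operadic composition of words of multilinear maps *)

Section Letters.
Variables (K : fieldType) (B : lmodType K).
Implicit Types (l : letter (HomB B)) (u v : seq (letter (HomB B))).

Lemma letter_ext l1 l2 : tag l1 = tag l2 ->
  (forall s, size s = arity l1 -> app l1 s = app l2 s) -> l1 = l2.
Proof.
case: l1 l2 => [k f] [k2 g] /= e; subst k2 => h; congr (Tagged _ _).
apply: val_inj; apply/funext => t.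
by have := h t (size_tuple t); rewrite /app /= valK.
Qed.

Lemma app_idB (x : B) : app (idB B) [:: x] = x.
Proof. by rewrite -[[:: x]]/(tval [tuple x]) app_mkhom /thead (tnth_nth x). Qed.

Lemma app_compose l u s : (0 < inputs u)%N -> size s = inputs u ->
  app (compose l u) s = app l (apps u s).
Proof.
move=> u0 su; have st : size s == (inputs u).-1.+1 by rewrite prednK // su.
by rewrite -[s in LHS]/(tval (Tuple st)) app_mkhom.
Qed.

Lemma inputs_cat u v : inputs (u ++ v) = (inputs u + inputs v)%N.
Proof. by rewrite /inputs map_cat sumn_cat. Qed.

Lemma inputs_ids p : inputs (nseq p (idB B)) = p.
Proof. by rewrite /inputs map_nseq sumn_nseq mul1n. Qed.

Lemma apps_ids p s : size s = p -> apps (nseq p (idB B)) s = s.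
Proof.
elim: p s => [|p IH] [|x s] //= [sz].
by rewrite take0 drop0 app_idB IH.
Qed.

Lemma compose_idB l : compose (idB B) [:: l] = l.
Proof.
have il : inputs [:: l] = arity l by rewrite /inputs /= addn0.
apply: letter_ext => [|s]; first exact: (congr1 predn il).
rewrite -[arity _]/((inputs [:: l]).-1.+1) il => ss.
by rewrite app_compose ?il //= take_oversize ?ss // app_idB.
Qed.

Lemma compose_ids l : compose l (nseq (arity l) (idB B)) = l.
Proof.
apply: letter_ext => [|s]; first exact: (congr1 predn (inputs_ids (arity l))).
rewrite -[arity _]/((inputs (nseq (arity l) (idB B))).-1.+1) inputs_ids => ss.
by rewrite app_compose ?inputs_ids // apps_ids.
Qed.

Lemma compose_word_cat u1 u2 v1 v2 : size v1 = inputs u1 ->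
  compose_word (u1 ++ u2) (v1 ++ v2) = compose_word u1 v1 ++ compose_word u2 v2.
Proof.
elim: u1 v1 => [|l u1 IH] v1; first by case: v1.
rewrite /inputs /= -/(inputs _) => sv.
have hl : (arity l <= size v1)%N by rewrite sv leq_addr.
rewrite takel_cat // drop_cat.
case: ltnP => h; first by rewrite IH // size_drop sv addKn.
have e : arity l = size v1 by apply/eqP; rewrite eqn_leq hl h.
rewrite e subnn drop0 drop_size -[v2 in LHS]cat0s IH //=.
by apply/eqP; rewrite eq_sym -(eqn_add2l (arity l)) -sv e addn0.
Qed.

Lemma compose_word_idl p v : size v = p -> compose_word (nseq p (idB B)) v = v.
Proof.
by move=> <-; elim: v => //= l v IH; rewrite take0 drop0 compose_idB IH.
Qed.

Lemma compose_word_idr u : compose_word u (nseq (inputs u) (idB B)) = u.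
Proof.
elim: u => //= l u IH; rewrite /inputs /= -/(inputs _) nseqD.
by rewrite take_size_cat ?size_nseq // drop_size_cat ?size_nseq // compose_ids IH.
Qed.

Lemma compose_word1 l v : size v = arity l -> compose_word [:: l] v = [:: compose l v].
Proof. by move=> sv; rewrite /= -sv take_size. Qed.

Lemma nabla_wclass n m k u v : size u = n -> inputs u = k -> size v = k -> inputs v = m ->
  nabla B n m (vten (wclass n k u) (wclass k m v)) = wclass n m (compose_word u v).
Proof.
move=> un ik vk im.
have hu : (size u == n) && (inputs u == k) by rewrite un ik !eqxx.
have hv : (size v == k) && (inputs v == m) by rewrite vk im !eqxx.
exact: (nablaE (exist _ u hu : word _ n k) (exist _ v hv : word _ k m)).
Qed.

Lemma nabla_idr n m (x : words (HomB B) n m) : nabla B n m (vten x (idB_word B m)) = x.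
Proof.
move: x; apply: presented_ext => // [c x y|x]; first by rewrite vtenPl linearP.
have /andP[/eqP sx /eqP ix] := valP x.
rewrite -wclass_gen /idB_word nabla_wclass ?size_nseq ?inputs_ids //.
by rewrite -[X in nseq X]ix compose_word_idr.
Qed.

Lemma nabla_idl n m (x : words (HomB B) n m) : nabla B n m (vten (idB_word B n) x) = x.
Proof.
move: x; apply: presented_ext => // [c x y|x]; first by rewrite vtenPr linearP.
have /andP[/eqP sx /eqP ix] := valP x.
rewrite -wclass_gen /idB_word nabla_wclass ?size_nseq ?inputs_ids //.
by rewrite compose_word_idl.
Qed.

(** Linearity of a word of multilinear maps in one of its letters. *)
Lemma wclass_letter_sum n m u v l I (r : seq I) (P : pred I) (L : I -> letter (HomB B)) :
  (forall i, P i -> tag (L i) = tag l) ->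
  (forall s, size s = arity l -> app l s = \sum_(i <- r | P i) app (L i) s) ->
  wclass n m (u ++ l :: v) = \sum_(i <- r | P i) wclass n m (u ++ L i :: v).
Proof.
move=> tl al.
pose cast i : HomB B (tag l) := if eqP is ReflectT e then
  ecast k (HomB B k) e (tagged (L i)) else 0.
have castE i : P i -> mkletter (cast i) = L i.
  move=> Pi; rewrite /cast; case: eqP => [e|]; last by rewrite tl.
  by case: (L i) e => k f /= e; case: _ / e.
pose Phi (h : HomB B (tag l)) := wclass n m (u ++ mkletter h :: v).
have Phi_lin : linear Phi.
  by move=> c h1 h2; apply: wclass_respects; exists u, v, (tag l), h1, h2.
pose PhiL : {linear HomB B (tag l) -> words (HomB B) n m} :=
  HB.pack Phi (GRing.isLinear.Build _ _ _ _ Phi Phi_lin).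
have -> : l = mkletter (\sum_(i <- r | P i) cast i).
  apply: letter_ext => // s ss; rewrite al //.
  transitivity (\sum_(i <- r | P i) app (mkletter (cast i)) s).
    by apply: eq_bigr => i Pi; rewrite castE.
  pose Ap (h : HomB B (tag l)) := app (mkletter h) s.
  have Ap_lin : linear Ap by move=> c h1 h2; apply: app_comb.
  pose ApL : {linear HomB B (tag l) -> B} :=
    HB.pack Ap (GRing.isLinear.Build _ _ _ _ Ap Ap_lin).
  exact: esym (raddf_sum ApL r P cast).
rewrite -[LHS]/(PhiL _) raddf_sum; apply: eq_bigr => i Pi /=.
by rewrite /Phi castE.
Qed.

End Letters.

(** * Half coproducts on words *)

Lemma sum_tuple_cast (V : nmodType) N N' (F : seq bool -> V) : N = N' ->
  \sum_(s : N.-tuple bool) F s = \sum_(s : N'.-tuple bool) F s.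
Proof. by move->. Qed.

Lemma sum_tuple_single (V : nmodType) N (F : seq bool -> V) b :
  (forall s, size s = N -> s != nseq N b -> F s = 0) ->
  \sum_(s : N.-tuple bool) F s = F (nseq N b).
Proof.
move=> F0; rewrite (bigD1 (nseq_tuple N b)) //= big1 ?addr0 // => s ns.
by apply: F0; rewrite ?size_tuple.
Qed.

(** [s] consists of [false]'s followed by [true]'s. *)
Definition prefix_mask (s : bitseq) := all id (drop (find id s) s).

Lemma all_id_nseq (s : bitseq) : all id s -> s = nseq (size s) true.
Proof. by elim: s => //= -[] s IH //= /IH <-. Qed.

Lemma sum_tuple_prefix (V : nmodType) N (F : seq bool -> V) :
  (forall s, size s = N -> ~~ prefix_mask s -> F s = 0) ->
  \sum_(s : N.-tuple bool) F s =
  \sum_(j < N.+1) F (nseq j false ++ nseq (N - j) true).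
Proof.
elim: N F => [|N IH] F F0; first by rewrite sum_tuple0 big_ord1.
rewrite sum_tuple_cons big_ord_recl /=; congr (_ + _).
  apply: (sum_tuple_single (F := fun s => F (true :: s))) => s sz ns.
  apply: F0 => /=; first by rewrite sz.
  by apply: contra ns; rewrite /prefix_mask /= => /all_id_nseq {1}->; rewrite sz.
rewrite (IH (fun s => F (false :: s))); first by [].
by move=> s sz ns; apply: F0; rewrite /= ?sz.
Qed.

Section Cuts.
Variables (K : fieldType) (A : lmodType K).
Implicit Types (x : seq A) (w : seq (seq A)).

Lemma size_mask_nilp s x : size s = size x -> nilp (mask s x) = all negb s.
Proof.
move=> sz; rewrite /nilp size_mask // -[all _ _]negbK -has_predC eqn0Ngt -has_count.
by congr (~~ _); apply: eq_has => -[].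
Qed.

Lemma gaps_nilp s x : size s = size x -> all (@nilp A) (gaps s x) = all id s.
Proof.
by elim: x s => [|a x IH] [|b s] //= [sz]; case: b => /=; rewrite ?IH.
Qed.

Lemma gaps_prefix_mask s x : size s = size x ->
  all (@nilp A) (behead (gaps s x)) -> prefix_mask s.
Proof.
elim: x s => [|a x IH] [|b s] //= [sz]; case: b => /=; last exact: IH.
by rewrite /prefix_mask /= gaps_nilp.
Qed.

Lemma gaps_prefix j x : (j <= size x)%N ->
  gaps (nseq j false ++ nseq (size x - j) true) x = take j x :: nseq (size x - j) [::].
Proof.
elim: x j => [|a x IH] [|j] //= hj; last by rewrite subSS IH.
by have := IH 0%N isT; rewrite subn0 take0 /= => ->.
Qed.

Lemma mask_prefix j x : (j <= size x)%N ->
  mask (nseq j false ++ nseq (size x - j) true) x = drop j x.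
Proof.
elim: x j => [|a x IH] [|j] //= hj; last by rewrite subSS IH.
by rewrite mask_true.
Qed.

Lemma gaps_true x : gaps (nseq (size x) true) x = nseq (size x).+1 [::].
Proof. by have := @gaps_prefix 0 x isT; rewrite subn0 take0. Qed.

Lemma gaps_false x : gaps (nseq (size x) false) x = [:: x].
Proof. by have := gaps_prefix (leqnn (size x)); rewrite subnn cats0 take_size. Qed.

Lemma cut_left_nilp s w : size s = size (flatten w) ->
  all (@nilp A) (cut_left s w) = all negb s.
Proof.
elim: w s => [|x w IH] s /=; first by move/size0nil => ->.
rewrite size_cat => sz; have hs : (size x <= size s)%N by rewrite sz leq_addr.
rewrite size_mask_nilp ?size_takel // IH; last by rewrite size_drop sz addKn.
by rewrite -all_cat cat_take_drop.
Qed.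

Lemma cut_right_nilp s w : size s = size (flatten w) ->
  all (@nilp A) (cut_right s w) = all id s.
Proof.
elim: w s => [|x w IH] s /=; first by move/size0nil => ->.
rewrite size_cat => sz; have hs : (size x <= size s)%N by rewrite sz leq_addr.
rewrite all_cat gaps_nilp ?size_takel // IH; last by rewrite size_drop sz addKn.
by rewrite -all_cat cat_take_drop.
Qed.

Lemma cut_left_true w : cut_left (nseq (size (flatten w)) true) w = w.
Proof.
elim: w => //= x w IH; rewrite size_cat nseqD take_size_cat ?size_nseq //.
by rewrite drop_size_cat ?size_nseq // IH mask_true.
Qed.

Lemma cut_left_false w : cut_left (nseq (size (flatten w)) false) w = nseq (size w) [::].
Proof.
elim: w => //= x w IH; rewrite size_cat nseqD take_size_cat ?size_nseq //.
by rewrite drop_size_cat ?size_nseq // IH mask_false.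
Qed.

Lemma cut_right_true w :
  cut_right (nseq (size (flatten w)) true) w = nseq (size w + size (flatten w)) [::].
Proof.
elim: w => //= x w IH; rewrite size_cat nseqD take_size_cat ?size_nseq //.
by rewrite drop_size_cat ?size_nseq // IH gaps_true -nseqD addSn addnCA.
Qed.

Lemma cut_right_false w : cut_right (nseq (size (flatten w)) false) w = w.
Proof.
elim: w => //= x w IH; rewrite size_cat nseqD take_size_cat ?size_nseq //.
by rewrite drop_size_cat ?size_nseq // IH gaps_false.
Qed.

Lemma cut_left_nils p s x w :
  cut_left s (nseq p [::] ++ x :: w) =
  nseq p [::] ++ mask (take (size x) s) x :: cut_left (drop (size x) s) w.
Proof. by elim: p => //= p IH; rewrite take0 drop0 IH. Qed.

Lemma cut_right_nils p s x w :
  cut_right s (nseq p [::] ++ x :: w) =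
  nseq p [::] ++ gaps (take (size x) s) x ++ cut_right (drop (size x) s) w.
Proof. by elim: p => //= p IH; rewrite drop0 IH. Qed.

Lemma flatten_nils p w : flatten (nseq p [::] ++ w) = flatten w.
Proof. by elim: p. Qed.

Lemma all_nilpP w : all (@nilp A) w -> w = nseq (size w) [::].
Proof. by elim: w => //= -[|//] w IH /IH <-. Qed.

Lemma split_first_nonempty w : ~~ all (@nilp A) w ->
  exists p a w', a != [::] /\ w = nseq p [::] ++ a :: w'.
Proof.
elim: w => //= -[|a x] w IH /=; last by exists 0%N, (a :: x), w.
by move/IH => [p [y [w' [yn ->]]]]; exists p.+1, y, w'.
Qed.

End Cuts.

Section Morphisms.
Variables (K : fieldType) (A B : lmodType K).
Local Notation mor := (bimorphism (W A) (words (HomB B))).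
Implicit Types (f g : mor) (w : seq (seq A)).

Lemma infinitesimal_eq0 f n m w : infinitesimal f ->
  count (predC (@nilp A)) w != 1%N -> f n m (Wclass n m w) = 0.
Proof.
move=> [_ f0] cw; apply: f0 => p q a an ew; case/negP: cw.
rewrite ew count_cat /= !count_nseq /= !mul0n !add0n addn0.
by case: a an {ew}.
Qed.

Lemma mor_unit_word n m w : size w = n -> (size w + size (flatten w))%N = m ->
  mor_unit A B n m (Wclass n m w) =
  if all (@nilp A) w then wclass n m (nseq n (idB B)) else 0.
Proof.
move=> sw fw; rewrite /mor_unit /bicomp /= /counit wliftE //.
case: ifP => hw; last by rewrite linear0.
rewrite /eta /= /eta_fun.
under eq_bigr do rewrite mxE.
have nm : (n == m) = true.
  apply/eqP; rewrite -fw (all_nilpP hw) sw -[nseq _ _]cats0 flatten_nils.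
  by rewrite addn0 size_cat size_nseq addn0.
by rewrite sumr_const card_ord nm scale1r.
Qed.

(** The term of the half-shuffle of [f] and [g] on [w] indexed by the set [s] of
letters that go to the left. *)
Definition cut_value f g n m (s : bitseq) w : words (HomB B) n m :=
  let k := size (cut_right s w) in
  nabla B n m (vten (f n k (Wclass n k (cut_left s w))) (g k m (Wclass k m (cut_right s w)))).

Lemma mor_cuts sel f g n m w : size w = n -> (size w + size (flatten w))%N = m ->
  nabla B n m (vmap f g n m (coproduct_on A sel n m (Wclass n m w))) =
  \sum_(s : (size (flatten w)).-tuple bool | sel s) cut_value f g n m s w.
Proof.
move=> sw fw; rewrite coproductE // /cuts !linear_sum; apply: eq_bigr => s _.
by rewrite /cut vmapE.
Qed.

Lemma mor_prec_cuts f g n m w : size w = n -> (size w + size (flatten w))%N = m ->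
  mor_prec f g n m (Wclass n m w) =
  \sum_(s : (size (flatten w)).-tuple bool | head false s && has negb s)
    cut_value f g n m s w.
Proof. exact: (mor_cuts (fun s => head false s && has negb s)). Qed.

Lemma mor_succ_cuts f g n m w : size w = n -> (size w + size (flatten w))%N = m ->
  mor_succ f g n m (Wclass n m w) =
  \sum_(s : (size (flatten w)).-tuple bool | ~~ head true s && has id s)
    cut_value f g n m s w.
Proof. exact: (mor_cuts (fun s => ~~ head true s && has id s)). Qed.

Lemma cut_valueE f g n m s w k : size (cut_right s w) = k ->
  cut_value f g n m s w =
  nabla B n m (vten (f n k (Wclass n k (cut_left s w))) (g k m (Wclass k m (cut_right s w)))).
Proof. by move=> <-. Qed.

Lemma bisubE f g n m z : bisub f g n m z = f n m z - g n m z.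
Proof. by []. Qed.

(** [f] sends each word of empty words to a word of identities of [B]. *)
Definition unital f := forall p, f p p (Wclass p p (nseq p [::])) = idB_word B p.

Lemma size_flatten_gt0 w : ~~ all (@nilp A) w -> (0 < size (flatten w))%N.
Proof. by elim: w => //= -[|a x] w IH. Qed.

(** The summand [f w] is the term in which all the letters go to the left, which is
left out of the half coproduct.  In the other terms some letter goes to the
right, where the unit vanishes. *)
Lemma prec_cuts f F n m w : size w = n -> (size w + size (flatten w))%N = m ->
  unital F -> ~~ all (@nilp A) w ->
  mor_prec_ext f F n m (Wclass n m w) =
  \sum_(s : (size (flatten w)).-tuple bool | head false s) cut_value f F n m s w.
Proof.
move=> sw fw Fu nw; rewrite -[LHS]/(f n m (Wclass n m w) +
  mor_prec f (bisub F (mor_unit A B)) n m (Wclass n m w)) mor_prec_cuts //.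
have N0 := size_flatten_gt0 nw.
rewrite [RHS](bigD1 (nseq_tuple (size (flatten w)) true)) /=; last first.
  by case: (size _) N0.
congr (_ + _).
  rewrite (@cut_valueE _ _ _ _ _ _ m) cut_right_true ?size_nseq // fw cut_left_true.
  by rewrite Fu nabla_idr.
apply: eq_big => [s|s /andP[_ hs]].
  congr (_ && _); rewrite -[has _ _]negbK -all_predC.
  congr (~~ _); apply/idP/eqP => [h|-> /=]; last by rewrite all_nseq orbT.
  apply: val_inj; rewrite /= -[X in nseq X](size_tuple s); apply: all_id_nseq.
  by apply: sub_all h => -[].
rewrite /cut_value bisubE mor_unit_word //.
- rewrite cut_right_nilp ?size_tuple // -[all _ _]negbK -has_predC.
  by rewrite (eq_has (a2 := negb)) // hs /= subr0.
- by rewrite size_cut_right ?size_tuple // -addnA size_flatten_cut ?size_tuple.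
Qed.

(** The summand [f w] is the term in which all the letters go to the right. *)
Lemma succ_cuts F f n m w : size w = n -> (size w + size (flatten w))%N = m ->
  unital F -> ~~ all (@nilp A) w ->
  mor_succ_ext F f n m (Wclass n m w) =
  \sum_(s : (size (flatten w)).-tuple bool | ~~ head true s) cut_value F f n m s w.
Proof.
move=> sw fw Fu nw; rewrite -[LHS]/(f n m (Wclass n m w) +
  mor_succ (bisub F (mor_unit A B)) f n m (Wclass n m w)) mor_succ_cuts //.
have N0 := size_flatten_gt0 nw.
rewrite [RHS](bigD1 (nseq_tuple (size (flatten w)) false)) /=; last first.
  by case: (size _) N0.
congr (_ + _).
  rewrite (@cut_valueE _ _ _ _ _ _ n) cut_right_false // cut_left_false sw.
  by rewrite Fu nabla_idl.
apply: eq_big => [s|s /andP[_ hs]].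
  congr (_ && _); rewrite -[has _ _]negbK -all_predC.
  congr (~~ _); apply/idP/eqP => [h|-> /=]; last by rewrite all_nseq orbT.
  apply: val_inj; rewrite /= -[X in nseq X](size_tuple s); apply/all_pred1P.
  by apply: sub_all h => -[].
rewrite /cut_value bisubE mor_unit_word.
- rewrite cut_left_nilp ?size_tuple // -[all _ _]negbK -has_predC.
  by rewrite (eq_has (a2 := id)) ?hs /= ?subr0 // => -[].
- by rewrite size_cut_left.
- by rewrite size_cut_left size_cut_right ?size_tuple.
Qed.

Lemma prec_nils f F n m w : infinitesimal f -> size w = n ->
  (size w + size (flatten w))%N = m -> all (@nilp A) w ->
  mor_prec_ext f F n m (Wclass n m w) = 0.
Proof.
move=> hf sw fw nw; rewrite -[LHS]/(f n m (Wclass n m w) +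
  mor_prec f (bisub F (mor_unit A B)) n m (Wclass n m w)) mor_prec_cuts //.
rewrite infinitesimal_eq0 //; last first.
  rewrite (_ : count _ _ = 0%N) //; apply/eqP.
  by rewrite -leqn0 leqNgt -has_count has_predC nw.
rewrite add0r big_pred0 // => s.
have /eqP : size (flatten w) = 0%N.
  by rewrite (all_nilpP nw) -[nseq _ _]cats0 flatten_nils.
by case: s => -[|b s] //= /eqP <-.
Qed.

Lemma succ_nils F f n m w : infinitesimal f -> size w = n ->
  (size w + size (flatten w))%N = m -> all (@nilp A) w ->
  mor_succ_ext F f n m (Wclass n m w) = 0.
Proof.
move=> hf sw fw nw; rewrite -[LHS]/(f n m (Wclass n m w) +
  mor_succ (bisub F (mor_unit A B)) f n m (Wclass n m w)) mor_succ_cuts //.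
rewrite infinitesimal_eq0 //; last first.
  rewrite (_ : count _ _ = 0%N) //; apply/eqP.
  by rewrite -leqn0 leqNgt -has_count has_predC nw.
rewrite add0r big_pred0 // => s.
have /eqP : size (flatten w) = 0%N.
  by rewrite (all_nilpP nw) -[nseq _ _]cats0 flatten_nils.
by case: s => -[|b s] //= /eqP <-.
Qed.

(** A choice of the multilinear map that is the value on each one-letter word. *)
Lemma letters_of_values f phi : has_values f phi ->
  exists L : seq A -> letter (HomB B), forall a, a != [::] ->
    [/\ tag (L a) = size a,
        f 1%N (size a).+1 (Wclass _ _ [:: a]) = wclass _ _ [:: L a] &
        forall s, size s = (size a).+1 -> app (L a) s = phi a s].
Proof.
move=> hf; suff /choice[L hL] : forall a, exists l : letter (HomB B), a != [::] ->
    [/\ tag l = size a,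
        f 1%N (size a).+1 (Wclass _ _ [:: a]) = wclass _ _ [:: l] &
        forall s, size s = (size a).+1 -> app l s = phi a s] by exists L.
move=> a; have [->|an] := eqVneq a [::]; first by exists (idB B).
have [h e hv] := hf a an; exists (mkletter h) => _; split=> // s ss.
have st : size s == (size a).+1 by rewrite ss.
by rewrite -[s]/(tval (Tuple st)) -hv /app valK.
Qed.

Section Letters.
Variable L : seq A -> letter (HomB B).

Lemma inputs_letters w : (forall a, tag (L a) = size a) ->
  inputs (map L w) = (size w + size (flatten w))%N.
Proof.
move=> tL; elim: w => //= a w IH.
by rewrite /inputs /= -/(inputs _) IH /arity tL size_cat !addSn addnCA.
Qed.

Lemma hmorphism_word f n m w : hmorphism f ->
  (forall a, tag (L a) = size a) ->
  (forall a, f 1%N (size a).+1 (Wclass _ _ [:: a]) = wclass _ _ [:: L a]) ->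
  size w = n -> (size w + size (flatten w))%N = m ->
  f n m (Wclass n m w) = wclass n m (map L w).
Proof.
move=> [f0 fM] tL fL; elim: w n m => [|a w IH] n m /=; first by move=> <- <-.
move=> <-; have -> : ((size w).+1 + size (a ++ flatten w) =
   (size a).+1 + (size w + size (flatten w)))%N by rewrite size_cat !addSn addnCA.
move=> <-.
have := fM _ _ _ _ (Wclass 1 (size a).+1 [:: a]) (Wclass (size w) _ w).
move=> /(_ (size w + size (flatten w))%N).
rewrite hprod_Wclass //=; last by rewrite cats0.
move=> ->; rewrite fL IH // hprod_wclass //= ?size_map ?inputs_letters //.
by rewrite /inputs /arity /= tL addn0.
Qed.

Lemma infinitesimal_word f n m p q a : infinitesimal f -> a != [::] ->
  tag (L a) = size a ->
  f 1%N (size a).+1 (Wclass _ _ [:: a]) = wclass _ _ [:: L a] ->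
  n = (p + 1 + q)%N -> m = (p + (size a).+1 + q)%N ->
  f n m (Wclass n m (nseq p [::] ++ a :: nseq q [::])) =
  wclass n m (nseq p (idB B) ++ L a :: nseq q (idB B)).
Proof.
move=> [hf _] an tL fL -> ->; rewrite hf // fL /idB_word.
have iL : inputs [:: L a] = (size a).+1 by rewrite /inputs /arity /= tL addn0.
rewrite !hprod_wclass ?size_cat ?inputs_cat ?size_nseq ?inputs_ids ?iL //.
by rewrite -catA.
Qed.

End Letters.

End Morphisms.

(** * The identities on words with one letter *)

Lemma size_apps (K : fieldType) (B : lmodType K) (q : seq (letter (HomB B))) s :
  size (apps q s) = size q.
Proof. by elim: q s => //= l q IH s; rewrite IH. Qed.

Lemma zip_take (S T : Type) (s : seq S) (t : seq T) : zip s (take (size s) t) = zip s t.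
Proof. by elim: s t => [|x s IH] [|y t] //=; rewrite IH. Qed.

Lemma size_gaps (K : fieldType) (A : lmodType K) s (x : seq A) : size s = size x ->
  size (gaps s x) = (size (mask s x)).+1 /\
  (size (gaps s x) + size (flatten (gaps s x)))%N = (size x).+1.
Proof.
move=> sx; have sx' : size s = size (flatten [:: x]) by rewrite /= cats0.
have := size_cut_right sx'; have := size_flatten_cut sx'.
rewrite /= !cats0 take_oversize ?sx // => h1 h2.
by rewrite -h1 {2}h2; split; rewrite ?h2 ?add1n // addSn.
Qed.

Section OneLetter.
Variables (C : numClosedFieldType) (B A : algType C) (starB : B -> B) (starA : A -> A).
Variables (la : B -> A -> A) (ra : A -> B -> A) (E : {linear A -> B}).
Hypothesis space : opv_probability_space starB starA la ra E.

Let bim := opv_bimodule space.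

(** The list a_1 b_1, ..., a_n b_n. *)
Definition zip_mulr (x : seq A) (s : seq B) : seq A := [seq ra q.1 q.2 | q <- zip x s].

Arguments zip_mulr : simpl never.

Lemma zip_mulr_cons y x b s : zip_mulr (y :: x) (b :: s) = ra y b :: zip_mulr x s.
Proof. by []. Qed.

Lemma size_zip_mulr x s : size s = size x -> size (zip_mulr x s) = size x.
Proof. by move=> sz; rewrite size_map size_zip sz minnn. Qed.

Lemma zip_mulr_takel x s : zip_mulr x (take (size x) s) = zip_mulr x s.
Proof. by rewrite /zip_mulr zip_take. Qed.

Lemma take_zip_mulr j x s : take j (zip_mulr x s) = zip_mulr (take j x) (take j s).
Proof.
by rewrite /zip_mulr; elim: j x s => [|j IH] [|y x] [|b s] //=; rewrite IH.
Qed.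

Lemma drop_zip_mulr j x s : drop j (zip_mulr x s) = zip_mulr (drop j x) (drop j s).
Proof.
rewrite /zip_mulr; elim: j x s => [|j IH] [|y x] [|b s] //=; rewrite ?IH //.
  by case: (drop j s).
by case: (drop j x).
Qed.

Lemma sandwich_cons y x b0 b1 s :
  sandwich la ra (y :: x) (b0 :: b1 :: s) = la b0 (ra y b1) :: zip_mulr x s.
Proof. by []. Qed.

(** [L a] is the map (b_0, ..., b_n) |-> b_0 E(a_1 b_1 ... a_n b_n), the empty word
being sent to the identity of [B]. *)
Definition is_moment_letters (L : seq A -> letter (HomB B)) : Prop :=
  forall a, tag (L a) = size a /\
    forall b s, size s = size a ->
      app (L a) (b :: s) = b * E (\prod_(z <- zip_mulr a s) z).

(** The map [L a] has the values [phi a], for non-empty words [a]. *)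
Definition are_letters_of (L : seq A -> letter (HomB B)) (phi : seq A -> seq B -> B) : Prop :=
  forall a, a != [::] -> tag (L a) = size a /\
    forall s, size s = (size a).+1 -> app (L a) s = phi a s.

Variable eL : seq A -> letter (HomB B).
Hypothesis eLP : is_moment_letters eL.

(** Feeding the arguments of a word to the moments of its gaps amounts to cutting
the word of the products a_i b_i in the same way. *)
Lemma gaps_zip_mulr s x t : size t = size x ->
    [/\ (size (head [::] (gaps s x)) <= size x)%N,
      head [::] (gaps s (zip_mulr x t)) = zip_mulr (head [::] (gaps s x)) t &
      zip_mulr (mask s x) (apps (map eL (behead (gaps s x)))
        (drop (size (head [::] (gaps s x))) t)) =
      [seq ra q.1 (E (\prod_(z <- q.2) z))
         | q <- zip (mask s (zip_mulr x t)) (behead (gaps s (zip_mulr x t)))]].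
Proof.
elim: x s t => [|y x IH] s [|t1 t] //= => [_|[sz]].
  by rewrite /zip_mulr /= !mask0.
rewrite zip_mulr_cons.
have [h1 h2 h3] := IH (behead s) t sz.
case: s h1 h2 h3 => [|[] s] /= h1 h2 h3; split=> //.
- by rewrite zip_mulr_cons h2.
- rewrite [gaps s x]gaps_head [gaps s (zip_mulr x t)]gaps_head /=.
  have [-> eh] := eLP (head [::] (gaps s x)).
  rewrite eh; last by rewrite size_takel ?sz.
  by rewrite !zip_mulr_cons zip_mulr_takel -h2 (raM bim) h3.
- by rewrite zip_mulr_cons h2.
Qed.

Lemma inputs_moment w : inputs (map eL w) = (size w + size (flatten w))%N.
Proof. by apply: inputs_letters => a; have [] := eLP a. Qed.

Lemma free_letter kappa kL a t : free_cumulants la ra E kappa ->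
  are_letters_of kL (fun a s => kappa (sandwich la ra a s)) ->
  a != [::] -> size t = (size a).+1 ->
  app (eL a) t = \sum_(s : (size a).-tuple bool | head false s)
    app (compose (kL (mask s a)) (map eL (gaps s a))) t.
Proof.
move=> hk kLP; case: a => // x a _; case: t => [|t0 [|t1 t]] //= [sz].
have [_ ->] := eLP (x :: a); last by rewrite /= sz.
rewrite -(E_la space) (la_prod space) /= (free_moment_masks space hk).
rewrite [RHS]big_mkcond (sum_tuple_cons _ (fun s => if head false s then
   app (compose (kL (mask s (x :: a))) (map eL (gaps s (x :: a)))) (t0 :: t1 :: t) else 0)).
(* The sets that do not contain the first position are left out. *)
rewrite /= [X in _ + X]big1 // addr0 size_zip_mulr //.
apply: eq_bigr => s _.
have ss : size s = size a by rewrite size_tuple.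
have [g1 g2] := size_gaps ss.
rewrite app_compose; last 2 first.
- by rewrite -[_ :: map _ _]/(map eL ([::] :: gaps s a)) inputs_moment.
- by rewrite -[_ :: map _ _]/(map eL ([::] :: gaps s a)) inputs_moment /= addSn g2 sz.
have [_ ->] := kLP (x :: mask s a) isT; last by rewrite size_apps /= size_map g1.
have [_ h2 h3] := gaps_zip_mulr s sz.
(* The empty gap before the first letter is sent to the identity of B, so that
   the first argument of kappa is multiplied on the left by t0 alone. *)
rewrite /= [gaps s a]gaps_head /=.
have [e0 eh] := eLP [::]; have [e1 eh'] := eLP (head [::] (gaps s a)).
rewrite /arity e0 e1 /= eh // big_nil (opv_E_unital space) mulr1.
have [lh _ _] := gaps_zip_mulr s sz.
rewrite eh'; last by rewrite size_takel ?sz.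
rewrite sandwich_cons zip_mulr_takel h3 -h2 (raM bim) (la_ra bim).
by [].
Qed.

Lemma boolean_letter beta bL a t : boolean_cumulants la ra E beta ->
  are_letters_of bL (fun a s => beta (sandwich la ra a s)) ->
  a != [::] -> size t = (size a).+1 ->
  app (eL a) t = \sum_(j < size a)
    app (compose (eL (drop j.+1 a)) (bL (take j.+1 a) :: nseq (size a - j.+1) (idB B))) t.
Proof.
move=> hb bLP; case: a => // x a _; case: t => [|t0 [|t1 t]] //= [sz].
have [_ ->] := eLP (x :: a); last by rewrite /= sz.
rewrite -(E_la space) (la_prod space) /= (boolean_moment_prefixes space hb).
rewrite size_zip_mulr //; apply: eq_bigr => j _.
have ja : (j <= size a)%N by rewrite -ltnS.
have [tb vb] := bLP (x :: take j a) isT.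
have ib : inputs (bL (x :: take j a) :: nseq ((size a).+1 - j.+1) (idB B)) = (size a).+2.
  by rewrite /inputs /= -/(inputs _) inputs_ids /arity tb /= size_takel // subSS addSn addSn subnKC.
rewrite app_compose ?ib //= ?sz //.
rewrite /arity tb /= size_takel //.
rewrite apps_ids; last by rewrite size_drop sz subSS.
rewrite vb /=; last by rewrite !size_takel ?sz.
have [_ ->] := eLP (drop j a); last by rewrite !size_drop sz.
by rewrite take_zip_mulr drop_zip_mulr.
Qed.

End OneLetter.

(** * The identities on all words *)

Lemma vten0l (K : fieldType) (P Q : bicollection K) n m k (q : Q k m) :
  vten (0 : P n k) q = 0.
Proof.
have := @vtenPl K P Q n m k 1 0 0 q; rewrite !scale1r addr0 => h.
by apply: (addIr (vten (0 : P n k) q)); rewrite add0r -h.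
Qed.

Lemma vten0r (K : fieldType) (P Q : bicollection K) n m k (p : P n k) :
  vten p (0 : Q k m) = 0.
Proof.
have := @vtenPr K P Q n m k 1 p 0 0; rewrite !scale1r addr0 => h.
by apply: (addIr (vten p (0 : Q k m))); rewrite add0r -h.
Qed.

Lemma linear_add3 (K : fieldType) (U V : lmodType K) (f g h : {linear U -> V}) :
  linear (fun x => f x + (g x + h x)).
Proof.
move=> c x y; rewrite !linearP !scalerDr.
by rewrite (addrACA (c *: g x)) (addrACA (c *: f x)).
Qed.

(** If the summand vanishes unless the choices for the letters [x] are all [b], only
the choices for the letters [a] matter. *)
Lemma sum_tuple_first_word (K : fieldType) (V : lmodType K) (T : Type) (a x : seq T)
    (F : seq bool -> V) b :
  (forall s s', size s = size a -> size s' = size x -> s' != nseq (size x) b ->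
     F (s ++ s') = 0) ->
  \sum_(s : (size (a ++ x)).-tuple bool) F s =
  \sum_(s : (size a).-tuple bool) F (s ++ nseq (size x) b).
Proof.
move=> F0; rewrite (@sum_tuple_cast _ _ (size a + size x)%N) ?size_cat // big_tuple_cat.
apply: eq_bigr => s _.
apply: (sum_tuple_single (F := fun s' => F (s ++ s'))) => s' sz ns.
by apply: F0; rewrite ?size_tuple.
Qed.

Section FirstWord.
Variables (K : fieldType) (A B : lmodType K).
Local Notation mor := (bimorphism (W A) (words (HomB B))).
Variables (f F : mor) (L eL : seq A -> letter (HomB B)).
Hypothesis f_inf : infinitesimal f.
Hypothesis tL : forall a, a != [::] -> tag (L a) = size a.
Hypothesis fL : forall a, a != [::] ->
  f 1%N (size a).+1 (Wclass _ _ [:: a]) = wclass _ _ [:: L a].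
Hypothesis eL0 : eL [::] = idB B.
Hypothesis teL : forall a, tag (eL a) = size a.
Hypothesis FW : forall n m w, size w = n -> (size w + size (flatten w))%N = m ->
  F n m (Wclass n m w) = wclass n m (map eL w).

Variables (n m p : nat) (a : seq A) (w : seq (seq A)).
Hypothesis a0 : a != [::].
Local Notation pw := (nseq p [::] ++ a :: w).
Hypothesis size_pw : size pw = n.
Hypothesis inputs_pw : (size pw + size (flatten pw))%N = m.

Let n_eq : n = (p + 1 + size w)%N.
Proof. by rewrite -size_pw size_cat /= size_nseq addn1 addSnnS. Qed.

Let m_eq : m = (p + (size a).+1 + (size w + size (flatten w)))%N.
Proof. by rewrite -inputs_pw size_pw n_eq flatten_nils /= size_cat; lia. Qed.

Lemma count_nils_cons x w' : count (predC (@nilp A)) (nseq p [::] ++ x :: w') =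
  ((x != [::]) + count (predC (@nilp A)) w')%N.
Proof. by rewrite count_cat count_nseq /= mul0n add0n; case: x. Qed.

(** Only the letters of the first non-empty word [a] can go to the left, since
[f] vanishes on words with two non-empty letters. *)
Lemma prec_first_word :
  \sum_(s : (size (flatten pw)).-tuple bool | head false s) cut_value f F n m s pw =
  \sum_(s : (size a).-tuple bool | head false s)
    wclass n m (nseq p (idB B) ++
      compose (L (mask s a)) (map eL (gaps s a)) :: map eL w).
Proof.
rewrite big_mkcond [RHS]big_mkcond /= flatten_nils /=.
rewrite (@sum_tuple_first_word _ _ _ _ _
  (fun s => if head false s then cut_value f F n m s pw else 0) false).
  apply: eq_bigr => -[s ss] _ /=; move/eqP: ss => ss.
  have -> : head false (s ++ nseq (size (flatten w)) false) = head false s.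
    by case: (s) ss a0 => //; case: (a).
  case: ifP => // h.
  have ma : mask s a != [::] by case: (s) (a) ss h => [|[] s'] // [|y x].
  have [g1 g2] := size_gaps ss.
  have cl : cut_left (s ++ nseq (size (flatten w)) false) pw =
      nseq p [::] ++ mask s a :: nseq (size w) [::].
    by rewrite cut_left_nils take_size_cat // drop_size_cat // cut_left_false.
  have cr : cut_right (s ++ nseq (size (flatten w)) false) pw =
      nseq p [::] ++ gaps s a ++ w.
    by rewrite cut_right_nils take_size_cat // drop_size_cat // cut_right_false.
  have scr : size (nseq p [::] ++ gaps s a ++ w) =
      (p + (size (mask s a)).+1 + size w)%N.
    by rewrite !size_cat size_nseq g1 addnA.
  have icr : (size (nseq p [::] ++ gaps s a ++ w) +
      size (flatten (nseq p [::] ++ gaps s a ++ w)) = m)%N.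
    by rewrite m_eq flatten_nils flatten_cat !size_cat size_nseq -g2; lia.
  rewrite (cut_valueE _ _ _ _ (k := (p + (size (mask s a)).+1 + size w)%N)) ?cr //.
  rewrite cl (infinitesimal_word (L := L) f_inf ma (tL ma) (fL ma)) // FW //.
  have ids : map eL (nseq p [::]) = nseq p (idB B) by rewrite map_nseq eL0.
  have aL : arity (L (mask s a)) = (size (mask s a)).+1 by rewrite /arity tL.
  rewrite nabla_wclass; first last.
  - by rewrite inputs_letters.
  - by rewrite size_map.
  - by rewrite inputs_cat inputs_ids /inputs /= -/(inputs _) inputs_ids aL addnA.
  - by rewrite size_cat /= !size_nseq n_eq addn1 addSnnS.
  congr wclass; rewrite !map_cat ids compose_word_cat ?inputs_ids ?size_nseq //.
  rewrite compose_word_idl ?size_nseq //.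
  rewrite -cat1s compose_word_cat; last by rewrite /inputs /= addn0 aL size_map g1.
  rewrite compose_word1 ?aL ?size_map //.
  by rewrite compose_word_idl ?size_map.
(* A selected letter outside a makes a second non-empty word on the left. *)
move=> s s' ss ss' ns; case: ifP => // h.
rewrite /cut_value infinitesimal_eq0 //.
  by rewrite vten0l linear0.
rewrite cut_left_nils take_size_cat // drop_size_cat // count_nils_cons.
have -> : mask s a != [::].
  by case: (s) (a) a0 ss h => [|[] s1] // [|y x].
have : has (predC (@nilp A)) (cut_left s' w).
  rewrite has_predC cut_left_nilp //; apply: contra ns => /allP hn.
  by apply/eqP; rewrite -ss'; apply/all_pred1P/allP => x /hn; case: x.
by rewrite has_count add1n eqSS -lt0n.
Qed.

(** As the first letter of [a] goes to the right, so must exactly an initial segment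
of [a]: any other choice produces a second non-empty word on the right, where
[f] vanishes. *)
Lemma succ_first_word :
  \sum_(s : (size (flatten pw)).-tuple bool | ~~ head true s) cut_value F f n m s pw =
  \sum_(j < size a)
    wclass n m (nseq p (idB B) ++
      compose (eL (drop j.+1 a))
        (L (take j.+1 a) :: nseq (size a - j.+1) (idB B)) :: map eL w).
Proof.
have zero s : size s = size (flatten pw) -> ~~ head true s ->
    count (predC (@nilp A)) (cut_right s pw) != 1%N -> cut_value F f n m s pw = 0.
  by move=> sz h hc; rewrite /cut_value (infinitesimal_eq0 _ _ f_inf hc) vten0r linear0.
rewrite big_mkcond /= flatten_nils /=.
have split_count s s' : size s = size a -> size s' = size (flatten w) ->
    count (predC (@nilp A)) (cut_right (s ++ s') pw) =
    (count (predC (@nilp A)) (gaps s a) + count (predC (@nilp A)) (cut_right s' w))%N.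
  move=> ss ss'; rewrite cut_right_nils take_size_cat // drop_size_cat //.
  by rewrite !count_cat count_nseq /= mul0n.
have gap0 s : size s = size a -> ~~ head true s ->
    count (predC (@nilp A)) (gaps s a) =
    (count (predC (@nilp A)) (behead (gaps s a))).+1.
  by case: (a) a0 s => // x a' _ [|[] s].
rewrite (@sum_tuple_first_word _ _ _ _ _
  (fun s => if ~~ head true s then cut_value F f n m s pw else 0) true); last first.
  (* An unselected letter outside a makes a second non-empty word on the right. *)
  move=> s s' ss ss' ns; case: ifP => // h.
  apply: zero => //; first by rewrite flatten_nils /= !size_cat ss ss'.
  have h' : ~~ head true s by move: h; case: (s) (a) a0 ss => [|b s1] // [|y x].
  rewrite split_count // gap0 //.
  have : has (predC (@nilp A)) (cut_right s' w).
    rewrite has_predC cut_right_nilp //; apply: contra ns => /all_id_nseq ->.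
    by rewrite ss'.
  by rewrite has_count; lia.
rewrite (sum_tuple_prefix (F := fun s =>
  if ~~ head true (s ++ nseq (size (flatten w)) true)
  then cut_value F f n m (s ++ nseq (size (flatten w)) true) pw else 0)); last first.
  (* So does an unselected letter of a that follows a selected one. *)
  move=> s ss ns; case: ifP => // h.
  have h' : ~~ head true s by move: h; case: (s) (a) a0 ss => [|b s1] // [|y x].
  apply: zero => //; first by rewrite flatten_nils /= !size_cat ss size_nseq.
  rewrite split_count ?size_nseq // gap0 //.
  have : has (predC (@nilp A)) (behead (gaps s a)).
    by rewrite has_predC; apply: contra ns; apply: gaps_prefix_mask.
  by rewrite has_count; lia.
rewrite big_ord_recl /= subn0.
have -> : head true (nseq (size a) true ++ nseq (size (flatten w)) true) = true.
  by rewrite -nseqD; case: (_ + _)%N.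
rewrite add0r; apply: eq_bigr => j _.
rewrite /bump /= add1n; set s := false :: _.
have ja : (j.+1 <= size a)%N by [].
have tn : take j.+1 a != [::] by rewrite -size_eq0 size_takel.
have es : s = (nseq j.+1 false ++ nseq (size a - j.+1) true) ++ nseq (size (flatten w)) true.
  by [].
have ss : size (nseq j.+1 false ++ nseq (size a - j.+1) true) = size a.
  by rewrite size_cat !size_nseq subnKC.
have cl : cut_left s pw = nseq p [::] ++ drop j.+1 a :: w.
  rewrite es cut_left_nils take_size_cat // drop_size_cat // cut_left_true.
  by rewrite mask_prefix.
have cr : cut_right s pw = nseq p [::] ++ take j.+1 a ::
    nseq (size a - j.+1 + (size w + size (flatten w))) [::].
  rewrite es cut_right_nils take_size_cat // drop_size_cat // cut_right_true.
  by rewrite gaps_prefix // [nseq (_ - _ + _) _]nseqD.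
pose k := (p + 1 + (size a - j.+1 + (size w + size (flatten w))))%N.
rewrite (cut_valueE _ _ _ _ (k := k)); last first.
  by rewrite cr size_cat /= !size_nseq /k addn1 addSnnS.
have tk : (size (take j.+1 a)).+1 = j.+2 by rewrite size_takel.
rewrite cl cr (infinitesimal_word (L := L) f_inf tn (tL tn) (fL tn)) //; last first.
  by rewrite tk m_eq; lia.
rewrite FW; last 2 first.
- by rewrite -size_pw !size_cat.
- by rewrite /k flatten_nils /= !size_cat size_nseq size_drop /=; lia.
have ids : map eL (nseq p [::]) = nseq p (idB B) by rewrite map_nseq eL0.
have aL : arity (L (take j.+1 a)) = j.+2 by rewrite /arity tL.
have aeL : arity (eL (drop j.+1 a)) = (size a - j.+1).+1 by rewrite /arity teL size_drop.
rewrite nabla_wclass; first last.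
- by rewrite inputs_cat inputs_ids /inputs /= -/(inputs _) inputs_ids aL m_eq; lia.
- by rewrite size_cat /= !size_nseq /k addn1 addSnnS.
- by rewrite inputs_letters // /k flatten_nils /= !size_cat size_nseq size_drop /=; lia.
- by rewrite size_map -size_pw !size_cat.
congr wclass; rewrite map_cat ids compose_word_cat ?inputs_ids ?size_nseq //.
rewrite compose_word_idl ?size_nseq //.
rewrite [nseq (_ - _ + _) _]nseqD -cat_cons map_cons -(cat1s (eL _)) compose_word_cat; last first.
  by rewrite /inputs /= addn0 aeL size_nseq.
rewrite compose_word1; last by rewrite /= size_nseq aeL.
by rewrite -(inputs_letters w teL) compose_word_idr.
Qed.

End FirstWord.

Section Main.
Variables (C : numClosedFieldType) (B A : algType C) (starB : B -> B) (starA : A -> A).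
Variables (la : B -> A -> A) (ra : A -> B -> A) (E : {linear A -> B}).
Hypothesis space : opv_probability_space starB starA la ra E.
Local Notation mor := (bimorphism (W A) (words (HomB B))).
Variable Ehat : mor.
Hypothesis EM : hmorphism Ehat.
Hypothesis E1 : Ehat 1%N 1%N (Wclass 1 1 [:: [::]]) = wclass 1 1 [:: idB B].
Hypothesis EV : has_values Ehat (fun a s => E (\prod_(x <- sandwich la ra a s) x)).

Lemma moment_letters_exist : exists eL : seq A -> letter (HomB B),
  [/\ eL [::] = idB B, is_moment_letters ra E eL &
      forall a, Ehat 1%N (size a).+1 (Wclass _ _ [:: a]) = wclass _ _ [:: eL a]].
Proof.
have [L LP] := letters_of_values EV.
exists (fun a => if a is [::] then idB B else L a); split=> //; last first.
  by case=> [|x a]; [exact: E1 | have [] := LP (x :: a) isT].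
case=> [|x a]; split=> //.
- by move=> b [|//] _; rewrite app_idB big_nil (opv_E_unital space) mulr1.
- by have [] := LP (x :: a) isT.
move=> b [|b1 s] //= [ss]; have [_ _ ->] := LP (x :: a) isT; last by rewrite /= ss.
by rewrite sandwich_cons -(la_prod space) (E_la space).
Qed.

Lemma has_values_letters (f : mor) phi : has_values f phi ->
  exists L : seq A -> letter (HomB B), are_letters_of L phi /\
    forall a, a != [::] ->
      f 1%N (size a).+1 (Wclass _ _ [:: a]) = wclass _ _ [:: L a].
Proof.
move=> /letters_of_values [L LP]; exists L.
by split=> a /LP [].
Qed.

Lemma hmorphism_unital : unital Ehat.
Proof.
have [eL [e0 eP eV]] := moment_letters_exist.
move=> p; rewrite (hmorphism_word (L := eL) EM) ?size_nseq //.
- by rewrite map_nseq e0.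
- by move=> a; have [] := eP a.
by rewrite -[nseq _ _]cats0 flatten_nils addn0.
Qed.

(** On words made of empty words, [Ehat] is the unit. *)
Lemma hmorphism_nils n m w : size w = n -> (size w + size (flatten w))%N = m ->
  all (@nilp A) w -> Ehat n m (Wclass n m w) = mor_unit A B n m (Wclass n m w).
Proof.
move=> sw fw nw; rewrite mor_unit_word // nw.
have nm : n = m.
  by rewrite -fw (all_nilpP nw) sw -[nseq _ _]cats0 flatten_nils cats0 size_nseq addn0.
by move: nm fw => <- _; rewrite (all_nilpP nw) sw hmorphism_unital.
Qed.

Theorem free_fixed_point kappa (k : mor) : free_cumulants la ra E kappa ->
  infinitesimal k -> has_values k (fun a s => kappa (sandwich la ra a s)) ->
  forall n m (w : W A n m),
    Ehat n m w = mor_unit A B n m w + mor_prec_ext k Ehat n m w.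
Proof.
move=> hk k_inf kV n m.
have [eL [e0 eP eV]] := moment_letters_exist.
have [kL [kP kLV]] := has_values_letters kV.
have teL a : tag (eL a) = size a by have [] := eP a.
have tkL a : a != [::] -> tag (kL a) = size a by move=> /kP [].
apply: W_ext => [c u v|c u v|w sw fw].
- by rewrite linearP.
- exact: (linear_add3 (mor_unit A B n m) (k n m)
    (mor_prec k (bisub Ehat (mor_unit A B)) n m)).
have [nw|nw] := boolP (all (@nilp A) w).
  by rewrite (prec_nils _ k_inf) // addr0 hmorphism_nils.
rewrite mor_unit_word // (negPf nw) add0r (prec_cuts _ sw fw hmorphism_unital nw).
have [p [a [w' [an ew]]]] := split_first_nonempty nw.
subst w; rewrite (prec_first_word k_inf tkL kLV e0 teL _ an sw fw); last first.
  by move=> *; apply: (hmorphism_word EM).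
rewrite (hmorphism_word (L := eL) EM) // map_cat map_nseq e0 /=.
apply: wclass_letter_sum => [s hs|s ss].
  have [_ g2] := size_gaps (size_tuple s).
  by rewrite /= (inputs_letters _ teL) g2 teL.
by apply: (free_letter space eP hk kP an); rewrite ss /arity teL.
Qed.

Theorem boolean_fixed_point beta (b : mor) : boolean_cumulants la ra E beta ->
  infinitesimal b -> has_values b (fun a s => beta (sandwich la ra a s)) ->
  forall n m (w : W A n m),
    Ehat n m w = mor_unit A B n m w + mor_succ_ext Ehat b n m w.
Proof.
move=> hb b_inf bV n m.
have [eL [e0 eP eV]] := moment_letters_exist.
have [bL [bP bLV]] := has_values_letters bV.
have teL a : tag (eL a) = size a by have [] := eP a.
have tbL a : a != [::] -> tag (bL a) = size a by move=> /bP [].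
apply: W_ext => [c u v|c u v|w sw fw].
- by rewrite linearP.
- exact: (linear_add3 (mor_unit A B n m) (b n m)
    (mor_succ (bisub Ehat (mor_unit A B)) b n m)).
have [nw|nw] := boolP (all (@nilp A) w).
  by rewrite (succ_nils _ b_inf) // addr0 hmorphism_nils.
rewrite mor_unit_word // (negPf nw) add0r (succ_cuts _ sw fw hmorphism_unital nw).
have [p [a [w' [an ew]]]] := split_first_nonempty nw.
subst w; rewrite (succ_first_word b_inf tbL bLV e0 teL _ an sw fw); last first.
  by move=> *; apply: (hmorphism_word EM).
rewrite (hmorphism_word (L := eL) EM) // map_cat map_nseq e0 /=.
apply: wclass_letter_sum => [j _|s ss].
  have tn : take j.+1 a != [::] by rewrite -size_eq0 size_takel.
  have [tb _] := bP _ tn.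
  rewrite /= /inputs /= -/(inputs _) inputs_ids /arity tb size_takel // teL.
  by have := ltn_ord j; lia.
by apply: (boolean_letter space eP hb bP an); rewrite ss /arity teL.
Qed.

End Main.

Theorem proposition41 (R : realType) (B A : algType R[i])
    (starB : B -> B) (starA : A -> A) (la : B -> A -> A) (ra : A -> B -> A)
    (E : {linear A -> B})
    (kappa beta : seq A -> B)
    (k b Ehat : bimorphism (W A) (words (HomB B))) :
  opv_probability_space starB starA la ra E ->
  free_cumulants la ra E kappa ->
  boolean_cumulants la ra E beta ->
  infinitesimal k ->
  has_values k (fun a s => kappa (sandwich la ra a s)) ->
  infinitesimal b ->
  has_values b (fun a s => beta (sandwich la ra a s)) ->
  hmorphism Ehat ->
  Ehat 1%N 1%N (Wclass 1 1 [:: [::]]) = wclass 1 1 [:: idB B] ->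
  has_values Ehat (fun a s => E (\prod_(x <- sandwich la ra a s) x)) ->
  (forall n m (w : W A n m),
     Ehat n m w = mor_unit A B n m w + mor_prec_ext k Ehat n m w) /\
  (forall n m (w : W A n m),
     Ehat n m w = mor_unit A B n m w + mor_succ_ext Ehat b n m w).
Proof.
move=> space hk hb k_inf kV b_inf bV EM E1 EV; split.
  exact: (free_fixed_point space EM E1 EV hk k_inf kV).
exact: (boolean_fixed_point space EM E1 EV hb b_inf bV).
Qed.
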